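(* Let $1\leq p<\infty$ and let $f,g\in L'^{\,p}$. (a) Let $q,r\in[1,\infty]$ be such that $1/p+1/q=1+1/r$. Let $K_{p,q}=(c_pc_q/c_r)^{1/2}\alpha_q$. Then for all $t>0$ $$\|f\ast\Theta_t-g\ast\Theta_t\|'_r\leq K_{p,q}\|f-g\|'_p\,t^{-(1-1/q)/2}.$$ When $r=p$, $q=1$, this reads $\|f\ast\Theta_t-g\ast\Theta_t\|'_p\leq\|f-g\|'_p$. (b) Let $v,w:\mathbb{R}\times(0,\infty)\to\mathbb{R}$ be such that for each $t>0$ the functions $v_t=v(\cdot,t)$ and $w_t=w(\cdot,t)$ are in $L'^{\,p}$. Let $\epsilon>0$. Suppose $\|v_t-f\|'_p\to0$ and $\|w_t-g\|'_p\to0$ as $t\to0^+$. If $\|f-g\|'_p<\epsilon$ then for all small enough $t>0$ we have $\|v_t-w_t\|'_p<2\epsilon$.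
   Context: All functions are real-valued on $\mathbb{R}$; $L^p=L^p(\mathbb{R})$ with norm $\|\cdot\|_p$; $\mathcal{S}'$ is the space of tempered distributions on $\mathbb{R}$. For $1\leq p<\infty$, $L'^{\,p}=\{f\in\mathcal{S}' : f=F' \text{ (distributional derivative) for some } F\in L^p\}$. Each $f\in L'^{\,p}$ has a unique primitive $F\in L^p$ (i.e. $F'=f$), and $\|f\|'_p:=\|F\|_p$. A function is said to be in $L'^{\,p}$ if, as a distribution, it is the derivative of an $L^p$ function. The Gauss–Weierstrass heat kernel is $\Theta_t(x)=\frac{1}{2\sqrt{\pi t}}\exp(-x^2/(4t))$, $t>0$. For $f\in L'^{\,p}$ with primitive $F\in L^p$, the convolution is $f\ast\Theta_t(x)=\int_{-\infty}^\infty F(y)\Theta_t'(x-y)\,dy=(F\ast\Theta_t)'(x)$. Constants: $c_p=p^{1/p}/(p')^{1/p'}$ with $p,p'$ conjugate exponents, and $c_1=c_\infty=1$. $\alpha_1=1$, $\alpha_q=\frac{1}{(2\sqrt{\pi})^{1-1/q}q^{1/(2q)}}$ for $1<q<\infty$, $\alpha_\infty=\frac{1}{2\sqrt\pi}$. For $r=\infty$, $\|f\ast\Theta_t-g\ast\Theta_t\|'_\infty$ means $\|(F-G)\ast\Theta_t\|_\infty$, where $F,G$ are the $L^p$ primitives of $f,g$. *)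

(* Defs.v *)
From HB Require Import structures.
From mathcomp Require Import all_boot all_order all_algebra.
From mathcomp Require Import all_classical all_reals all_analysis.

Set Implicit Arguments.
Unset Strict Implicit.
Unset Printing Implicit Defensive.

Import Order.TTheory GRing.Theory Num.Theory.
Import numFieldNormedType.Exports.

Local Open Scope classical_set_scope.
Local Open Scope ring_scope.

Section SchwartzSpace.
Context {R : realType}.

Definition smooth (f : R -> R) := forall n x, derivable (derive1n n f) x 1.

Definition rapidly_decreasing (f : R -> R) :=
  forall k m : nat, exists M : R, forall x, `|x ^+ k * derive1n m f x| <= M.

Definition schwartz_pred : {pred R -> R} :=
  mem [set f | smooth f /\ rapidly_decreasing f].

Lemma derive1n_cst0 n : derive1n n (cst 0 : R -> R) = cst 0.
Proof.
elim: n => // n IH; rewrite derive1nS IH; apply/funext => x.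
by rewrite derive1E derive_cst.
Qed.

Lemma derive1n_lin a (f g : R -> R) n : smooth f -> smooth g ->
  derive1n n (a \*: f \+ g) = a \*: derive1n n f \+ derive1n n g.
Proof.
move=> sf sg; elim: n => // n IH; rewrite !derive1nS IH; apply/funext => x /=.
rewrite !derive1E deriveD//; last exact: derivableZ.
by rewrite deriveZ.
Qed.

Lemma schwartz_submod_closed : submod_closed schwartz_pred.
Proof.
split=> [|a f g].
  rewrite inE/=; split=> [n x|k m].
    by rewrite derive1n_cst0; exact: derivable_cst.
  by exists 0 => x; rewrite derive1n_cst0 mulr0 normr0.
rewrite !inE/= => -[sf df] [sg dg]; split=> [n x|k m].
  rewrite derive1n_lin//; apply: derivableD => //; exact: derivableZ.
have [Mf Mfle] := df k m; have [Mg Mgle] := dg k m.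
exists (`|a| * Mf + Mg) => x; rewrite derive1n_lin//= mulrDr.
rewrite (le_trans (ler_normD _ _))// lerD// mulrCA normrM ler_wpM2l//.
Qed.

HB.instance Definition _ :=
  GRing.isSubmodClosed.Build R (R -> R) schwartz_pred schwartz_submod_closed.

Record schwartz := Schwartz {
  schwartz_fun :> R -> R ; schwartzP : schwartz_fun \in schwartz_pred }.

HB.instance Definition _ := [isSub for schwartz_fun].
HB.instance Definition _ := [Choice of schwartz by <:].
HB.instance Definition _ := [SubChoice_isSubLmodule of schwartz by <:].

(* The Schwartz topology is the initial topology for this map, where the factor
   of index (k, m) carries the topology of uniform convergence: it is generated
   by the seminorms sup_x |x ^ k * phi^(m) x|. *)
Definition schwartz_jet (phi : schwartz) :
    prod_topology (fun _ : nat * nat => {uniform R -> R}) :=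
  fun km x => x ^+ km.1 * derive1n km.2 phi x.

HB.instance Definition _ :=
  Topological.copy schwartz (initial_topology schwartz_jet).

Lemma schwartz_deriv_subproof (phi : schwartz) : derive1 phi \in schwartz_pred.
Proof.
have := schwartzP phi; rewrite !inE/= => -[s d]; split=> [n|k m].
  by rewrite -derive1Sn; exact: s.
by rewrite -derive1Sn; exact: d.
Qed.

Definition schwartz_deriv (phi : schwartz) : schwartz :=
  Schwartz (schwartz_deriv_subproof phi).

End SchwartzSpace.
Arguments schwartz R : clear implicits.

Section Distributions.
Context {R : realType}.
Local Notation mu := (@lebesgue_measure R).
Implicit Types (p : R) (T f g : schwartz R -> R) (u F : R -> R).

Definition tempered T := scalar T /\ continuous T.

Definition dist_deriv T : schwartz R -> R := fun phi => - T (schwartz_deriv phi).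

Definition regular_dist u : schwartz R -> R :=
  fun phi => \int[mu]_x (u x * phi x).

(* T is the function u viewed as a tempered distribution.  Testing against
   compactly supported functions determines T, and does not require u * phi to
   be integrable for all Schwartz functions phi: a locally integrable function
   that is a tempered distribution may oscillate with unbounded growth. *)
Definition distribution_of u T :=
  [/\ locally_integrable setT u, tempered T &
    forall phi : schwartz R, (exists M, forall x, M < `|x| -> phi x = 0) ->
      T phi = regular_dist u phi].

Definition is_primitive p f F :=
  F \in Lfun mu p%:E /\ f = dist_deriv (regular_dist F).

Definition Lprime p : set (schwartz R -> R) :=
  [set f | tempered f /\ exists F, is_primitive p f F].

(* The primitive in L^p is unique up to equality almost everywhere; this chooses
   a representative. *)
Definition primitive p f : R -> R := xget (cst 0) (is_primitive p f).

Definition Lprime_norm p f : \bar R := 'N[mu]_p%:E[EFin \o primitive p f]%E.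

Definition heat_kernel (t x : R) : R :=
  (2 * Num.sqrt (pi * t))^-1 * expR (- (x ^+ 2 / (4 * t))).

(* F * Theta_t for a function F *)
Definition heat_conv_fun F (t x : R) : R :=
  \int[mu]_y (F y * heat_kernel t (x - y)).

(* f * Theta_t for f in L'^p *)
Definition heat_conv p f (t x : R) : R :=
  \int[mu]_y (primitive p f y * derive1 (heat_kernel t) (x - y)).

Definition heat_diff p f g t : R -> R := heat_conv p f t \- heat_conv p g t.

(* || f * Theta_t - g * Theta_t ||'_r, where the case r = +oo is by convention
   the sup norm of (F - G) * Theta_t *)
Definition heat_diff_norm p f g t (r : \bar R) : \bar R :=
  if r is r'%:E then Lprime_norm r' (regular_dist (heat_diff p f g t))
  else 'N[mu]_+oo[EFin \o heat_conv_fun (primitive p f \- primitive p g)%R t]%E.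

End Distributions.

Section Constants.
Context {R : realType}.
Implicit Types p q r : \bar R.

Definition young_c p : R :=
  if p is p0%:E then
    if p0 == 1 then 1
    else let p' := fine (hoelder_conjugate p) in p0 `^ p0^-1 / p' `^ p'^-1
  else 1.

Definition young_alpha q : R :=
  if q is q0%:E then
    if q0 == 1 then 1
    else ((2 * Num.sqrt pi) `^ (1 - q0^-1) * q0 `^ (2 * q0)^-1)^-1
  else (2 * Num.sqrt pi)^-1.

(* K_{p,q}; the exponent r is determined by 1/p + 1/q = 1 + 1/r *)
Definition young_K p q r : R :=
  Num.sqrt (young_c p * young_c q / young_c r) * young_alpha q.

End Constants.

(* Main.v *)
From HB Require Import structures.
Require Import Defs.
From mathcomp Require Import all_boot all_order all_algebra.
From mathcomp Require Import all_classical all_reals all_analysis.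
From mathcomp Require Import measurable_realfun ess_sup_inf ring lra.

(* After passing to primitives, the estimate is Young's inequality for the heat
   kernel with its sharp constant.  That inequality is equivalent to
     E (f(X)^a g(Y)^b) <= (E f(X))^a (E g(Y))^b,   f, g >= 0,
   for standard normal X, Y with correlation rho, a b rho^2 <= (1 - a)(1 - b):
   substitute f = F^(1/a) / density after rescaling.  To prove it, follow a
   random walk whose increments of size t are Gaussian with correlation rho.
   Over one step the inequality holds up to O(t^3), because the second order
   term of the Taylor expansion of x^a y^b along correlated increments is a
   quadratic form that the condition on rho makes nonpositive.  Summing n steps
   of size 1 / sqrt n leaves an error O(1 / sqrt n), and by rotation invariance
   the n steps recombine into one Gaussian step.  Functions that are not smooth
   are first regularized by the heat flow, which lowers the correlation a
   little; this loss disappears in the limit.  Duality turns the bilinear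
   estimate into the bound of the L^r norm of F * Theta_t.  The cases p = 1,
   q = 1 and r = oo follow from Jensen's and Hoelder's inequalities.

   A primitive in L^p is unique almost everywhere: if H is in L^p and H' = 0,
   then the convolution of H with the Schwartz function exp(-(d x)^(2n)) is a
   constant in L^p, hence 0, and n -> oo shows that the integral of H over any
   bounded interval vanishes.  Thus the norm of a distribution may be computed
   from any of its primitives, and (b) is the triangle inequality. *)

Set Implicit Arguments.
Unset Strict Implicit.
Unset Printing Implicit Defensive.

Import Order.TTheory GRing.Theory Num.Theory.
Import numFieldNormedType.Exports.
Local Open Scope classical_set_scope.
Local Open Scope ring_scope.

(** * Gaussian measures *)

Section affine.
Context {R : realType}.
Local Notation mu := (@lebesgue_measure R).

(** Since the constant must be sharp, no loss may accumulate over the steps of the walk. Increments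
    are therefore measured relative to the Gaussian averages of u and v over the step, not to the
    values at the starting point: the linear terms then have mean exactly zero, and only the
    quadratic form a b rho d e - a (1 - a) d^2 / 2 - b (1 - b) e^2 / 2 in the relative slopes d, e
    remains. The condition on rho is its negative semidefiniteness. The remainder is uniform over
    the steps because Gaussian averaging preserves two-sided bounds and a quadratic Taylor estimate
    with the same constants.

    For Young's inequality a = 1/p and b = 1 - 1/r, and rho is fixed by equality, a b rho^2 = (1 -
    a)(1 - b). Then 1 - rho^2 = (1/p - 1/r) / (a b), so p < r makes the joint density nondegenerate.

    For uniqueness, exp(-(d x)^(2n)) is convenient because its derivatives are polynomials times the
    function itself, which gives membership in the Schwartz space at once. *)

Lemma measurable_affine (a b : R) : measurable_fun [set: R] (fun x => a * x + b).
Proof. by apply: measurable_funD => //; exact: measurable_funM. Qed.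

Let aff (a b : R) : measurableTypeR R -> measurableTypeR R := fun x => a * x + b.
Let maff (a b : R) : measurable_fun setT (aff a b) := measurable_affine a b.

(** The right-hand side is a measure in [A] that gives half-open intervals their length, so
    uniqueness of Lebesgue measure identifies the two. *)
Lemma lebesgue_measure_affine (a b : R) (a0 : 0 < a) A : measurable A ->
  mu A = (a%:E * pushforward mu (aff a b) A)%E.
Proof.
move=> mA.
pose nu := mscale (NngNum (ltW a0)) (pushforward mu (aff a b)).
rewrite -[RHS]/(nu (maff a b) A).
apply: lebesgue_measure_unique => // _ [[x y]] _ <-/=.
rewrite /nu/mscale/= /pushforward.
have -> : aff a b @^-1` `]x, y] = `](x - b) / a, (y - b) / a]%classic.
  apply/seteqP; split => z /=; rewrite !in_itv/= /aff ltr_pdivrMr// ler_pdivlMr//;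
   by rewrite ltrBlDr lerBrDr mulrC.
rewrite !lebesgue_measure_itv/= !lte_fin ltr_pM2r ?invr_gt0// ltrBlDr subrK.
case: ifP => _; last by rewrite mule0.
by rewrite -EFinD -EFinM; congr EFin; field; rewrite gt_eqF.
Qed.

Lemma ge0_integral_affine (a b : R) (f : R -> \bar R) : 0 < a ->
  measurable_fun setT f -> (forall x, 0 <= f x)%E ->
  (\int[mu]_x f (a * x + b)%R = a^-1%:E * \int[mu]_x f x)%E.
Proof.
move=> a0 mf f0.
have := @ge0_integral_pushforward _ _ _ _ R (aff a b) (maff a b) mu setT f
  measurableT mf (fun y _ => f0 y).
rewrite preimage_setT => <-.
have -> : (\int[mu]_x f x = a%:E * \int[pushforward mu (aff a b)]_x f x)%E.
  rewrite -(ge0_integral_mscale _ measurableT (NngNum (ltW a0)))//.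
  by apply: eq_measure_integral => A mA _; exact: (lebesgue_measure_affine b a0).
by rewrite muleA -EFinM mulVf ?mul1e ?gt_eqF.
Qed.

Lemma ge0_integral_shift (b : R) (f : R -> \bar R) :
  measurable_fun setT f -> (forall x, 0 <= f x)%E ->
  (\int[mu]_x f (x + b)%R = \int[mu]_x f x)%E.
Proof.
move=> mf f0; have := ge0_integral_affine b ltr01 mf f0.
by rewrite invr1 mul1e => <-; apply: eq_integral => x _; rewrite mul1r.
Qed.

Lemma ge0_integral_opp (f : R -> \bar R) :
  measurable_fun setT f -> (forall x, 0 <= f x)%E ->
  (\int[mu]_x f (- x)%R = \int[mu]_x f x)%E.
Proof.
move=> mf f0.
pose opp : measurableTypeR R -> measurableTypeR R := fun x => - x.
have mopp : measurable_fun setT opp by exact: oppr_measurable.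
have := @ge0_integral_pushforward _ _ _ _ R opp mopp mu setT f
  measurableT mf (fun y _ => f0 y).
rewrite preimage_setT => <-.
by apply: eq_measure_integral => A mA _; exact: lebesgue_measureN.
Qed.

End affine.

(** * Integration against a measure with a density *)

Section density.
Context d (T : measurableType d) {R : realType}.
Variables (mu nu : {measure set T -> \bar R}) (w : T -> R).
Hypotheses (mw : measurable_fun setT w) (w0 : forall x, 0 <= w x).
Hypothesis nuE : forall A, measurable A -> nu A = (\int[mu]_(x in A) (w x)%:E)%E.
Import HBNNSimple.

(** [nuE] settles indicators; finite sums and monotone convergence along simple approximations do
    the rest. *)
Lemma ge0_integral_density (f : T -> \bar R) : measurable_fun setT f ->
  (forall x, 0 <= f x)%E -> (\int[nu]_x f x = \int[mu]_x (f x * (w x)%:E))%E.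
Proof.
move=> mf f0; pose f_ := nnsfun_approx measurableT mf.
have f_cvg x : EFin \o f_^~ x @ \oo --> f x by exact: cvg_nnsfun_approx.
transitivity (limn (fun n => \int[nu]_x (f_ n x)%:E)%E).
  rewrite -monotone_convergence//.
  - by apply: eq_integral => y _; apply/esym/cvg_lim => //; exact: f_cvg.
  - by move=> n; exact/measurable_EFinP/measurable_funP.
  - by move=> n y _; rewrite lee_fin.
  - by move=> y _ m n mn; rewrite lee_fin; exact/lefP/nd_nnsfun_approx.
have mfw n : measurable_fun setT (fun x => (f_ n x)%:E * (w x)%:E)%E.
  by apply: emeasurable_funM; exact/measurable_EFinP.
transitivity (limn (fun n => \int[mu]_x ((f_ n x)%:E * (w x)%:E))%E); last first.
  rewrite -monotone_convergence//; last 2 first.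
  - by move=> n y _; rewrite mule_ge0 ?lee_fin.
  - move=> y _ m n mn; rewrite lee_wpmul2r ?lee_fin//.
    exact/lefP/nd_nnsfun_approx.
  apply: eq_integral => y _; apply/cvg_lim => //.
  exact: (cvgeZr _ (f_cvg y)).
congr (limn _); apply/funext => n.
transitivity (\sum_(k \in range (f_ n)) \int[mu]_x (k * \1_(f_ n @^-1` [set k]) x * w x)%:E)%E.
  under eq_integral do rewrite fimfunE -fsumEFin//.
  rewrite ge0_integral_fsum//; last 2 first.
  - by move=> y; exact/measurable_EFinP/measurable_funM.
  - by move=> y x _; rewrite nnfun_muleindic_ge0.
  apply: eq_fsbigr => r /[!inE] -[x _ <-].
  rewrite integralZl_indic_nnsfun// integral_indic// setIT nuE//.
  rewrite integral_mkcond -ge0_integralZl_EFin//; last 2 first.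
  - move=> y _; rewrite patchE; case: ifP => // _; by rewrite lee_fin.
  - apply/(measurable_restrictT _ _).1 => //; apply: measurable_funTS.
    exact/measurable_EFinP.
  apply: eq_integral => y _; rewrite patchE indicE.
  by case: ifP => _; rewrite ?mule0 -?EFinM ?mulr1// mulr0 mul0r.
rewrite -ge0_integral_fsum//.
- apply: eq_integral => x _; rewrite fsumEFin// -EFinM; congr EFin.
  by rewrite [in RHS]fimfunE -mulr_fsuml.
- by move=> r; apply/measurable_EFinP/measurable_funM => //; exact/measurable_funM.
- by move=> r x _; rewrite EFinM mule_ge0// ?nnfun_muleindic_ge0// lee_fin.
Qed.

End density.

(** * Plane rotations preserve Lebesgue measure *)

Section shear.
Context {R : realType}.
Local Notation mu := (@lebesgue_measure R).

Lemma measurable_fun_lin2 (a b : R) :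
  measurable_fun [set: R * R] (fun p : R * R => a * p.1 + b * p.2).
Proof. by apply: measurable_funD; apply: measurable_funM. Qed.

(** On the slice at height y the shear is the translation by t y. *)
Lemma ge0_integral_shear1 (t : R) (f : R * R -> \bar R) :
  measurable_fun setT f -> (forall p, 0 <= f p)%E ->
  (\int[mu \x mu]_p f (p.1 + t * p.2, p.2)%R = \int[mu \x mu]_p f p)%E.
Proof.
move=> mf f0; rewrite !fubini_tonelli2//; last first.
  apply: measurableT_comp => //; apply: measurable_fun_pair => //.
  by apply: measurable_funD => //; apply: measurable_funM.
apply: eq_integral => y _; rewrite /fubini_G/=.
apply: (ge0_integral_shift (t * y) (f := fun x => f (x, y))) => //.
exact: measurable_fun_pair1.
Qed.

Lemma ge0_integral_shear2 (t : R) (f : R * R -> \bar R) :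
  measurable_fun setT f -> (forall p, 0 <= f p)%E ->
  (\int[mu \x mu]_p f (p.1, p.2 + t * p.1)%R = \int[mu \x mu]_p f p)%E.
Proof.
move=> mf f0; rewrite !fubini_tonelli1//; last first.
  apply: measurableT_comp => //; apply: measurable_fun_pair => //.
  by apply: measurable_funD => //; apply: measurable_funM.
apply: eq_integral => x _; rewrite /fubini_F/=.
apply: (ge0_integral_shift (t * x) (f := fun y => f (x, y))) => //.
exact: measurable_fun_pair2.
Qed.

(** A rotation is a product of three shears, with [t = s / (1 + c)] the tangent of half the angle;
    [0 <= c] keeps the denominator away from 0. *)
Lemma ge0_integral_rotation (c s : R) (f : R * R -> \bar R) :
  0 <= c -> c ^+ 2 + s ^+ 2 = 1 ->
  measurable_fun setT f -> (forall p, 0 <= f p)%E ->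
  (\int[mu \x mu]_p f (c * p.1 + s * p.2, - s * p.1 + c * p.2)%R
   = \int[mu \x mu]_p f p)%E.
Proof.
move=> c0 cs mf f0; pose t := s / (1 + c).
have c1 : 1 + c != 0 by rewrite gt_eqF// ltr_pwDl.
have mf2 : measurable_fun setT (fun p : R * R => f (p.1 + t * p.2, p.2)).
  apply: measurableT_comp => //; apply: measurable_fun_pair => //.
  by apply: measurable_funD => //; apply: measurable_funM.
have mf1 : measurable_fun setT (fun p : R * R =>
    f (p.1 + t * (p.2 - s * p.1), p.2 - s * p.1)).
  apply: measurableT_comp => //; apply: measurable_fun_pair => //.
    apply: measurable_funD => //; apply: measurable_funM => //.
    by apply: measurable_funB => //; apply: measurable_funM.
  by apply: measurable_funB => //; apply: measurable_funM.
rewrite -[RHS](ge0_integral_shear1 t mf f0).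
rewrite -[RHS](ge0_integral_shear2 (- s) mf2)//=.
under [in RHS]eq_integral do rewrite mulNr.
rewrite -[RHS](ge0_integral_shear1 t mf1)//=.
have st : s ^+ 2 = (1 - c) * (1 + c).
  by rewrite -[s ^+ 2](addrK (c ^+ 2)) (addrC (s ^+ 2)) cs; ring.
apply: eq_integral => -[x y] _ /=; congr (f (_, _)); rewrite /t.
- have -> : x + s / (1 + c) * y + s / (1 + c) * (y - s * (x + s / (1 + c) * y)) =
    x - x * s ^+ 2 / (1 + c) + s * y / (1 + c) * (2 - s ^+ 2 / (1 + c)) by field.
  by rewrite st; field.
- have -> : y - s * (x + s / (1 + c) * y) = y - s * x - s ^+ 2 / (1 + c) * y by field.
  by rewrite st; field.
Qed.

End shear.

(** * The standard normal law on the line and on the plane *)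

Section gaussian.
Context {R : realType}.
Local Notation mu := (@lebesgue_measure R).

Definition gauss : probability (measurableTypeR R) R := normal_prob 0 1.
Definition gauss_pdf (x : R) := normal_pdf 0 1 x.

Lemma gauss_pdfE x : gauss_pdf x = (Num.sqrt (2 * pi))^-1 * expR (- (x ^+ 2 / 2)).
Proof.
rewrite /gauss_pdf normal_pdfE ?oner_neq0// /normal_peak /normal_fun expr1n mul1r.
by rewrite subr0 mulr_natl mulNr.
Qed.

Lemma gauss_pdf_pair x y x' y' : x ^+ 2 + y ^+ 2 = x' ^+ 2 + y' ^+ 2 ->
  gauss_pdf x * gauss_pdf y = gauss_pdf x' * gauss_pdf y'.
Proof. by move=> h; rewrite !gauss_pdfE [LHS]mulrACA [RHS]mulrACA -!expRD -!opprD -!mulrDl h. Qed.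

Lemma gauss_pdf_gt0 x : 0 < gauss_pdf x.
Proof. by rewrite gauss_pdfE mulr_gt0 ?expR_gt0// invr_gt0 sqrtr_gt0 mulr_gt0 ?pi_gt0. Qed.

Lemma measurable_gauss_pdf : measurable_fun setT gauss_pdf.
Proof. exact: measurable_normal_pdf. Qed.

Lemma ge0_integral_gauss (f : R -> \bar R) : measurable_fun setT f ->
  (forall x, 0 <= f x)%E -> (\int[gauss]_x f x = \int[mu]_x (f x * (gauss_pdf x)%:E))%E.
Proof.
exact: (@ge0_integral_density _ (measurableTypeR R) R mu gauss gauss_pdf
  measurable_gauss_pdf (fun x => ltW (gauss_pdf_gt0 x)) (fun _ _ => erefl)).
Qed.

Local Notation gauss2 := (gauss \x gauss)%E.

Lemma ge0_integral_gauss2 (f : R * R -> \bar R) : measurable_fun setT f ->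
  (forall x, 0 <= f x)%E ->
  (\int[gauss2]_p f p = \int[mu \x mu]_p (f p * (gauss_pdf p.1 * gauss_pdf p.2)%:E))%E.
Proof.
move=> mf f0.
have mg : measurable_fun setT (fun p : R * R => (gauss_pdf p.1 * gauss_pdf p.2)%:E).
  apply/measurable_EFinP; apply: measurable_funM;
    by apply: (measurableT_comp measurable_gauss_pdf).
have g0 x : (0 <= (gauss_pdf x)%:E)%E by exact/ltW/gauss_pdf_gt0.
rewrite !fubini_tonelli1//; last 2 first.
- exact: emeasurable_funM.
- by move=> p; rewrite mule_ge0// EFinM mule_ge0.
rewrite ge0_integral_gauss; last 2 first.
- exact: measurable_fun_fubini_tonelli_F.
- by move=> x; apply: integral_ge0.
apply: eq_integral => x _; rewrite /fubini_F/=.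
have mfx := measurable_fun_pair2 x mf.
rewrite ge0_integral_gauss// muleC -ge0_integralZl//=.
- by apply: eq_integral => y _; rewrite muleCA EFinM.
- by apply: (emeasurable_funM mfx); apply/measurable_EFinP; exact: measurable_gauss_pdf.
- by move=> y _; exact: mule_ge0.
Qed.

Lemma gauss2_rotation (c s : R) (f : R * R -> \bar R) :
  0 <= c -> c ^+ 2 + s ^+ 2 = 1 ->
  measurable_fun setT f -> (forall p, 0 <= f p)%E ->
  (\int[gauss2]_p f (c * p.1 + s * p.2, - s * p.1 + c * p.2)%R
   = \int[gauss2]_p f p)%E.
Proof.
move=> c0 cs mf f0; rewrite !ge0_integral_gauss2//; last first.
  by apply: measurableT_comp => //; apply: measurable_fun_pair;
    exact: measurable_fun_lin2.
rewrite -[RHS](ge0_integral_rotation c0 cs); last 2 first.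
- apply: emeasurable_funM => //; apply/measurable_EFinP; apply: measurable_funM;
    by apply: (measurableT_comp measurable_gauss_pdf).
- by move=> p; rewrite mule_ge0// lee_fin mulr_ge0// ltW// gauss_pdf_gt0.
apply: eq_integral => -[x y] _ /=; congr (_ * _%:E)%E.
apply: gauss_pdf_pair.
by rewrite -[LHS]mul1r -cs; ring.
Qed.

(** The rotation with cosine [a / r] and sine [b / r] turns [a * p.1 + b * p.2] into [r] times one
    coordinate, and the other coordinate integrates to 1. *)
Lemma gauss_sum (a b r : R) (f : R -> \bar R) : 0 <= a -> 0 < r ->
  a ^+ 2 + b ^+ 2 = r ^+ 2 ->
  measurable_fun setT f -> (forall x, 0 <= f x)%E ->
  (\int[gauss2]_p f (a * p.1 + b * p.2)%R = \int[gauss]_x f (r * x)%R)%E.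
Proof.
move=> a0 r0 abr mf f0.
have mfr : measurable_fun setT (fun p : R * R => f (r * p.1)).
  by apply: measurableT_comp => //; exact: measurable_funM.
have := @gauss2_rotation (a / r) (b / r) (fun p => f (r * p.1)%R).
rewrite divr_ge0 ?(ltW r0)//= => /(_ isT).
have -> : (a / r) ^+ 2 + (b / r) ^+ 2 = 1.
  by rewrite !expr_div_n -mulrDl abr divff// sqrf_eq0 gt_eqF.
move=> /(_ erefl mfr (fun=> f0 _)).
under eq_integral => p _.
  rewrite (_ : r * _ = a * p.1 + b * p.2); last by field; rewrite gt_eqF.
  over.
move=> ->; rewrite fubini_tonelli1//; apply: eq_integral => x _.
rewrite /fubini_F/= integral_cst//.
by rewrite (_ : _ setT = 1%E) ?mule1//; exact: (@probability_setT _ _ _ gauss).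
Qed.

End gaussian.
#[global] Arguments gauss {R} : simpl never.

(** * Correlated Gaussian variables *)

Section powR_taylor.
Context {R : realType}.
Implicit Types a s x y : R.

(** Concavity of the power, obtained from Young's inequality for the numbers y^s and 1 with
    exponents 1/s and 1/(1 - s). *)
Lemma powR_le_tangent y s : 0 <= y -> 0 < s < 1 -> y `^ s <= 1 + s * (y - 1).
Proof.
move=> y0 /andP[s0 s1].
have := @conjugate_powR R (y `^ s) 1 s^-1 (1 - s)^-1 (powR_ge0 _ _) ler01.
rewrite !invr_gt0 subr_gt0 !invrK s0 s1 => /(_ isT isT).
rewrite addrC subrK => /(_ erefl); rewrite mulr1 -powRrM divff ?gt_eqF//.
by rewrite powRr1// powR1 mul1r => /le_trans; apply; lra.
Qed.

(** The second Taylor polynomial of x^a at 1 plus a cubic term, whose coefficient [k] is taken to be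
    0 to the left of 1 and a (1 - a) / 3 to the right. [dT] is the derivative of the gap to x^a. *)
Let T a k x := 1 + a * (x - 1) - a * (1 - a) / 2 * (x - 1) ^+ 2 + k * (x - 1) ^+ 3.
Let dT a k x := a - a * (1 - a) * (x - 1) + 3 * k * (x - 1) ^+ 2 - a * x `^ (a - 1).

Let derT a k x : 0 < x -> is_derive x 1 (fun x => T a k x - x `^ a) (dT a k x).
Proof.
move=> x0; rewrite /T /dT; have := is_derive1_powR a x0 => h.
apply: is_derive_eq.
by rewrite /GRing.scale/=; field.
Qed.

Let contT a k x y : 0 < x -> {within `[x, y], continuous (fun x => T a k x - x `^ a)}.
Proof.
move=> x0; apply: derivable_within_continuous => z /[!in_itv]/= /andP[xz _].
by have [] := @derT a k z (lt_le_trans x0 xz).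
Qed.

(** The gap between polynomial and power vanishes at 1, so by the mean value theorem only the sign
    of [dT] on each side of 1 matters, and the tangent bound decides it. *)
Lemma powR_le_taylor a x : 0 < a < 1 -> 0 < x ->
  x `^ a <= 1 + a * (x - 1) - a * (1 - a) / 2 * (x - 1) ^+ 2 + `|x - 1| ^+ 3.
Proof.
move=> /andP[a0 a1] x0; have s01 : 0 < 1 - a < 1 by apply/andP; split; lra.
have T1 k : T a k 1 - 1 `^ a = 0 by rewrite /T subrr powR1; ring.
have [x1|x1] := leP 1 x; last first.
- have xz z : z \in `]x, 1[ -> 0 < z by rewrite in_itv/= => /andP[/(lt_trans x0)].
  have [c cx] := MVT x1 (fun z zx => @derT a 0 z (xz z zx)) (contT (y := 1) x0).
  rewrite T1 sub0r => h.
  have c0 := xz _ cx; move: cx; rewrite in_itv/= => /andP[xc c1].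
  suff : dT a 0 c <= 0.
    move=> d0; have : 0 <= T a 0 x - x `^ a.
      by rewrite -oppr_le0 h mulr_le0_ge0// subr_ge0 ltW.
    rewrite subr_ge0 => /le_trans; apply; rewrite /T mul0r addr0 lerDl.
    by rewrite exprn_ge0.
  rewrite /dT mulr0 mul0r addr0 subr_le0.
  rewrite -mulrA -[X in X - _]mulr1 -mulrBr ler_pM2l//.
  have -> : a - 1 = - (1 - a) by ring.
  (* The claim is 1 - w <= c^(-(1 - a)) with w = (1 - a)(c - 1). Multiplying by c^(1 - a) <= 1 + w
     reduces it to (1 - w)(1 + w) <= 1. *)
  have := powR_le_tangent (ltW c0) s01.
  rewrite powRN; have := powR_gt0 (1 - a) c0; set p := c `^ _ => p0 pc.
  rewrite -[p^-1]mul1r ler_pdivlMr//.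
  have X0 : 0 <= 1 - (1 - a) * (c - 1) by nra.
  apply: (le_trans (ler_wpM2l X0 pc)).
  have -> : (1 - (1 - a) * (c - 1)) * (1 + (1 - a) * (c - 1)) =
    1 - ((1 - a) * (c - 1)) ^+ 2 by ring.
  by rewrite gerBl sqr_ge0.
- have z0 z : z \in `]1, x[ -> 0 < z by rewrite in_itv/= => /andP[/(lt_trans ltr01)].
  (* This dominates the true third coefficient a (1 - a)(2 - a) / 6 and is at most 1, so the cubic
     term stays below that of the statement. *)
  pose k := a * (1 - a) / 3.
  have k1 : k <= 1 by rewrite /k; nra.
  have [c cx] := MVT_segment x1 (fun z zx => @derT a k z (z0 z zx)) (contT (y := x) ltr01).
  rewrite T1 subr0 => h.
  move: cx; rewrite in_itv/= => /andP[c1 cx].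
  have c0 : 0 < c by exact: lt_le_trans c1.
  suff : 0 <= dT a k c.
    move=> d0; have : 0 <= T a k x - x `^ a by rewrite h mulr_ge0// subr_ge0.
    rewrite subr_ge0 => /le_trans; apply; rewrite /T lerD2l ger0_norm ?subr_ge0//.
    by rewrite ler_piMl// exprn_ge0// subr_ge0.
  rewrite /dT /k.
  have -> : a - a * (1 - a) * (c - 1) + 3 * (a * (1 - a) / 3) * (c - 1) ^+ 2 -
      a * c `^ (a - 1) =
      a * (1 - (1 - a) * (c - 1) + (1 - a) * (c - 1) ^+ 2 - c `^ (a - 1)) by field.
  apply: mulr_ge0; first exact: ltW.
  have -> : a - 1 = - (1 - a) by ring.
  (* The tangent bound is taken at 1/c, since c^(a - 1) is the power 1 - a of 1/c. *)
  have := @powR_le_tangent c^-1 _ _ s01; rewrite invr_ge0 (ltW c0) => /(_ isT).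
  rewrite -powR_inv1 ?(ltW c0)// -powRrM mulN1r powR_inv1 ?(ltW c0)// => h2.
  rewrite subr_ge0 (le_trans h2)//.
  have -> : c^-1 - 1 = - (c - 1) + (c - 1) ^+ 2 / c by field; rewrite gt_eqF.
  suff : (c - 1) ^+ 2 / c <= (c - 1) ^+ 2 by nra.
  by rewrite ler_pdivrMr// ler_peMr// sqr_ge0.
Qed.

End powR_taylor.

(** * Second order expansion of a product of two powers *)

Section powR_product.
Context {R : realType}.

(** Here [al] and [be] stand for relative increments and [al1], [be1] for their linear parts. First
    order terms keep the exact increments, whose mean will vanish; second order terms use the linear
    parts, whose moments are explicit. [L] carries the growth in the Gaussian variable. *)
Lemma powR_mul_le_taylor (a b al be al1 be1 t L : R) :
  0 < a < 1 -> 0 < b < 1 -> -1 < al -> -1 < be -> 0 <= t <= 1 -> 1 <= L ->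
  `|al| <= t * L -> `|be| <= t * L -> `|al1| <= t * L -> `|be1| <= t * L ->
  `|al - al1| <= t ^+ 2 * L -> `|be - be1| <= t ^+ 2 * L ->
  (1 + al) `^ a * (1 + be) `^ b <=
  1 + a * al + b * be + (a * b * (al1 * be1) - a * (1 - a) / 2 * al1 ^+ 2
    - b * (1 - b) / 2 * be1 ^+ 2) + 16 * (t ^+ 3 * L ^+ 6).
Proof.
move=> a01 b01 alN beN /andP[t0 t1] L1 hal hbe hal1 hbe1 hda hdb.
set A := a * (1 - a) / 2; set B := b * (1 - b) / 2.
have A01 : 0 <= A <= 1.
  by rewrite /A; case/andP: a01 => a0 a1; apply/andP; split; nra.
have B01 : 0 <= B <= 1.
  by rewrite /B; case/andP: b01 => b0 b1; apply/andP; split; nra.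
have ha := powR_le_taylor a01 (x := 1 + al); rewrite -/A in ha.
have hb := powR_le_taylor b01 (x := 1 + be); rewrite -/B in hb.
rewrite -[1 + al - 1]addrAC subrr add0r in ha.
rewrite -[1 + be - 1]addrAC subrr add0r in hb.
have {}ha := ha ltac:(lra); have {}hb := hb ltac:(lra).
apply: (le_trans (ler_pM (powR_ge0 _ _) (powR_ge0 _ _) ha hb)).
(* Every error term carries at least t^3, and the largest power of L, the sixth, comes from the
   product of the two cubic terms; as t <= 1 <= L, [E] bounds them all. *)
set E := t ^+ 3 * L ^+ 6.
have L0 : 0 <= L by lra.
have tE k m : (3 <= k)%N -> (m <= 6)%N -> t ^+ k * L ^+ m <= E.
  move=> k3 m6; rewrite ler_pM ?exprn_ge0//; last exact: ler_weXn2l.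
  by apply: ler_wiXn2l => //; rewrite ?t0.
have E0 : 0 <= E by rewrite mulr_ge0// exprn_ge0.
have mon (x y : R) i j m n : `|x| <= t ^+ i * L ^+ m -> `|y| <= t ^+ j * L ^+ n ->
    `|x * y| <= t ^+ (i + j) * L ^+ (m + n).
  by move=> xi yj; rewrite normrM !exprD mulrACA ler_pM.
have low (c x : R) : 0 <= c <= 1 -> `|x| <= E -> - E <= c * x <= E.
  move=> /andP[c0 c1] xE; rewrite -ler_norml normrM (ger0_norm c0).
  by rewrite (le_trans _ xE)// ler_piMl.
have al_ : `|al| <= t ^+ 1 * L ^+ 1 by rewrite !expr1.
have be_ : `|be| <= t ^+ 1 * L ^+ 1 by rewrite !expr1.
have al1_ : `|al1| <= t ^+ 1 * L ^+ 1 by rewrite !expr1.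
have be1_ : `|be1| <= t ^+ 1 * L ^+ 1 by rewrite !expr1.
have da_ : `|al - al1| <= t ^+ 2 * L ^+ 1 by rewrite !expr1.
have db_ : `|be - be1| <= t ^+ 2 * L ^+ 1 by rewrite !expr1.
have al2 := mon _ _ _ _ _ _ al_ al_; have be2 := mon _ _ _ _ _ _ be_ be_.
have al3 : `|(`|al| ^+ 3)| <= t ^+ 3 * L ^+ 3.
  by rewrite normrX normr_id -exprMn lerXn2r ?nnegrE ?mulr_ge0.
have be3 : `|(`|be| ^+ 3)| <= t ^+ 3 * L ^+ 3.
  by rewrite normrX normr_id -exprMn lerXn2r ?nnegrE ?mulr_ge0.
have a01' : 0 <= a <= 1 by case/andP: a01 => ? ?; rewrite !ltW.
have b01' : 0 <= b <= 1 by case/andP: b01 => ? ?; rewrite !ltW.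
have cM (c d : R) : 0 <= c <= 1 -> 0 <= d <= 1 -> 0 <= c * d <= 1.
  move=> /andP[c0 c1] /andP[d0 d1]; rewrite mulr_ge0//=.
  by rewrite -[1]mulr1 ler_pM.
have bnd (c x : R) i m : 0 <= c <= 1 -> `|x| <= t ^+ i * L ^+ m ->
    (3 <= i)%N -> (m <= 6)%N -> - E <= c * x <= E.
  move=> c01 xi i3 m6; apply: low => //; exact: le_trans xi (tE _ _ i3 m6).
have one : 0 <= (1 : R) <= 1 by rewrite ler01 lexx.
(* [r1] to [r10] are the terms of degree at least three in the product of the two bounds; [q1] to
   [q6] are the costs of passing to [al1] and [be1] in the quadratic terms. Together they account
   for the sixteen multiples of [E]. *)
have /andP[_ r1] := bnd _ _ _ _ one al3 isT isT.
have /andP[_ r2] := bnd _ _ _ _ one be3 isT isT.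
have /andP[r3 _] := bnd _ _ _ _ (cM _ _ a01' B01) (mon _ _ _ _ _ _ al_ be2) isT isT.
have /andP[_ r4] := bnd _ _ _ _ a01' (mon _ _ _ _ _ _ al_ be3) isT isT.
have /andP[r5 _] := bnd _ _ _ _ (cM _ _ b01' A01) (mon _ _ _ _ _ _ be_ al2) isT isT.
have /andP[_ r6] := bnd _ _ _ _ (cM _ _ A01 B01) (mon _ _ _ _ _ _ al2 be2) isT isT.
have /andP[r7 _] := bnd _ _ _ _ A01 (mon _ _ _ _ _ _ al2 be3) isT isT.
have /andP[_ r8] := bnd _ _ _ _ b01' (mon _ _ _ _ _ _ be_ al3) isT isT.
have /andP[r9 _] := bnd _ _ _ _ B01 (mon _ _ _ _ _ _ be2 al3) isT isT.
have /andP[_ r10] := bnd _ _ _ _ one (mon _ _ _ _ _ _ al3 be3) isT isT.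
have /andP[_ q1] := bnd _ _ _ _ (cM _ _ a01' b01') (mon _ _ _ _ _ _ da_ be_) isT isT.
have /andP[_ q2] := bnd _ _ _ _ (cM _ _ a01' b01') (mon _ _ _ _ _ _ al1_ db_) isT isT.
have /andP[q3 _] := bnd _ _ _ _ A01 (mon _ _ _ _ _ _ da_ al_) isT isT.
have /andP[q4 _] := bnd _ _ _ _ A01 (mon _ _ _ _ _ _ da_ al1_) isT isT.
have /andP[q5 _] := bnd _ _ _ _ B01 (mon _ _ _ _ _ _ db_ be_) isT isT.
have /andP[q6 _] := bnd _ _ _ _ B01 (mon _ _ _ _ _ _ db_ be1_) isT isT.
move: (`|al| ^+ 3) (`|be| ^+ 3) r1 r2 r3 r4 r5 r6 r7 r8 r9 r10 q1 q2 q3 q4 q5 q6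
  => al3' be3' r1 r2 r3 r4 r5 r6 r7 r8 r9 r10 q1 q2 q3 q4 q5 q6.
rewrite -subr_ge0; rewrite !mul1r in r1 r2 r10.
lra.
Qed.

End powR_product.

(** * Integrability under the normal law *)

Section gaussian_moments.
Context {R : realType}.
Local Notation mu := (@lebesgue_measure R).
Local Notation N := (@gauss R).
Local Notation N2 := ((@gauss R) \x (@gauss R))%E.

(** Against [gauss_pdf] the integrand is a multiple of the normal density of variance 2. *)
Lemma integrable_expR_sqr4 : N.-integrable setT (fun z : R => (expR (z ^+ 2 / 4))%:E).
Proof.
have mf : measurable_fun setT (fun z : R => expR (z ^+ 2 / 4)).
  by apply: measurableT_comp => //; exact: measurable_funM.
apply/integrableP; split; first exact/measurable_EFinP.
under eq_integral do rewrite gee0_abs ?lee_fin ?expR_ge0//.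
rewrite ge0_integral_gauss//; last exact/measurable_EFinP.
pose s : R := Num.sqrt 2; have s0 : s != 0 by rewrite gt_eqF// sqrtr_gt0.
have s2 : s ^+ 2 = 2 by rewrite sqr_sqrtr.
pose c : R := (Num.sqrt (2 * pi))^-1 / normal_peak s.
have c0 : 0 <= c by rewrite mulr_ge0// ?invr_ge0 ?normal_peak_ge0.
rewrite (_ : (\int[mu]_x _)%E = (\int[mu]_x (c%:E * (normal_pdf 0 s x)%:E))%E).
  rewrite ge0_integralZl_EFin//.
  - by rewrite integral_normal_pdf mule1 ltry.
  - by move=> x _; rewrite lee_fin normal_pdf_ge0.
  - by apply/measurable_EFinP; exact: measurable_normal_pdf.
apply: eq_integral => x _; rewrite -!EFinM; congr EFin.
rewrite gauss_pdfE normal_pdfE//= [RHS]mulrA /c divfK ?gt_eqF ?normal_peak_gt0//.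
rewrite mulrCA -expRD; congr (_ * expR _).
by rewrite s2 subr0; field.
Qed.

(** A common bound for all monomials of degree at most two in the coordinates. Its product form
    allows its sixth power, the size of the error in [powR_mul_le_taylor], to be integrated one
    coordinate at a time. *)
Definition gauss_weight (p : R * R) : R := (1 + p.1 ^+ 2) * (1 + p.2 ^+ 2).

Lemma gauss_weight_ge1 p : 1 <= gauss_weight p.
Proof. by rewrite -[1]mulr1 ler_pM// lerDl sqr_ge0. Qed.

Lemma measurable_gauss_weight : measurable_fun setT gauss_weight.
Proof.
by apply: measurable_funM; apply: measurable_funD => //; apply: measurable_funX.
Qed.

Lemma integrable_sqr6 : N.-integrable setT (fun z : R => ((1 + z ^+ 2) ^+ 6)%:E).
Proof.
(* 1 + z^2 <= 24 exp(z^2 / 24), and the sixth power of the right side is 24^6 exp(z^2 / 4). *)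
have h := integrableZl measurableT (24 ^+ 6) integrable_expR_sqr4.
apply: le_integrable h => //.
  apply/measurable_EFinP; apply: measurable_funX.
  by apply: measurable_funD => //; exact: measurable_funX.
move=> z _ /=; rewrite lee_fin.
have z0 : 0 <= z ^+ 2 by exact: sqr_ge0.
rewrite !ger0_norm ?mulr_ge0 ?expR_ge0 ?exprn_ge0 ?addr_ge0//.
have -> : z ^+ 2 / 4 = 6%:R * (z ^+ 2 / 24) by field.
rewrite expRM_natl -exprMn lerXn2r ?nnegrE ?mulr_ge0 ?expR_ge0 ?addr_ge0//.
by have := expR_ge1Dx (z ^+ 2 / 24); lra.
Qed.

Lemma integrable_gauss_weight6 : N2.-integrable setT (fun p => (gauss_weight p ^+ 6)%:E).
Proof.
have m6 : measurable_fun setT (fun z : R => ((1 + z ^+ 2) ^+ 6)%:E).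
  by case/integrableP: integrable_sqr6.
have s60 (z : R) : (0 <= ((1 + z ^+ 2) ^+ 6)%:E)%E.
  by rewrite lee_fin exprn_ge0// addr_ge0// sqr_ge0.
apply/integrable12ltyP.
  by apply/measurable_EFinP; apply: measurable_funX; exact: measurable_gauss_weight.
set K := (\int[N]_z ((1 + z ^+ 2) ^+ 6)%:E)%E.
have K0 : (0 <= K)%E by apply: integral_ge0.
have Kfin : K \is a fin_num.
  by apply: integrable_fin_num => //; exact: integrable_sqr6.
rewrite (_ : (\int[_]_x _)%E = (\int[N]_x (K * ((1 + x ^+ 2) ^+ 6)%:E))%E).
  by rewrite ge0_integralZl// -/K lte_mul_pinfty ?ge0_fin_numE// -ge0_fin_numE.
apply: eq_integral => x _; rewrite muleC -ge0_integralZl//.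
apply: eq_integral => y _; rewrite /= -EFinM -exprMn ger0_norm//.
by rewrite exprn_ge0// (le_trans ler01)// gauss_weight_ge1.
Qed.

Lemma integrable_gauss2_le (f : R * R -> R) (k : nat) (c : R) : (k <= 6)%N ->
  measurable_fun setT f -> (forall p, `|f p| <= c * gauss_weight p ^+ k) ->
  N2.-integrable setT (EFin \o f).
Proof.
move=> k6 mf fc; have h := integrableZl measurableT c integrable_gauss_weight6.
apply: le_integrable h => //; first exact/measurable_EFinP.
move=> p _; rewrite lee_fin/=.
have w1 := gauss_weight_ge1 p.
have c0 : 0 <= c.
  have := le_trans (normr_ge0 _) (fc p).
  by rewrite pmulr_lge0// exprn_gt0// (lt_le_trans ltr01).
rewrite (le_trans (fc p))// (le_trans _ (ler_norm _))// ler_wpM2l//.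
exact: ler_weXn2l.
Qed.

End gaussian_moments.

(** * Moments of the Gaussian vector up to degree two *)

Section gauss2_expectation.
Context {R : realType}.
Local Notation N := (@gauss R).
Local Notation N2 := ((@gauss R) \x (@gauss R))%E.

Lemma gauss_setT : N setT = 1%E.
Proof. exact: (@probability_setT _ _ _ N). Qed.

Lemma gauss2_setT : N2 setT = 1%E.
Proof.
rewrite -setXTT; transitivity (N setT * N setT)%E.
  exact: product_measure1E.
by rewrite gauss_setT mule1.
Qed.

Lemma Rintegral_gauss2_cst (r : R) : \int[N2]_p r = r.
Proof.
rewrite Rintegral_cst// (_ : (_ : set _ -> \bar R) setT = 1%E) ?mulr1//.
exact: gauss2_setT.
Qed.

Lemma integrable_gauss2_bounded (f : R * R -> R) (c : R) : measurable_fun setT f ->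
  (forall p, `|f p| <= c) -> N2.-integrable setT (EFin \o f).
Proof.
move=> mf fc; apply: (integrable_gauss2_le (k := 0) (c := c)) => // p.
by rewrite expr0 mulr1.
Qed.

Lemma integrable_gauss_bounded (f : R -> R) (c : R) : measurable_fun setT f ->
  (forall p, `|f p| <= c) -> N.-integrable setT (EFin \o f).
Proof.
move=> mf fc; apply: measurable_bounded_integrable => //.
- by rewrite ltey_eq (_ : (_ : set _ -> \bar R) setT = 1%E)//; exact: gauss_setT.
- exists c; split; first exact: num_real.
  by move=> y cy x _; exact: (le_trans (fc x) (ltW cy)).
Qed.

Lemma gauss_weight_bounds (p : R * R) :
  [/\ `|p.1| <= gauss_weight p, `|p.2| <= gauss_weight p,
      p.1 ^+ 2 <= gauss_weight p, p.2 ^+ 2 <= gauss_weight p &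
      `|p.1 * p.2| <= gauss_weight p].
Proof.
rewrite normrM -(real_normK (num_real p.1)) -(real_normK (num_real p.2)).
rewrite /gauss_weight -(real_normK (num_real p.1)) -(real_normK (num_real p.2)).
have := normr_ge0 p.1; have := normr_ge0 p.2.
move: `|p.1| `|p.2| => x y y0 x0; rewrite mulrDl mul1r !mulrDr !mulr1.
have := sqr_ge0 x; have := sqr_ge0 y; have := sqr_ge0 (x - 1).
have := sqr_ge0 (y - 1); have := sqr_ge0 (x - y).
have : 0 <= x ^+ 2 * y ^+ 2 by rewrite mulr_ge0 ?sqr_ge0.
by rewrite !sqrrB !expr1n; split; lra.
Qed.

Let I1 : N2.-integrable setT (EFin \o (fun p : R * R => p.1)).
Proof.
apply: (integrable_gauss2_le (k := 1) (c := 1)) => //; first exact: measurable_fst.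
by move=> p; rewrite mul1r expr1; have [] := gauss_weight_bounds p.
Qed.

Let I2 : N2.-integrable setT (EFin \o (fun p : R * R => p.2)).
Proof.
apply: (integrable_gauss2_le (k := 1) (c := 1)) => //; first exact: measurable_snd.
by move=> p; rewrite mul1r expr1; have [] := gauss_weight_bounds p.
Qed.

Let I11 : N2.-integrable setT (EFin \o (fun p : R * R => p.1 ^+ 2)).
Proof.
apply: (integrable_gauss2_le (k := 1) (c := 1)) => //.
  exact: measurable_funX.
by move=> p; rewrite mul1r expr1 ger0_norm ?sqr_ge0//; have [] := gauss_weight_bounds p.
Qed.

Let I22 : N2.-integrable setT (EFin \o (fun p : R * R => p.2 ^+ 2)).
Proof.
apply: (integrable_gauss2_le (k := 1) (c := 1)) => //.
  exact: measurable_funX.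
by move=> p; rewrite mul1r expr1 ger0_norm ?sqr_ge0//; have [] := gauss_weight_bounds p.
Qed.

Let I12 : N2.-integrable setT (EFin \o (fun p : R * R => p.1 * p.2)).
Proof.
apply: (integrable_gauss2_le (k := 1) (c := 1)) => //.
  exact: measurable_funM.
by move=> p; rewrite mul1r expr1; have [] := gauss_weight_bounds p.
Qed.

Let quad (c c1 c2 c11 c12 c22 : R) (p : R * R) :=
  c + (c1 * p.1 + (c2 * p.2 + (c11 * p.1 ^+ 2 + (c12 * (p.1 * p.2) + c22 * p.2 ^+ 2)))).

Let m1 : R := \int[N2]_p p.1.
Let m2 : R := \int[N2]_p p.2.
Let m12 : R := \int[N2]_p (p.1 * p.2).
Let m22 : R := \int[N2]_p (p.2 ^+ 2).

(** The variance enters [one_step] as a nonnegative factor of a nonpositive form and as part of a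
    constant, so its value stays unevaluated. *)
Definition gauss_var : R := \int[N2]_p (p.1 ^+ 2).

Lemma gauss_var_ge0 : 0 <= gauss_var.
Proof. by apply: Rintegral_ge0 => p _; rewrite sqr_ge0. Qed.

Let Equad c c1 c2 c11 c12 c22 :
  N2.-integrable setT (EFin \o quad c c1 c2 c11 c12 c22) /\
  \int[N2]_p quad c c1 c2 c11 c12 c22 p =
  c + (c1 * m1 + (c2 * m2 + (c11 * gauss_var + (c12 * m12 + c22 * m22)))).
Proof.
have Ic (k : R) : N2.-integrable setT (EFin \o (fun=> k)).
  exact: (integrable_gauss2_bounded (c := `|k|)).
have Z (k : R) f : N2.-integrable setT (EFin \o f) ->
    N2.-integrable setT (EFin \o (fun p => k * f p)).
  by move=> If; exact: (integrableZl measurableT k If).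
have D f g : N2.-integrable setT (EFin \o f) -> N2.-integrable setT (EFin \o g) ->
    N2.-integrable setT (EFin \o (fun p => f p + g p)).
  by move=> If Ig; exact: (integrableD measurableT If Ig).
have J5 := D _ _ (Z c12 _ I12) (Z c22 _ I22).
have J4 := D _ _ (Z c11 _ I11) J5.
have J3 := D _ _ (Z c2 _ I2) J4.
have J2 := D _ _ (Z c1 _ I1) J3.
split; first exact: D (Ic c) J2.
rewrite /quad (RintegralD measurableT (Ic c) J2) Rintegral_gauss2_cst.
rewrite (RintegralD measurableT (Z c1 _ I1) J3) (RintegralD measurableT (Z c2 _ I2) J4).
rewrite (RintegralD measurableT (Z c11 _ I11) J5) (RintegralD measurableT (Z c12 _ I12) (Z c22 _ I22)).
by rewrite !RintegralZl.
Qed.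

Let rot (s : R) (f : R * R -> R) : s ^+ 2 = 1 -> measurable_fun setT f ->
  (forall p, 0 <= f p) -> \int[N2]_p f (s * p.2, - s * p.1) = \int[N2]_p f p.
Proof.
move=> s1 mf f0; congr fine.
have := @gauss2_rotation R 0 s (EFin \o f) (lexx 0).
rewrite expr0n/= add0r => /(_ s1); rewrite -/N2 => <-.
- by apply: eq_integral => p _ /=; rewrite !mul0r add0r addr0.
- exact/measurable_EFinP.
- by move=> p; rewrite lee_fin.
Qed.

Let quadE f c c1 c2 c11 c12 c22 : (forall p, f p = quad c c1 c2 c11 c12 c22 p) ->
  \int[N2]_p f p =
  c + (c1 * m1 + (c2 * m2 + (c11 * gauss_var + (c12 * m12 + c22 * m22)))).
Proof.
move=> fE; rewrite -(Equad c c1 c2 c11 c12 c22).2.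
by apply: eq_Rintegral => p _.
Qed.

Let msq (a b c : R) : measurable_fun setT (fun p : R * R => (a + b * p.1 + c * p.2) ^+ 2).
Proof.
apply: measurable_funX; apply: measurable_funD; last exact: measurable_funM.
by apply: measurable_funD => //; exact: measurable_funM.
Qed.

(** The rotation lemma asks for nonnegative integrands, while the first and mixed moments have
    signed ones; squares of affine functions are nonnegative and recover these moments by
    polarization. *)
Let rotE (s a b c : R) : s ^+ 2 = 1 ->
  let F (x y z : R) := x ^+ 2 + (2 * x * y * m1 + (2 * x * z * m2 + (y ^+ 2 * gauss_var + (2 * y * z * m12 + z ^+ 2 * m22)))) in
  F a (- s * c) (s * b) = F a b c.
Proof.
move=> s1 F; have := rot s1 (msq a b c) (fun p => sqr_ge0 _) => /=.
rewrite (@quadE _ (a ^+ 2) (2 * a * (- s * c)) (2 * a * (s * b)) ((- s * c) ^+ 2)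
  (2 * (- s * c) * (s * b)) ((s * b) ^+ 2)); last by move=> p; rewrite /quad; ring.
rewrite (@quadE _ (a ^+ 2) (2 * a * b) (2 * a * c) (b ^+ 2)
  (2 * b * c) (c ^+ 2)); last by move=> p; rewrite /quad; ring.
by [].
Qed.

(* Invariance under quarter turns makes the first moments and the mixed moment
   vanish and the two variances equal. *)
Lemma gauss2_quad c c1 c2 c11 c12 c22 :
  let f (p : R * R) := c + (c1 * p.1 + (c2 * p.2 + (c11 * p.1 ^+ 2 + (c12 * (p.1 * p.2) + c22 * p.2 ^+ 2)))) in
  N2.-integrable setT (EFin \o f) /\ \int[N2]_p f p = c + (c11 + c22) * gauss_var.
Proof.
have [If Ef] := Equad c c1 c2 c11 c12 c22; split => //.
rewrite -/(quad c c1 c2 c11 c12 c22) Ef.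
have N1 : (-1 : R) ^+ 2 = 1 by rewrite sqrrN expr1n.
have := @rotE 1 1 1 0 (expr1n _ _); have := @rotE (-1) 1 1 0 N1.
have := @rotE 1 1 0 1 (expr1n _ _); have := @rotE 1 0 1 1 (expr1n _ _).
rewrite /= => h1 h2 h3 h4.
have -> : m22 = gauss_var by lra.
have -> : m1 = 0 by lra.
have -> : m2 = 0 by lra.
have -> : m12 = 0 by lra.
lra.
Qed.

End gauss2_expectation.

(** * One step of the correlated random walk *)

Section one_step.
Context {R : realType}.
Local Notation N := (@gauss R).
Local Notation N2 := ((@gauss R) \x (@gauss R))%E.

(** [D] plays the derivative, but only the Taylor inequality is recorded: it passes to Gaussian
    averages by mere integration, with the same [C]. The lower bound [de] makes relative increments
    meaningful. *)
Definition nice (de C : R) (u : R -> R) := [/\ measurable_fun setT u,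
  forall x, de <= u x <= C &
  exists D : R -> R, [/\ measurable_fun setT D, forall x, `|D x| <= C &
    forall x h, `|u (x + h) - u x - D x * h| <= C * h ^+ 2]].

(* This is convolution with the heat kernel at time t^2 / 2. *)
Definition heat (t : R) (u : R -> R) (x : R) : R := \int[N]_z u (x + t * z).

Variables (rho sg : R).
Hypotheses (rho0 : 0 <= rho) (rs1 : rho ^+ 2 + sg ^+ 2 = 1).

Let corr (p : R * R) := rho * p.1 + sg * p.2.

Lemma measurable_shift_scale (u : R -> R) (x t : R) : measurable_fun setT u ->
  measurable_fun setT (fun z => u (x + t * z)).
Proof.
move=> mu; apply: measurableT_comp => //; apply: measurable_funD => //; exact: measurable_funM.
Qed.

Lemma heatE (u : R -> R) (t x : R) (C : R) : measurable_fun setT u ->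
  (forall x, 0 <= u x <= C) -> (heat t u x)%:E = (\int[N]_z (u (x + t * z))%:E)%E.
Proof.
move=> mu uC; rewrite /heat /Rintegral fineK//; apply: integrable_fin_num => //.
apply: (integrable_gauss_bounded (c := C)); first exact: measurable_shift_scale.
by move=> z; have /andP[u0 u1] := uC (x + t * z); rewrite ger0_norm.
Qed.

(** Both [p.1] and [corr p] are standard normal, the latter because rho^2 + sg^2 = 1. *)
Lemma heat_gauss2 (u : R -> R) (t x : R) : measurable_fun setT u ->
  (forall x, 0 <= u x) -> heat t u x = \int[N2]_p u (x + t * p.1) /\
  heat t u x = \int[N2]_p u (x + t * corr p).
Proof.
move=> mu u0; have m : measurable_fun setT (fun z => (u (x + t * z))%:E).
  by apply/measurable_EFinP; exact: measurable_shift_scale.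
have u0' z : (0 <= (u (x + t * z))%:E)%E by rewrite lee_fin.
split; congr fine.
- have /= h := @gauss_sum R 1 0 1 _ ler01 ltr01 _ m u0'.
  rewrite !expr1n expr0n addr0 in h.
  apply: etrans; first (apply: etrans; last exact: (esym (h erefl)));
    by apply: eq_integral => z _; rewrite ?mul1r ?mul0r ?addr0.
- have /= h := @gauss_sum R rho sg 1 _ rho0 ltr01 _ m u0'.
  rewrite rs1 expr1n in h; rewrite [RHS](h erefl).
  by apply: eq_integral => z _; rewrite mul1r.
Qed.

Let corr_sqr p : corr p ^+ 2 <= gauss_weight p.
Proof.
have h : corr p ^+ 2 <= (rho ^+ 2 + sg ^+ 2) * (p.1 ^+ 2 + p.2 ^+ 2).
  rewrite -subr_ge0 /corr.
  have -> : (rho ^+ 2 + sg ^+ 2) * (p.1 ^+ 2 + p.2 ^+ 2) - (rho * p.1 + sg * p.2) ^+ 2 =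
    (rho * p.2 - sg * p.1) ^+ 2 by ring.
  exact: sqr_ge0.
rewrite (le_trans h)// rs1 mul1r /gauss_weight.
have : 0 <= p.1 ^+ 2 * p.2 ^+ 2 by rewrite mulr_ge0// sqr_ge0.
by rewrite mulrDl mul1r mulrDr mulr1; lra.
Qed.

Let corr_norm p : `|corr p| <= gauss_weight p.
Proof.
rewrite -(@ler_pXn2r _ 2)// ?nnegrE//; last exact: le_trans (gauss_weight_ge1 p).
rewrite real_normK ?num_real// (le_trans (corr_sqr p))//.
by rewrite -[leLHS]expr1 ler_weXn2l// gauss_weight_ge1.
Qed.

Let measurable_corr : measurable_fun setT corr.
Proof. exact: measurable_fun_lin2. Qed.

(* Taylor estimate for u along a centred direction X, a linear form in the
   Gaussian vector p. *)
Let expand (de C t x : R) (u : R -> R) (D : R -> R) (X : R * R -> R) :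
  0 < de -> 0 <= t <= 1 -> measurable_fun setT u ->
  (forall x, de <= u x <= C) -> measurable_fun setT D ->
  (forall x, `|D x| <= C) ->
  (forall x h, `|u (x + h) - u x - D x * h| <= C * h ^+ 2) ->
  measurable_fun setT X -> (forall p, `|X p| <= gauss_weight p) ->
  (forall p, X p ^+ 2 <= gauss_weight p) ->
  N2.-integrable setT (EFin \o X) -> \int[N2]_p X p = 0 ->
  N2.-integrable setT (EFin \o (fun p => X p ^+ 2)) -> \int[N2]_p (X p ^+ 2) = gauss_var ->
  heat t u x = \int[N2]_p u (x + t * X p) ->
  let al p := u (x + t * X p) / heat t u x - 1 in
  let d := D x / heat t u x in
  let L p := C * (2 + gauss_var) / de * gauss_weight p in
  [/\ de <= heat t u x <= C, N2.-integrable setT (EFin \o al), \int[N2]_p al p = 0 &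
   forall p, [/\ -1 < al p, `|al p| <= t * L p, `|d * t * X p| <= t * L p &
     `|al p - d * t * X p| <= t ^+ 2 * L p]].
Proof.
move=> de0 /andP[t0 t1] mu uC mD DC uT mX XW X2W IX EX IX2 EX2 Hu al d L.
have C0 : 0 < C by have /andP[h1 h2] := uC 0; exact: lt_le_trans (le_trans h1 h2).
have mux : measurable_fun setT (fun p => u (x + t * X p)).
  by apply: measurableT_comp => //; apply: measurable_funD => //; exact: measurable_funM.
have Iu : N2.-integrable setT (EFin \o (fun p => u (x + t * X p))).
  apply: (integrable_gauss2_bounded (c := C)) => // p.
  by have /andP[u0 u1] := uC (x + t * X p); rewrite ger0_norm// (le_trans (ltW de0)).
have Icst (c : R) : N2.-integrable setT (EFin \o (fun=> c)).
  exact: (integrable_gauss2_bounded (c := `|c|)).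
have hC : de <= heat t u x <= C.
  apply/andP; split; rewrite Hu.
    rewrite -[leLHS]Rintegral_gauss2_cst.
    apply: (le_Rintegral measurableT (Icst de) Iu) => p _.
    by have /andP[] := uC (x + t * X p).
  rewrite -[leRHS]Rintegral_gauss2_cst.
  apply: (le_Rintegral measurableT Iu (Icst C)) => p _.
  by have /andP[] := uC (x + t * X p).
have /andP[h_de h_C] := hC.
have h0 : 0 < heat t u x by exact: lt_le_trans h_de.
have IZ (c : R) f : N2.-integrable setT (EFin \o f) ->
    N2.-integrable setT (EFin \o (fun p => c * f p)).
  by move=> If; exact: (integrableZl measurableT c If).
have ID f g : N2.-integrable setT (EFin \o f) -> N2.-integrable setT (EFin \o g) ->
    N2.-integrable setT (EFin \o (fun p => f p + g p)).
  by move=> If Ig; exact: (integrableD measurableT If Ig).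
have alE : al = (fun p => (heat t u x)^-1 * u (x + t * X p) + (-1)).
  by apply/funext => p; rewrite /al mulrC.
have Ial : N2.-integrable setT (EFin \o al).
  by rewrite alE; apply: ID => //; exact: IZ.
split => //.
  rewrite alE (RintegralD measurableT (IZ _ _ Iu) (Icst _)) Rintegral_gauss2_cst.
  by rewrite RintegralZl// -Hu mulVf ?subrr// gt_eqF.
(* the mean of u is within O(t^2) of u x because X is centred *)
have hx : `|u x - heat t u x| <= C * t ^+ 2 * gauss_var.
  have J1 := ID _ _ (Icst (u x)) (ID _ _ (IZ (D x * t) _ IX) (IZ (-1) _ Iu)).
  have J2 := IZ (C * t ^+ 2) _ IX2.
  have -> : u x - heat t u x =
      \int[N2]_p (u x + (D x * t * X p + - 1 * u (x + t * X p))).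
    rewrite (RintegralD measurableT (Icst (u x)) (ID _ _ (IZ (D x * t) _ IX) (IZ (-1) _ Iu))).
    rewrite (RintegralD measurableT (IZ (D x * t) _ IX) (IZ (-1) _ Iu)).
    rewrite !RintegralZl// Rintegral_gauss2_cst EX mulr0 add0r -Hu.
    by rewrite mulN1r.
  apply: (le_trans (le_normr_Rintegral measurableT J1)).
  rewrite -EX2 -RintegralZl//.
  apply: (le_Rintegral measurableT _ J2).
    exact: (integrable_norm J1).
  move=> p _; rewrite -normrN.
  have -> : - (u x + (D x * t * X p + -1 * u (x + t * X p))) =
    u (x + t * X p) - u x - D x * (t * X p) by ring.
  by rewrite (le_trans (uT _ _))// exprMn mulrA.
have g0 := @gauss_var_ge0 R.
have dV0 : 0 <= de^-1 by rewrite invr_ge0 ltW.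
have C00 := ltW C0.
(* The bracket is a Taylor remainder plus the gap between [u x] and its average, both O(t^2);
   together they give [1 + gauss_var]. The linear part contributes one more unit, whence
   [2 + gauss_var] in [L]. *)
have key p : `|al p - d * t * X p| <= t ^+ 2 * (C * (1 + gauss_var) / de * gauss_weight p).
  have -> : al p - d * t * X p =
    (heat t u x)^-1 * (u (x + t * X p) - u x - D x * (t * X p) + (u x - heat t u x)).
    by rewrite /al /d; field; rewrite gt_eqF.
  rewrite normrM normfV (gtr0_norm h0).
  have W1 := gauss_weight_ge1 p.
  apply: (@le_trans _ _ (de^-1 * (C * (t * X p) ^+ 2 + C * t ^+ 2 * gauss_var))).
    apply: ler_pM => //; first by rewrite invr_ge0 ltW.
      by rewrite lef_pV2.
    by rewrite (le_trans (ler_normD _ _))// lerD.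
  have -> : t ^+ 2 * (C * (1 + gauss_var) / de * gauss_weight p) =
    de^-1 * (C * t ^+ 2 * ((1 + gauss_var) * gauss_weight p)) by ring.
  apply: ler_wpM2l => //.
  have -> : C * (t * X p) ^+ 2 + C * t ^+ 2 * gauss_var =
    C * t ^+ 2 * (X p ^+ 2 + gauss_var) by ring.
  apply: ler_wpM2l; first by rewrite mulr_ge0// sqr_ge0.
  rewrite mulrDl mul1r lerD//.
  by rewrite ler_peMr.
have key2 p : `|d * t * X p| <= t * (C / de * gauss_weight p).
  rewrite /d !normrM normfV (gtr0_norm h0) (ger0_norm t0) -mulrA mulrCA.
  apply: ler_wpM2l => //; apply: ler_pM => //.
    by rewrite mulr_ge0// invr_ge0 ltW.
  by apply: ler_pM => //; rewrite ?lef_pV2// invr_ge0 ltW.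
have W0 (p : R * R) : 0 <= gauss_weight p by exact: le_trans (gauss_weight_ge1 p).
have Cd : 0 <= C / de by rewrite mulr_ge0.
have L0 (p : R * R) : 0 <= C * (1 + gauss_var) / de * gauss_weight p.
  have g1 : 0 <= 1 + @gauss_var R by rewrite addr_ge0.
  exact: (mulr_ge0 (mulr_ge0 (mulr_ge0 C00 g1) dV0) (W0 p)).
move=> p; split.
- rewrite /al ltrBrDl subrr divr_gt0//; have /andP[+ _] := uC (x + t * X p).
  exact: lt_le_trans.
- rewrite -[al p](subrK (d * t * X p)) (le_trans (ler_normD _ _))//.
  have := lerD (key p) (key2 p); move/le_trans; apply.
  have -> : L p = C * (1 + gauss_var) / de * gauss_weight p + C / de * gauss_weight p.
    by rewrite /L; ring.
  rewrite [leRHS]mulrDr lerD2r; apply: ler_wpM2r; first by exact: L0.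
  by rewrite expr2 ler_piMl.
- rewrite (le_trans (key2 p))// ler_wpM2l// /L ler_wpM2r// ler_wpM2r//.
  by rewrite ler_peMr// -[X in X <= _]addr0 lerD// ler1n.
- rewrite (le_trans (key p))// ler_wpM2l ?sqr_ge0// /L ler_wpM2r// ler_wpM2r//.
  by rewrite ler_wpM2l// lerD2r ler1n.
Qed.

Let Icorr2 : N2.-integrable setT (EFin \o (fun p => corr p ^+ 2)) /\
  \int[N2]_p (corr p ^+ 2) = gauss_var.
Proof.
have [I2 E2] := gauss2_quad 0 0 0 (rho ^+ 2) (2 * rho * sg) (sg ^+ 2).
have fE : (fun p : R * R => corr p ^+ 2) = (fun p => 0 + (0 * p.1 + (0 * p.2 +
    (rho ^+ 2 * p.1 ^+ 2 + (2 * rho * sg * (p.1 * p.2) + sg ^+ 2 * p.2 ^+ 2))))).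
  by apply/funext => p; rewrite /corr; ring.
by rewrite fE; split; [exact: I2|rewrite [LHS]E2 add0r rs1 mul1r].
Qed.

Let Icorr : N2.-integrable setT (EFin \o corr) /\ \int[N2]_p corr p = 0.
Proof.
have [I2 E2] := gauss2_quad 0 rho sg 0 0 0.
have fE : corr = (fun p => 0 + (rho * p.1 + (sg * p.2 +
    (0 * p.1 ^+ 2 + (0 * (p.1 * p.2) + 0 * p.2 ^+ 2))))).
  by apply/funext => p; rewrite /corr; ring.
by rewrite fE; split; [exact: I2|rewrite [LHS]E2 add0r addr0 mul0r].
Qed.

Let Ifst : N2.-integrable setT (EFin \o (fun p : R * R => p.1)) /\ \int[N2]_p p.1 = 0 :> R.
Proof.
have [I2 E2] := gauss2_quad (0 : R) 1 0 0 0 0.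
have fE : (fun p : R * R => p.1) = (fun p => 0 + (1 * p.1 + (0 * p.2 +
    (0 * p.1 ^+ 2 + (0 * (p.1 * p.2) + 0 * p.2 ^+ 2))))).
  by apply/funext => p; ring.
by rewrite fE; split; [exact: I2|rewrite [LHS]E2 add0r addr0 mul0r].
Qed.

Let Ifst2 : N2.-integrable setT (EFin \o (fun p : R * R => p.1 ^+ 2)).
Proof.
have [I2 E2] := gauss2_quad (0 : R) 0 0 1 0 0.
have fE : (fun p : R * R => p.1 ^+ 2) = (fun p => 0 + (0 * p.1 + (0 * p.2 +
    (1 * p.1 ^+ 2 + (0 * (p.1 * p.2) + 0 * p.2 ^+ 2))))).
  by apply/funext => p; ring.
by rewrite fE.
Qed.

(** [K] is chosen before [u], [v], [t], [x] and [y]: it knows the functions only through [de] and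
    [C]. This uniformity is what allows the step to be repeated on averaged functions. *)
Lemma one_step (a b de C : R) : 0 < a < 1 -> 0 < b < 1 ->
  a * b * rho ^+ 2 <= (1 - a) * (1 - b) -> 0 < de ->
  exists2 K, 0 <= K & forall u v, nice de C u -> nice de C v ->
  forall t x y : R, 0 <= t <= 1 ->
  (\int[N2]_p (u (x + t * p.1) `^ a * v (y + t * (rho * p.1 + sg * p.2)) `^ b)%:E
    <= (heat t u x `^ a * heat t v y `^ b + K * t ^+ 3)%:E)%E.
Proof.
move=> a01 b01 abr de0.
pose ka := C * (2 + gauss_var) / de; pose w6 : R := \int[N2]_p (gauss_weight p ^+ 6).
have w60 : 0 <= w6.
  by apply: Rintegral_ge0 => p _; rewrite exprn_ge0// (le_trans ler01)// gauss_weight_ge1.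
(* U^a V^b is at most C^a C^b, and 16 ka^6 w6 is the mean of the remainder in [powR_mul_le_taylor],
   per t^3, with L equal to ka times [gauss_weight]. *)
exists (C `^ a * C `^ b * (16 * ka ^+ 6 * w6)).
  apply: mulr_ge0; first by rewrite mulr_ge0 ?powR_ge0.
  by apply: mulr_ge0 => //; apply: mulr_ge0 => //; exact: exprn_even_ge0.
move=> u v [mu uC [Du [mDu DuC uT]]] [mv vC [Dv [mDv DvC vT]]] t x y t01.
have C0 : 0 < C by have /andP[h1 h2] := uC 0; exact: lt_le_trans (le_trans h1 h2).
have deC : de <= C by have /andP[h1 h2] := uC 0; exact: le_trans h2.
have u0 z : 0 <= u z by have /andP[h1 _] := uC z; rewrite (le_trans (ltW de0)).
have v0 z : 0 <= v z by have /andP[h1 _] := vC z; rewrite (le_trans (ltW de0)).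
have ka1 : 1 <= ka.
  rewrite /ka -mulrA mulrCA; have := @gauss_var_ge0 R => g0.
  have : 1 <= C / de by rewrite ler_pdivlMr// mul1r.
  by move=> h; rewrite -[1]mulr1 ler_pM//; lra.
have bnd (p : R * R) := gauss_weight_bounds p.
have X1 (p : R * R) : `|p.1| <= gauss_weight p by have [] := bnd p.
have X2 (p : R * R) : p.1 ^+ 2 <= gauss_weight p by have [] := bnd p.
have [hu Ial Eal pal] := expand (x := x) de0 t01 mu uC mDu DuC uT (@measurable_fst _ _ R R)
  X1 X2 Ifst.1 Ifst.2 Ifst2 erefl (heat_gauss2 t x mu u0).1.
have [hv Ibe Ebe pbe] := expand (x := y) de0 t01 mv vC mDv DvC vT measurable_corr
  corr_norm corr_sqr Icorr.1 Icorr.2 Icorr2.1 Icorr2.2 (heat_gauss2 t y mv v0).2.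
set U := heat t u x in hu Ial Eal pal *; set V := heat t v y in hv Ibe Ebe pbe *.
set al := (fun p : R * R => u (x + t * p.1) / U - 1) in Ial Eal pal.
set be := (fun p : R * R => v (y + t * corr p) / V - 1) in Ibe Ebe pbe.
pose d := Du x / U; pose e := Dv y / V.
rewrite -/d in pal; rewrite -/e in pbe.
have /andP[hU hUC] := hu; have /andP[hV hVC] := hv.
have U0 : 0 < U by exact: lt_le_trans hU.
have V0 : 0 < V by exact: lt_le_trans hV.
have /andP[t0 t1] := t01.
(* Coefficients in p.1^2, p.1 p.2 and p.2^2 of the second order term for the linear parts d t p.1
   and e t [corr p]. *)
pose c11 := a * b * (d * e * rho * t ^+ 2) - a * (1 - a) / 2 * (d * t) ^+ 2
  - b * (1 - b) / 2 * (e * t) ^+ 2 * rho ^+ 2.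
pose c12 := a * b * (d * e * sg * t ^+ 2) - b * (1 - b) / 2 * (e * t) ^+ 2 * (2 * rho * sg).
pose c22 := - (b * (1 - b) / 2 * (e * t) ^+ 2 * sg ^+ 2).
have [Iq Eq] := gauss2_quad 1 0 0 c11 c12 c22.
set q := (fun p : R * R => _) in Iq Eq.
pose k6 := 16 * t ^+ 3 * ka ^+ 6.
pose c0 := U `^ a * V `^ b.
have c00 : 0 <= c0 by rewrite mulr_ge0 ?powR_ge0.
pose H (p : R * R) := c0 * (q p + (a * al p + (b * be p + k6 * gauss_weight p ^+ 6))).
have IZ (c : R) f : N2.-integrable setT (EFin \o f) ->
    N2.-integrable setT (EFin \o (fun p => c * f p)).
  by move=> If; exact: (integrableZl measurableT c If).
have ID f g : N2.-integrable setT (EFin \o f) -> N2.-integrable setT (EFin \o g) ->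
    N2.-integrable setT (EFin \o (fun p => f p + g p)).
  by move=> If Ig; exact: (integrableD measurableT If Ig).
have J4 := IZ k6 _ integrable_gauss_weight6.
have J3 := ID _ _ (IZ b _ Ibe) J4.
have J2 := ID _ _ (IZ a _ Ial) J3.
have J1 := ID _ _ Iq J2.
have IH : N2.-integrable setT (EFin \o H) by exact: IZ c0 _ J1.
have EH : \int[N2]_p H p = c0 * ((1 + (c11 + c22) * gauss_var) + k6 * w6).
  rewrite RintegralZl// (RintegralD measurableT Iq J2) Eq.
  rewrite (RintegralD measurableT (IZ a _ Ial) J3) (RintegralD measurableT (IZ b _ Ibe) J4).
  rewrite !RintegralZl//; last exact: integrable_gauss_weight6.
  by rewrite Eal Ebe !mulr0 !add0r.
(* The sum is t^2 times a bracket; multiplied by a (1 - a), the bracket becomes minus half a square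
   minus a nonnegative multiple of (1 - a)(1 - b) - a b rho^2. *)
have qneg : c11 + c22 <= 0.
  have -> : c11 + c22 = t ^+ 2 * (a * b * rho * (d * e) - a * (1 - a) / 2 * d ^+ 2
      - b * (1 - b) / 2 * e ^+ 2 * (rho ^+ 2 + sg ^+ 2)) by rewrite /c11 /c22; ring.
  rewrite rs1 mulr1 mulr_ge0_le0 ?sqr_ge0//.
  case/andP: a01 => a0 a1; case/andP: b01 => b0 b1.
  have A0 : 0 < a * (1 - a) by rewrite mulr_gt0// subr_gt0.
  rewrite -(pmulr_rle0 _ A0) -oppr_ge0.
  have -> : - (a * (1 - a) * (a * b * rho * (d * e) - a * (1 - a) / 2 * d ^+ 2
      - b * (1 - b) / 2 * e ^+ 2)) =
    (a * (1 - a) * d - a * b * rho * e) ^+ 2 / 2 +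
    a * b * e ^+ 2 / 2 * ((1 - a) * (1 - b) - a * b * rho ^+ 2) by field.
  rewrite addr_ge0//; first by rewrite divr_ge0// sqr_ge0.
  rewrite mulr_ge0 ?subr_ge0// divr_ge0// mulr_ge0 ?sqr_ge0// mulr_ge0 ?ltW//.
have main (p : R * R) : u (x + t * p.1) `^ a * v (y + t * corr p) `^ b <= H p.
  have [al1 al2 al3 al4] := pal p; have [be1 be2 be3 be4] := pbe p.
  have -> : u (x + t * p.1) = U * (1 + al p) by rewrite /al; field; rewrite gt_eqF.
  have -> : v (y + t * corr p) = V * (1 + be p) by rewrite /be; field; rewrite gt_eqF.
  have al0 : 0 <= 1 + al p by rewrite -lerBlDl sub0r ltW.
  have be0 : 0 <= 1 + be p by rewrite -lerBlDl sub0r ltW.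
  rewrite (powRM _ (ltW U0) al0) (powRM _ (ltW V0) be0).
  rewrite mulrACA ler_wpM2l//.
  have L1 : 1 <= ka * gauss_weight p by rewrite -[1]mulr1 ler_pM// gauss_weight_ge1.
  apply: (le_trans (powR_mul_le_taylor a01 b01 al1 be1 t01 L1 al2 be2 al3 be3 al4 be4)).
  rewrite le_eqVlt; apply/orP; left; apply/eqP.
  rewrite /q /k6 /c11 /c12 /c22 /corr.
  by rewrite /al /be /corr; move: (u _ / U) (v _ / V) => ? ?; field.
apply: (@le_trans _ _ (\int[N2]_p (H p)%:E)%E).
  apply: ge0_le_integral => //.
  - by move=> p _; rewrite lee_fin mulr_ge0 ?powR_ge0.
  - apply/measurable_EFinP; apply: measurable_funM.
      apply: (measurableT_comp (measurable_powR a)); apply: measurableT_comp => //.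
      by apply: measurable_funD => //; exact: measurable_funM.
    apply: (measurableT_comp (measurable_powR b)); apply: measurableT_comp => //.
    by apply: measurable_funD => //; apply: measurable_funM.
  - by case/integrableP: IH.
  - by move=> p _; rewrite lee_fin main.
have -> : (\int[N2]_p (H p)%:E = (\int[N2]_p H p)%:E)%E.
  by rewrite /Rintegral fineK//; exact: integrable_fin_num IH.
rewrite lee_fin EH mulrDr mulrDr mulr1 -addrA lerD2l -[leRHS]add0r lerD//.
  rewrite mulr_ge0_le0// mulr_le0_ge0//; exact: gauss_var_ge0.
rewrite /k6.
have -> : c0 * (16 * t ^+ 3 * ka ^+ 6 * w6) = c0 * (16 * ka ^+ 6 * w6 * t ^+ 3) by ring.
rewrite -[leRHS]mulrA ler_wpM2r//.
  have ka0 : 0 <= ka by exact: le_trans ka1.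
  by rewrite (mulr_ge0 (mulr_ge0 (mulr_ge0 _ (exprn_ge0 6 ka0)) w60) (exprn_ge0 3 t0)).
case/andP: a01 => a0 _; case/andP: b01 => b0 _.
rewrite ler_pM ?powR_ge0// ge0_ler_powR ?nnegrE ?(ltW a0) ?(ltW b0) ?(ltW U0) ?(ltW V0) ?(ltW C0)//.
Qed.

End one_step.

(** * Gaussian averages and their semigroup law *)

Section heat_semigroup.
Context {R : realType}.
Local Notation N := (@gauss R).
Local Notation N2 := ((@gauss R) \x (@gauss R))%E.

Lemma norm_le_bounds (m C z : R) : m <= z <= C -> `|z| <= `|m| + `|C|.
Proof.
move=> /andP[h1 h2]; rewrite ler_norml; have := ler_norm C; have := ler_norm (- m).
by rewrite normrN; have := normr_ge0 C; have := normr_ge0 m; lra.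
Qed.

Lemma measurable_heat_ge0 (u : R -> R) t : measurable_fun setT u ->
  (forall x, 0 <= u x) -> measurable_fun setT (heat t u).
Proof.
move=> mu u0; rewrite /heat /Rintegral.
apply: (@measurableT_comp _ _ _ _ _ _ (@fine R)) => //.
apply: (measurable_fun_fubini_tonelli_F (m2 := N) (fun p : R * R => (u (p.1 + t * p.2))%:E)) => //.
  apply/measurable_EFinP; apply: measurableT_comp => //.
  by apply: measurable_funD => //; exact: measurable_funM.
by move=> p; rewrite lee_fin.
Qed.

Lemma integrable_shift_scale (u : R -> R) (C x t : R) : measurable_fun setT u ->
  (forall x, `|u x| <= C) -> N.-integrable setT (EFin \o (fun z => u (x + t * z))).
Proof.
move=> mu uC; apply: (integrable_gauss_bounded (c := C)) => //.
exact: measurable_shift_scale.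
Qed.

Lemma Rintegral_gauss_cst (r : R) : \int[N]_z r = r.
Proof.
rewrite Rintegral_cst// (_ : (_ : set _ -> \bar R) setT = 1%E) ?mulr1//.
exact: gauss_setT.
Qed.

Lemma integrable_gauss_cst (r : R) : N.-integrable setT (EFin \o (fun=> r)).
Proof. exact: (integrable_gauss_bounded (c := `|r|)). Qed.

Lemma heatD_cst (u : R -> R) (C t k x : R) : measurable_fun setT u ->
  (forall x, `|u x| <= C) -> heat t (fun x => u x + k) x = heat t u x + k.
Proof.
move=> mu uC.
rewrite /heat (RintegralD measurableT (integrable_shift_scale x t mu uC) (integrable_gauss_cst k)).
by rewrite Rintegral_gauss_cst.
Qed.

Lemma measurable_heat (u : R -> R) (C t : R) : measurable_fun setT u ->
  (forall x, `|u x| <= C) -> measurable_fun setT (heat t u).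
Proof.
move=> mu uC.
(* Adding [C] makes the function nonnegative, as the measurability lemma based on Tonelli
   requires. *)
rewrite (_ : heat t u = fun x => heat t (fun x => u x + C) x - C); last first.
  by apply/funext => x; rewrite (heatD_cst _ _ _ mu uC) addrK.
apply: measurable_funB => //; apply: measurable_heat_ge0; first exact: measurable_funD.
by move=> x; have := uC x; rewrite ler_norml => /andP[h _]; rewrite -lerBlDr sub0r.
Qed.

Lemma heat_bounds (u : R -> R) (m C t x : R) : measurable_fun setT u ->
  (forall x, m <= u x <= C) -> m <= heat t u x <= C.
Proof.
move=> mu uC.
have uB y : `|u y| <= `|m| + `|C|.
  exact: norm_le_bounds.
have Iu := integrable_shift_scale x t mu uB.
apply/andP; split.
  rewrite -[leLHS]Rintegral_gauss_cst.
  apply: (le_Rintegral measurableT (integrable_gauss_cst _) Iu) => z _.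
  by have /andP[] := uC (x + t * z).
rewrite -[leRHS]Rintegral_gauss_cst.
apply: (le_Rintegral measurableT Iu (integrable_gauss_cst _)) => z _.
by have /andP[] := uC (x + t * z).
Qed.

(** Each requirement is an inequality between values at translated points, so it survives averaging
    with unchanged [de] and [C]; [heat t D] serves as the derivative. *)
Lemma heat_nice de C t (u : R -> R) : nice de C u -> nice de C (heat t u).
Proof.
move=> [mu uC [D [mD DC uT]]].
have uB x : `|u x| <= `|de| + `|C|.
  exact: norm_le_bounds.
split.
- exact: measurable_heat uB.
- by move=> x; exact: heat_bounds.
- exists (heat t D); split; first exact: measurable_heat DC.
    move=> x; rewrite ler_norml; apply: heat_bounds => // y.
    by rewrite -ler_norml.
  move=> x h; rewrite /heat.
  have I1 := integrable_shift_scale (x + h) t mu uB.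
  have I2 := integrable_shift_scale x t mu uB.
  have I3 := integrable_shift_scale x t mD DC.
  have I3h : N.-integrable setT (EFin \o (fun z => D (x + t * z) * h)).
    have := integrableZl measurableT h I3; apply: eq_integrable => // z _ /=.
    by rewrite -EFinM mulrC.
  have I12 : N.-integrable setT (EFin \o (fun z => u (x + h + t * z) - u (x + t * z))).
    exact: (integrableB measurableT I1 I2).
  have I123 : N.-integrable setT (EFin \o (fun z =>
      u (x + h + t * z) - u (x + t * z) - D (x + t * z) * h)).
    exact: (integrableB measurableT I12 I3h).
  rewrite -RintegralZr// -(RintegralB measurableT I1 I2) -(RintegralB measurableT I12 I3h).
  apply: (le_trans (le_normr_Rintegral measurableT I123)).
  rewrite -[leRHS]Rintegral_gauss_cst.
  apply: (le_Rintegral measurableT _ (integrable_gauss_cst _)).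
    exact: (integrable_norm I123).
  by move=> z _; rewrite [x + h + _]addrAC; exact: uT.
Qed.

Lemma heat_semigroup (u : R -> R) (C s t r x : R) : measurable_fun setT u ->
  (forall x, 0 <= u x <= C) -> 0 <= s -> 0 < r -> s ^+ 2 + t ^+ 2 = r ^+ 2 ->
  heat s (heat t u) x = heat r u x.
Proof.
move=> mu uC s0 r0 str.
have u0 y : 0 <= u y by have /andP[] := uC y.
have mux : measurable_fun setT (fun p : R * R => (u (x + (s * p.1 + t * p.2)))%:E).
  apply/measurable_EFinP; apply: measurableT_comp => //.
  by apply: measurable_funD => //; exact: measurable_fun_lin2.
have mz : measurable_fun setT (fun z => (u (x + z))%:E).
  by apply/measurable_EFinP; apply: measurableT_comp => //; exact: measurable_funD.
apply: EFin_inj; rewrite (heatE r x mu uC).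
rewrite (heatE s x (measurable_heat_ge0 t mu u0) (fun y => heat_bounds t y mu uC)).
have /= <- := gauss_sum s0 r0 str mz (fun z => u0 (x + z)).
rewrite fubini_tonelli1//; last by move=> p; rewrite lee_fin.
apply: eq_integral => z _; rewrite (heatE _ _ mu uC).
by apply: eq_integral => w _; rewrite /= addrA.
Qed.

(* One step of size h of the random walk with correlated Gaussian increments. *)
Definition kick (rho sg h : R) (Phi : R * R -> \bar R) (q : R * R) : \bar R :=
  (\int[N2]_p Phi (q.1 + h * p.1, q.2 + h * (rho * p.1 + sg * p.2))%R)%E.

Lemma measurable_kick_arg (rho sg h : R) (Phi : R * R -> \bar R) q :
  measurable_fun setT Phi -> measurable_fun setT (fun p : R * R =>
    Phi (q.1 + h * p.1, q.2 + h * (rho * p.1 + sg * p.2))).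
Proof.
move=> mPhi; apply: measurableT_comp => //; apply: measurable_fun_pair.
  by apply: measurable_funD => //; exact: measurable_funM.
apply: measurable_funD => //; apply: measurable_funM => //.
exact: measurable_fun_lin2.
Qed.

Lemma le_kick (rho sg h : R) (Phi Psi : R * R -> \bar R) q :
  measurable_fun setT Phi -> measurable_fun setT Psi -> (forall q, 0 <= Phi q)%E ->
  (forall q, Phi q <= Psi q)%E -> (kick rho sg h Phi q <= kick rho sg h Psi q)%E.
Proof.
move=> mPhi mPsi Phi0 le; rewrite /kick; apply: ge0_le_integral.
- exact: measurableT.
- by move=> p _; exact: Phi0.
- exact: measurable_kick_arg.
- exact: measurable_kick_arg.
- by move=> p _; exact: le.
Qed.

Lemma measurable_kick (rho sg h : R) (Phi : R * R -> \bar R) :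
  measurable_fun setT Phi -> (forall q, 0 <= Phi q)%E ->
  measurable_fun setT (kick rho sg h Phi).
Proof.
move=> mPhi Phi0.
rewrite (_ : kick rho sg h Phi = fun q => (\int[N]_x \int[N]_y
    Phi (q.1 + h * x, q.2 + h * (rho * x + sg * y))%R)%E); last first.
  by apply/funext => q; rewrite /kick fubini_tonelli1//; exact: measurable_kick_arg.
have m11 : measurable_fun setT (fun q : (R * R) * R => q.1.1) by exact: measurableT_comp.
have m12 : measurable_fun setT (fun q : (R * R) * R => q.1.2) by exact: measurableT_comp.
apply: (measurable_fun_fubini_tonelli_F (m2 := N) (fun qx : (R * R) * R => (\int[N]_y
    Phi (qx.1.1 + h * qx.2, qx.1.2 + h * (rho * qx.2 + sg * y))%R)%E)); last first.
  by move=> q; exact: integral_ge0.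
apply: (measurable_fun_fubini_tonelli_F (m2 := N) (fun qxy : ((R * R) * R) * R =>
    Phi (qxy.1.1.1 + h * qxy.1.2, qxy.1.1.2 + h * (rho * qxy.1.2 + sg * qxy.2))%R)) => //.
have m111 : measurable_fun setT (fun q : ((R * R) * R) * R => q.1.1.1).
  by apply: (measurableT_comp m11).
have m112 : measurable_fun setT (fun q : ((R * R) * R) * R => q.1.1.2).
  by apply: (measurableT_comp m12).
have m2 : measurable_fun setT (fun q : ((R * R) * R) * R => q.1.2).
  exact: measurableT_comp.
apply: measurableT_comp => //; apply: measurable_fun_pair.
  by apply: measurable_funD => //; exact: measurable_funM.
apply: measurable_funD => //; apply: measurable_funM => //.
by apply: measurable_funD => //; exact: measurable_funM.
Qed.

(** Tonelli regroups the four coordinates into the pairs p.1, q.1 and p.2, q.2, and [gauss_sum]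
    merges each pair. *)
Lemma gauss4_sum (s t r : R) (Psi : R * R -> \bar R) : 0 <= s -> 0 < r ->
  s ^+ 2 + t ^+ 2 = r ^+ 2 -> measurable_fun setT Psi -> (forall q, 0 <= Psi q)%E ->
  (\int[N2]_p \int[N2]_q Psi (s * p.1 + t * q.1, s * p.2 + t * q.2)%R =
   \int[N2]_p Psi (r * p.1, r * p.2)%R)%E.
Proof.
move=> s0 r0 str mPsi Psi0.
have mA : measurable_fun setT (fun pq : (R * R) * (R * R) =>
    Psi (s * pq.1.1 + t * pq.2.1, s * pq.1.2 + t * pq.2.2)).
  have m11 : measurable_fun setT (fun qp : (R * R) * (R * R) => qp.1.1).
    exact: measurableT_comp.
  have m12 : measurable_fun setT (fun qp : (R * R) * (R * R) => qp.1.2).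
    exact: measurableT_comp.
  have m21 : measurable_fun setT (fun qp : (R * R) * (R * R) => qp.2.1).
    exact: measurableT_comp.
  have m22 : measurable_fun setT (fun qp : (R * R) * (R * R) => qp.2.2).
    exact: measurableT_comp.
  by apply: measurableT_comp => //; apply: measurable_fun_pair;
    apply: measurable_funD; exact: measurable_funM.
have mA1 (p : R * R) : measurable_fun setT (fun q : R * R =>
    Psi (s * p.1 + t * q.1, s * p.2 + t * q.2)).
  exact: measurable_fun_pair2 mA.
rewrite fubini_tonelli1//; last 2 first.
- rewrite (_ : (fun p => _) = kick 0 1 t Psi \o (fun p => (s * p.1, s * p.2))).
    apply: measurableT_comp; first exact: measurable_kick.
    by apply: measurable_fun_pair; exact: measurable_funM.
  apply/funext => p; apply: eq_integral => q _ /=.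
  by rewrite mul0r mul1r add0r.
- by move=> p; exact: integral_ge0.
pose G m : \bar R := (\int[N]_w Psi (m, r * w)%R)%E.
have mG : measurable_fun setT G.
  apply: (measurable_fun_fubini_tonelli_F (m2 := N) (fun q : R * R => Psi (q.1, r * q.2))) => //.
  apply: measurableT_comp => //; apply: measurable_fun_pair => //.
  exact: measurable_funM.
have G0 m : (0 <= G m)%E by exact: integral_ge0.
transitivity (\int[N]_x \int[N]_x' G (s * x + t * x')%R)%E.
  apply: eq_integral => x _; rewrite /fubini_F.
  transitivity (\int[N]_y \int[N]_x' \int[N]_y' Psi (s * x + t * x', s * y + t * y')%R)%E.
    apply: eq_integral => y _; rewrite fubini_tonelli1//.
    exact: (mA1 (x, y)).
  have mB : measurable_fun setT (fun yx : R * R =>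
      (\int[N]_y' Psi (s * x + t * yx.2, s * yx.1 + t * y')%R)%E).
    apply: (measurable_fun_fubini_tonelli_F (m2 := N) (fun yxy : (R * R) * R =>
      Psi (s * x + t * yxy.1.2, s * yxy.1.1 + t * yxy.2))) => //.
    have m11 : measurable_fun setT (fun q : (R * R) * R => q.1.1).
      exact: measurableT_comp.
    have m12 : measurable_fun setT (fun q : (R * R) * R => q.1.2).
      exact: measurableT_comp.
    apply: measurableT_comp => //; apply: measurable_fun_pair; apply: measurable_funD => //;
      exact: measurable_funM.
  have /= -> := fubini_tonelli (m1 := N) (m2 := N) _ mB
    (fun yx => integral_ge0 _ (fun y' _ => Psi0 _)).
  apply: eq_integral => x' _ /=.
  have mP : measurable_fun setT (fun y => Psi (s * x + t * x', y)).
    exact: measurable_fun_pair2 mPsi.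
  apply: (etrans _ (gauss_sum s0 r0 str mP (fun y => Psi0 _))).
  rewrite fubini_tonelli1//.
  exact: (measurableT_comp mP (measurable_fun_lin2 s t)).
transitivity (\int[N2]_p G (s * p.1 + t * p.2)%R)%E.
  rewrite fubini_tonelli1//.
  exact: (measurableT_comp mG (measurable_fun_lin2 s t)).
rewrite (gauss_sum s0 r0 str mG G0) fubini_tonelli1//.
by apply: measurableT_comp => //; apply: measurable_fun_pair; exact: measurable_funM.
Qed.

Lemma kick_semigroup (rho sg s t r : R) (Phi : R * R -> \bar R) q :
  0 <= s -> 0 < r -> s ^+ 2 + t ^+ 2 = r ^+ 2 ->
  measurable_fun setT Phi -> (forall q, 0 <= Phi q)%E ->
  kick rho sg s (kick rho sg t Phi) q = kick rho sg r Phi q.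
Proof.
move=> s0 r0 str mPhi Phi0.
pose Psi (m : R * R) := Phi (q.1 + m.1, q.2 + (rho * m.1 + sg * m.2)).
have mPsi : measurable_fun setT Psi.
  apply: measurableT_comp => //; apply: measurable_fun_pair.
    by apply: measurable_funD.
  by apply: measurable_funD => //; exact: measurable_fun_lin2.
have := gauss4_sum s0 r0 str mPsi (fun m => Phi0 _).
rewrite /Psi/= /kick => h.
transitivity (\int[N2]_p Phi (q.1 + r * p.1, q.2 + (rho * (r * p.1) + sg * (r * p.2)))%R)%E.
  rewrite -h; apply: eq_integral => p _; apply: eq_integral => p' _ /=.
  by congr (Phi (_, _)); ring.
by apply: eq_integral => p _; congr (Phi (_, _)); ring.
Qed.

End heat_semigroup.

(** * Iterating the step *)

Section iteration.
Context {R : realType}.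
Local Notation N := (@gauss R).
Local Notation N2 := ((@gauss R) \x (@gauss R))%E.
Variables (rho sg : R).
Hypotheses (rho0 : 0 <= rho) (rs1 : rho ^+ 2 + sg ^+ 2 = 1).
Variables (a b : R).
Hypotheses (a01 : 0 < a < 1) (b01 : 0 < b < 1).
Hypothesis abr : a * b * rho ^+ 2 <= (1 - a) * (1 - b).

Let J (u v : R -> R) (q : R * R) : \bar R := (u q.1 `^ a * v q.2 `^ b)%:E.

Let measurable_J u v : measurable_fun setT u -> measurable_fun setT v ->
  measurable_fun setT (J u v).
Proof.
move=> mu mv; apply/measurable_EFinP; apply: measurable_funM.
  by apply: (measurableT_comp (measurable_powR a)); exact: measurableT_comp.
by apply: (measurableT_comp (measurable_powR b)); exact: measurableT_comp.
Qed.

Let J0 u v q : (0 <= J u v q)%E.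
Proof. by rewrite lee_fin mulr_ge0 ?powR_ge0. Qed.

(** Induction peels off the innermost step: [one_step] replaces it by [heat t u] and [heat t v] at
    the cost K t^3, and these averages are again [nice] with the same constants, so the induction
    hypothesis covers the remaining steps. *)
Lemma n_steps (de C : R) : 0 < de -> exists2 K, 0 <= K & forall n u v, nice de C u -> nice de C v ->
  forall (t r : R) q, 0 < t <= 1 -> 0 <= r -> r ^+ 2 = n.+1%:R * t ^+ 2 ->
  (kick rho sg r (J u v) q
    <= (heat r u q.1 `^ a * heat r v q.2 `^ b + n.+1%:R * K * t ^+ 3)%:E)%E.
Proof.
move=> de0; have [K K0 HK] := one_step rho0 rs1 C a01 b01 abr de0; exists K => //.
elim=> [|n IH] u v nu nv t r q /andP[t0 t1] r0 rt.
  have -> : r = t.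
    by apply/eqP; rewrite -(eqrXn2 (n := 2))// ?(ltW t0)// rt mul1r.
  by rewrite mul1r; apply: HK => //; rewrite (ltW t0).
pose s : R := Num.sqrt (n.+1%:R * t ^+ 2).
have s0 : 0 <= s by exact: sqrtr_ge0.
have s2 : s ^+ 2 = n.+1%:R * t ^+ 2 by rewrite sqr_sqrtr// mulr_ge0// sqr_ge0.
have r_gt0 : 0 < r.
  rewrite lt0r r0 andbT; apply/eqP => r_0; move: rt; rewrite r_0 expr0n => /esym/eqP.
  by rewrite mulf_eq0 pnatr_eq0 sqrf_eq0 (gt_eqF t0).
have st : s ^+ 2 + t ^+ 2 = r ^+ 2 by rewrite s2 rt -[in RHS]natr1 mulrDl mul1r.
have [mu uC _] := nu; have [mv vC _] := nv.
have u0 x : 0 <= u x <= C.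
  by have /andP[h1 h2] := uC x; rewrite h2 (le_trans (ltW de0) h1).
have v0 x : 0 <= v x <= C.
  by have /andP[h1 h2] := vC x; rewrite h2 (le_trans (ltW de0) h1).
have mJ := measurable_J mu mv.
have nhu := heat_nice t nu; have nhv := heat_nice t nv.
have [mhu huC _] := nhu; have [mhv hvC _] := nhv.
have mJh := measurable_J mhu mhv.
rewrite -(kick_semigroup _ _ _ s0 r_gt0 st mJ (J0 u v)).
have Jh0 q' : (0 <= J (heat t u) (heat t v) q' + (K * t ^+ 3)%:E)%E.
  by rewrite adde_ge0// lee_fin mulr_ge0// exprn_ge0// ltW.
have mK : measurable_fun setT (fun q' => J (heat t u) (heat t v) q' + (K * t ^+ 3)%:E)%E.
  exact: emeasurable_funD.
apply: (@le_trans _ _ (kick rho sg s (fun q' => J (heat t u) (heat t v) q' + (K * t ^+ 3)%:E)%E q)).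
  apply: le_kick mK _ _; first exact: measurable_kick.
    by move=> q'; apply: integral_ge0 => p _; exact: J0.
  by move=> q'; rewrite -EFinD; apply: HK => //; rewrite (ltW t0).
have -> : kick rho sg s (fun q' => J (heat t u) (heat t v) q' + (K * t ^+ 3)%:E)%E q =
    (kick rho sg s (J (heat t u) (heat t v)) q + (K * t ^+ 3)%:E)%E.
  rewrite /kick (ge0_integralD _ measurableT).
  - rewrite integral_cst; last exact: measurableT.
    by rewrite (_ : (_ : set _ -> \bar R) setT = 1%E) ?mule1//; exact: gauss2_setT.
  - by move=> p _; exact: J0.
  - exact: (measurable_kick_arg _ _ _ _ mJh).
  - by move=> p _; rewrite lee_fin mulr_ge0// exprn_ge0// ltW.
  - exact: measurable_cst.
rewrite (le_trans (leeD2r _ (IH _ _ nhu nhv t s q _ s0 s2)))//; first by rewrite t0.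
rewrite -EFinD lee_fin (heat_semigroup _ mu u0 s0 r_gt0 st) (heat_semigroup _ mv v0 s0 r_gt0 st).
have -> : n.+2%:R * K * t ^+ 3 = n.+1%:R * K * t ^+ 3 + K * t ^+ 3.
  by rewrite -[n.+2%:R]natr1; ring.
by rewrite addrA.
Qed.

Lemma gauss_ineq_nice (de C : R) u v (r : R) : 0 < de -> nice de C u -> nice de C v ->
  0 < r <= 1 ->
  (\int[N2]_p (u (r * p.1) `^ a * v (r * (rho * p.1 + sg * p.2)) `^ b)%:E
    <= (heat r u 0 `^ a * heat r v 0 `^ b)%:E)%E.
Proof.
move=> de0 nu nv /andP[r0 r1]; have [K K0 HK] := n_steps C de0.
apply/lee_addgt0Pr => e e0.
(* With m^2 steps of size r / m the total error m^2 K (r / m)^3 equals K r^3 / m, which is at most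
   [e]. *)
pose m := (Num.trunc (K * r ^+ 3 / e)).+1.
have hm : K * r ^+ 3 / e <= m%:R by rewrite ltW// truncnS_gt.
have m0 : 0 < m%:R :> R by rewrite ltr0n.
have m1 : 1 <= m%:R :> R by rewrite ler1n.
pose n := (m ^ 2).-1.
have nm : n.+1 = (m ^ 2)%N by rewrite prednK// expn_gt0.
have t01 : 0 < r / m%:R <= 1.
  by rewrite divr_gt0//= ler_pdivrMr// mul1r (le_trans r1).
have rt : r ^+ 2 = n.+1%:R * (r / m%:R) ^+ 2.
  by rewrite nm natrX; field; rewrite gt_eqF.
have /= := HK n u v nu nv _ r (0, 0) t01 (ltW r0) rt.
rewrite /kick/=; under eq_integral do rewrite !add0r.
move=> /le_trans; apply; rewrite -EFinD lee_fin lerD2l nm natrX.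
have -> : m%:R ^+ 2 * K * (r / m%:R) ^+ 3 = K * r ^+ 3 / m%:R.
  by field; rewrite gt_eqF.
by rewrite ler_pdivrMr// (mulrC e) -ler_pdivrMr.
Qed.

End iteration.

(** * Gaussian averages of bounded functions are smooth *)

Section smoothing.
Context {R : realType}.
Local Notation mu := (@lebesgue_measure R).
Local Notation N := (@gauss R).

Lemma expR_taylor1_le (x : R) : `|expR x - 1 - x| <= x ^+ 2 * expR `|x|.
Proof.
rewrite ger0_norm; last by rewrite -addrA -opprD subr_ge0 expR_ge1Dx.
have e0 := expR_gt0 x.
have h1 : expR x - 1 <= x * expR x.
  have := expR_ge1Dx (- x); rewrite expRN -(ler_pM2r e0) mulVf ?gt_eqF//; lra.
have h2 := expR_ge1Dx x.
have [x0|x0] := leP 0 x.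
  by rewrite ger0_norm// -subr_ge0; nra.
have : 1 <= expR `|x| by rewrite -expR0 ler_expR.
by nra.
Qed.

(** The factor 3 is 2, from y^2 <= 2 exp y at y = |z| + 1, plus 1 to cover the term xi^2 / 2; the 6
    comes from 2 (|z| + 1) <= z^2 / 4 + 6. *)
Definition tilt_const : R := 3 * expR 6.

(** The exponential is the density of the normal law shifted by [xi] relative to the unshifted one;
    the weight on the right is integrable under [gauss]. *)
Lemma tilt_le (z xi : R) : `|xi| <= 1 ->
  `|expR (z * xi - xi ^+ 2 / 2) - 1 - z * xi| <= xi ^+ 2 * (tilt_const * expR (z ^+ 2 / 4)).
Proof.
move=> xi1; set th := z * xi - xi ^+ 2 / 2.
have -> : expR th - 1 - z * xi = (expR th - 1 - th) + (- (xi ^+ 2 / 2)).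
  by rewrite /th; ring.
apply: (le_trans (ler_normD _ _)).
have a0 := normr_ge0 z; have b0 := normr_ge0 xi.
have thle : `|th| <= `|xi| * (`|z| + 1).
  rewrite (le_trans (ler_normB _ _))// normrM mulrDr mulr1 [`|z| * _]mulrC lerD2l.
  by rewrite normrM normrX normfV [`|2|]ger0_norm//; nra.
have xi2 : `|xi| ^+ 2 = xi ^+ 2 by rewrite real_normK ?num_real.
have th2 : th ^+ 2 <= xi ^+ 2 * (`|z| + 1) ^+ 2.
  by rewrite -(real_normK (num_real th)) -xi2 -exprMn lerXn2r// ?nnegrE// mulr_ge0 ?addr_ge0.
have z2 : (`|z| + 1) ^+ 2 <= 2 * expR (`|z| + 1).
  have := @expR_ge1Dxn R (`|z| + 1) 1; rewrite addr_ge0// => /(_ isT).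
  by rewrite (_ : 2`! = 2)//; lra.
have eth : expR `|th| <= expR (`|z| + 1).
  by rewrite ler_expR (le_trans thle)// ler_piMl// addr_ge0.
have ez : expR (`|z| + 1) * expR (`|z| + 1) <= expR 6 * expR (z ^+ 2 / 4).
  rewrite -!expRD ler_expR -(real_normK (num_real z)).
  by have := sqr_ge0 (`|z| / 2 - 2); nra.
have ez1 : 1 <= expR (`|z| + 1) by rewrite -expR0 ler_expR addr_ge0.
rewrite normrN [`|_ / 2|]ger0_norm ?divr_ge0 ?sqr_ge0//.
have xi20 := sqr_ge0 xi.
apply: (@le_trans _ _ (xi ^+ 2 * (3 * (expR (`|z| + 1) * expR (`|z| + 1))))); last first.
  by rewrite /tilt_const -mulrA ler_wpM2l// ler_wpM2l.
apply: (@le_trans _ _ (xi ^+ 2 * (2 * expR (`|z| + 1)) * expR (`|z| + 1) + xi ^+ 2 / 2)).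
  rewrite lerD2r (le_trans (expR_taylor1_le _))// ler_pM ?sqr_ge0 ?expR_ge0//.
  by rewrite (le_trans th2)// ler_wpM2l.
set E := expR _ in ez1 *.
have : xi ^+ 2 <= xi ^+ 2 * (E * E) by rewrite ler_peMr// -[1]mulr1 ler_pM.
lra.
Qed.

Variables (f : R -> R) (M tau : R).
Hypotheses (mf : measurable_fun setT f) (fM : forall x, 0 <= f x <= M) (tau0 : 0 < tau).

Let f0 x : 0 <= f x. Proof. by have /andP[] := fM x. Qed.
Let M0 : 0 <= M. Proof. by have /andP[h1 h2] := fM 0; exact: le_trans h2. Qed.

Let W (z : R) := expR (z ^+ 2 / 4).
Let W1 z : 1 <= W z. Proof. by rewrite /W -expR0 ler_expR divr_ge0// sqr_ge0. Qed.
Let EW : R := \int[N]_z W z.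

Let I (k : R -> R) (x : R) := \int[N]_z (f (x + tau * z) * k z).

Let Iint (k : R -> R) (c x : R) : measurable_fun setT k -> (forall z, `|k z| <= c * W z) ->
  N.-integrable setT (EFin \o (fun z => f (x + tau * z) * k z)).
Proof.
move=> mk kc; have h := integrableZl measurableT (M * c) (@integrable_expR_sqr4 R).
apply: le_integrable h => //.
  apply/measurable_EFinP; apply: measurable_funM => //.
  exact: measurable_shift_scale.
move=> z _ /=; rewrite lee_fin (le_trans _ (ler_norm _))//.
rewrite normrM ger0_norm// -mulrA.
by have /andP[h1 h2] := fM (x + tau * z); exact: ler_pM.
Qed.

Let I_le (k : R -> R) (c x : R) : measurable_fun setT k ->
  (forall z, `|k z| <= c * W z) -> `|I k x| <= M * c * EW.
Proof.
move=> mk kc; have Ik := Iint x mk kc.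
apply: (le_trans (le_normr_Rintegral measurableT Ik)).
rewrite -RintegralZl//; last exact: integrable_expR_sqr4.
apply: le_Rintegral => //.
- exact: (integrable_norm Ik).
- exact: (integrableZl measurableT (M * c) (@integrable_expR_sqr4 R)).
- move=> z _; rewrite normrM ger0_norm// -mulrA.
  by have /andP[h1 h2] := fM (x + tau * z); exact: ler_pM.
Qed.

Let mI (k : R -> R) : measurable_fun setT k -> (forall z, 0 <= k z) ->
  measurable_fun setT (I k).
Proof.
move=> mk k0; rewrite /I /Rintegral.
apply: (@measurableT_comp _ _ _ _ _ _ (@fine R)) => //.
apply: (measurable_fun_fubini_tonelli_F (m2 := N)
  (fun p : R * R => (f (p.1 + tau * p.2) * k p.2)%:E)) => //.
  apply/measurable_EFinP; apply: measurable_funM; last exact: measurableT_comp.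
  apply: measurableT_comp => //.
  by apply: measurable_funD => //; exact: measurable_funM.
by move=> p; rewrite lee_fin mulr_ge0.
Qed.

Let tilt (xi z : R) := expR (z * xi - xi ^+ 2 / 2).

Let mtilt xi : measurable_fun setT (tilt xi).
Proof.
apply: measurableT_comp => //; apply: measurable_funB => //.
exact: measurable_funM.
Qed.

(** A change of variables moves the displacement from [f], which is merely measurable, to the
    Gaussian density, where it appears as the smooth factor [tilt xi]. *)
Let heat_tilt x xi : heat tau f (x + tau * xi) = I (tilt xi) x.
Proof.
congr fine.
have mf1 : measurable_fun setT (fun z => f (x + tau * z)).
  exact: measurable_shift_scale.
rewrite ge0_integral_gauss; last 2 first.
- by apply/measurable_EFinP; exact: measurable_shift_scale.
- by move=> z; rewrite lee_fin.
rewrite ge0_integral_gauss; last 2 first.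
- by apply/measurable_EFinP; exact: measurable_funM.
- by move=> z; rewrite lee_fin mulr_ge0// expR_ge0.
have pdf0 z : (0 <= (gauss_pdf z)%:E)%E by rewrite lee_fin ltW// gauss_pdf_gt0.
pose h z := ((f (x + tau * z))%:E * (tilt xi z)%:E * (gauss_pdf z)%:E)%E.
have mh : measurable_fun setT h.
  apply: emeasurable_funM; last first.
    by apply/measurable_EFinP; exact: measurable_gauss_pdf.
  by apply: emeasurable_funM; apply/measurable_EFinP.
have h0 z : (0 <= h z)%E by rewrite /h !mule_ge0// lee_fin// expR_ge0.
rewrite (_ : (\int[mu]_z ((f (x + tau * z) * tilt xi z)%:E * _))%E = \int[mu]_z h z)%E//.
rewrite -(ge0_integral_shift xi mh h0).
apply: eq_integral => z _; rewrite /h -!EFinM; congr EFin.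
rewrite -mulrA; congr (f _ * _); first by ring.
rewrite !gauss_pdfE mulrCA /tilt -expRD; congr (_ * expR _).
by field.
Qed.

Let kz (z : R) := z.
(** z is the derivative of [tilt xi z] in xi at 0, so this is the derivative of [heat tau f], the
    division by [tau] coming from h = tau xi. *)
Let D x := I kz x / tau.

Let zW z : `|z| <= 2 * W z.
Proof.
have := expR_ge1Dx (z ^+ 2 / 4); rewrite -/(W z) -(real_normK (num_real z)).
have := sqr_ge0 (`|z| - 1); nra.
Qed.

Let mD : measurable_fun setT D.
Proof.
apply: measurable_funM => //.
(* The weight z changes sign; it is written as the difference of the nonnegative weights 1 + z + z^2
   and 1 + z^2 so that Tonelli gives measurability. *)
pose k1 (z : R) := z + (1 + z ^+ 2); pose k2 (z : R) := 1 + z ^+ 2.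
have mk2 : measurable_fun setT k2.
  by apply: measurable_funD => //; exact: measurable_funX.
have mk1 : measurable_fun setT k1 by exact: measurable_funD.
have k2W z : `|k2 z| <= 4 * W z.
  rewrite ger0_norm ?addr_ge0 ?sqr_ge0//.
  have := expR_ge1Dx (z ^+ 2 / 4); rewrite -/(W z) /k2; lra.
have k1W z : `|k1 z| <= 6 * W z.
  by rewrite (le_trans (ler_normD _ _))//; have := zW z; have := k2W z; rewrite /k2; lra.
rewrite (_ : I kz = fun x => I k1 x - I k2 x); last first.
  apply/funext => x; rewrite /I -(RintegralB measurableT (Iint x mk1 k1W) (Iint x mk2 k2W)).
  by apply: eq_Rintegral => z _; rewrite /kz /k1 /k2; ring.
apply: measurable_funB; apply: mI => // z; rewrite /k1 /k2; last by rewrite addr_ge0 ?sqr_ge0.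
by have := sqr_ge0 (z + 1); nra.
Qed.

Lemma heat_smooth_nice (de : R) : 0 < de ->
  exists C, forall C', C <= C' -> nice de C' (fun x => heat tau f x + de).
Proof.
move=> de0; have EW0 : 0 <= EW by apply: Rintegral_ge0 => z _; rewrite expR_ge0.
have T0 : 0 <= tilt_const by rewrite mulr_ge0 ?expR_ge0.
pose C1 := M + de; pose C2 := M * 2 * EW / tau; pose C3 := M * tilt_const * EW / tau ^+ 2.
pose C4 := M / tau ^+ 2 + M * 2 * EW / tau ^+ 2.
have MEW : 0 <= M * 2 * EW by rewrite !mulr_ge0.
have C20 : 0 <= C2 by rewrite divr_ge0// ltW.
have C30 : 0 <= C3 by rewrite divr_ge0 ?sqr_ge0// !mulr_ge0.
have C40 : 0 <= C4 by rewrite addr_ge0// divr_ge0 ?sqr_ge0.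
have C10 : 0 <= C1 by rewrite addr_ge0// ltW.
have mh := measurable_heat_ge0 tau mf f0.
have DB x : `|D x| <= C2.
  rewrite normrM normfV (gtr0_norm tau0) ler_pM2r ?invr_gt0//.
  by apply: I_le; [exact: measurable_id|exact: zW].
exists (C1 + C2 + C3 + C4) => C' CC'; split.
- exact: measurable_funD.
- move=> x; have /andP[h1 h2] := heat_bounds tau x mf fM.
  by rewrite lerDr h1/= (le_trans _ CC')// /C1; lra.
- exists D; split => //; first by move=> x; rewrite (le_trans (DB x))//; lra.
  move=> x h; pose xi := h / tau.
  have hE : h = tau * xi by rewrite /xi mulrC divfK// gt_eqF.
  have h2E : h ^+ 2 = tau ^+ 2 * xi ^+ 2 by rewrite hE exprMn.
  rewrite opprD addrACA subrr addr0.
  apply: (@le_trans _ _ ((C3 + C4) * h ^+ 2)); last first.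
    by rewrite ler_wpM2r ?sqr_ge0//; lra.
  have /andP[a1 a2] := heat_bounds tau (x + h) mf fM.
  have /andP[b1 b2] := heat_bounds tau x mf fM.
  (* For displacements up to [tau] the expansion of [tilt] applies; beyond, h^2 exceeds tau^2 and
     crude bounds suffice. *)
  have [xi1|xi1] := leP `|xi| 1.
    have -> : heat tau f (x + h) - heat tau f x - D x * h =
        I (fun z => tilt xi z - 1 - z * xi) x.
      rewrite {1}hE heat_tilt (_ : heat tau f x = I (tilt 0) x); last first.
        by rewrite -heat_tilt mulr0 addr0.
      have k0W z : `|tilt 0 z| <= 1 * W z.
        by rewrite /tilt mulr0 expr0n mul0r subr0 expR0 normr1 mul1r.
      have kzW z : `|z * xi| <= 2 * W z.
        by rewrite normrM (le_trans _ (zW z))// ler_piMr.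
      have ktW z : `|tilt xi z| <= (tilt_const + 3) * W z.
        have -> : tilt xi z = (tilt xi z - 1 - z * xi) + (1 + z * xi) by ring.
        rewrite (le_trans (ler_normD _ _))// mulrDl lerD//.
          rewrite (le_trans (tilt_le z xi1))// ler_piMl ?mulr_ge0 ?expR_ge0//.
          by rewrite -(real_normK (num_real xi)) expr_le1.
        rewrite (le_trans (ler_normD _ _))// normr1; have := kzW z; have := W1 z; lra.
      have J0 := Iint x (mtilt 0) k0W.
      have mzx : measurable_fun setT (fun z : R => z * xi) by exact: measurable_funM.
      have Jz := Iint x mzx kzW.
      have Jt := Iint x (mtilt xi) ktW.
      have -> : D x * h = I (fun z => z * xi) x.
        rewrite /D hE mulrA divfK ?gt_eqF// /I.
        rewrite -RintegralZr//; last exact: (Iint x (@measurable_id _ _ setT) zW).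
        by apply: eq_Rintegral => z _; rewrite mulrA.
      have Jt0 : N.-integrable setT (EFin \o
          (fun z => f (x + tau * z) * tilt xi z - f (x + tau * z) * tilt 0 z)).
        exact: (integrableB measurableT Jt J0).
      rewrite /I -(RintegralB measurableT Jt J0) -(RintegralB measurableT Jt0 Jz).
      apply: eq_Rintegral => z _.
      by rewrite /(tilt 0) mulr0 expr0n mul0r subr0 expR0; ring.
    have mk : measurable_fun setT (fun z => tilt xi z - 1 - z * xi).
      apply: measurable_funB; last exact: measurable_funM.
      exact: measurable_funB.
    have kW z : `|tilt xi z - 1 - z * xi| <= xi ^+ 2 * tilt_const * W z.
      by rewrite -mulrA; exact: tilt_le.
    rewrite (le_trans (I_le x mk kW))// mulrDl -[leLHS]addr0 lerD//; last first.
      by rewrite mulr_ge0 ?sqr_ge0.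
    rewrite /C3 h2E le_eqVlt; apply/orP; left; apply/eqP.
    by field; rewrite gt_eqF.
  have xi2 : 1 <= `|xi| ^+ 2 by rewrite expr_ge1// ltW.
  have xi3 : `|xi| <= `|xi| ^+ 2 by rewrite expr2 ler_peMr// ltW.
  rewrite mulrDl -[leLHS]add0r lerD//; first by rewrite mulr_ge0 ?sqr_ge0.
  apply: (le_trans (ler_normB _ _)); rewrite /C4 mulrDl lerD//.
    rewrite h2E (_ : M / tau ^+ 2 * (tau ^+ 2 * xi ^+ 2) = M * xi ^+ 2); last first.
      by field; rewrite gt_eqF.
    apply: (@le_trans _ _ M); first by rewrite ler_norml; apply/andP; split; lra.
    by rewrite ler_peMr// -(real_normK (num_real xi)).
  have hN : `|h| = tau * `|xi| by rewrite {1}hE normrM (gtr0_norm tau0).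
  rewrite normrM hN h2E.
  rewrite (_ : M * 2 * EW / tau ^+ 2 * (tau ^+ 2 * xi ^+ 2) = C2 * tau * xi ^+ 2); last first.
    by rewrite /C2; field; rewrite gt_eqF.
  rewrite mulrA -(real_normK (num_real xi)) ler_pM ?mulr_ge0 ?(ltW tau0)//.
  by rewrite ler_wpM2r// ltW.
Qed.

End smoothing.

(** * Smoothing lowers the correlation *)

Section bounded_functions.
Context {R : realType}.
Local Notation N := (@gauss R).
Local Notation N2 := ((@gauss R) \x (@gauss R))%E.

Lemma gauss2_iter (f : R -> R -> R) : measurable_fun setT (fun p : R * R => f p.1 p.2) ->
  (forall x y, 0 <= f x y) ->
  (\int[N2]_p (f p.1 p.2)%:E = \int[N]_x \int[N]_y (f x y)%:E)%E.
Proof.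
move=> mf f0; rewrite fubini_tonelli1; first by [].
- by apply/measurable_EFinP; exact: mf.
- by move=> p; rewrite lee_fin; exact: f0.
Qed.

Lemma heatZ (u : R -> R) (C k t x : R) : measurable_fun setT u ->
  (forall x, 0 <= u x <= C) -> 0 <= k ->
  (k * heat t u x)%:E = (\int[N]_z (k * u (x + t * z))%:E)%E.
Proof.
move=> mu uC k0.
have uB y : `|u y| <= C by have /andP[h1 h2] := uC y; rewrite ger0_norm.
have mku : measurable_fun setT (fun y => k * u y) by exact: measurable_funM.
have kuC y : 0 <= k * u y <= k * C.
  by have /andP[h1 h2] := uC y; rewrite mulr_ge0//= ler_wpM2l.
rewrite -(heatE t x mku kuC) /heat RintegralZl//.
exact: integrable_shift_scale uB.
Qed.

Lemma heatN (u : R -> R) t x : measurable_fun setT u -> (forall x, 0 <= u x) ->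
  heat (- t) u x = heat t u x.
Proof.
move=> mu u0; have m : measurable_fun setT (fun z => (u (x + t * z))%:E).
  by apply/measurable_EFinP; exact: measurable_shift_scale.
have u0' z : (0 <= (u (x + t * z))%:E)%E by rewrite lee_fin.
congr fine; apply: (etrans _ (etrans (@gauss_sum R 0 (-1) 1 _ (lexx 0) ltr01 _ m u0') _)).
- have mm : measurable_fun setT (fun p : R * R => (u (x + t * (0 * p.1 + -1 * p.2)))%:E).
    exact: (measurableT_comp m (measurable_fun_lin2 0 (-1))).
  rewrite fubini_tonelli2//.
  apply: eq_integral => w _; rewrite /fubini_G/=.
  transitivity (\int[N]_z (u (x + - t * w))%:E)%E.
    rewrite integral_cst// (_ : (_ : set _ -> \bar R) setT = 1%E) ?mule1//.
    exact: gauss_setT.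
  apply: eq_integral => z _ /=; by rewrite mul0r add0r mulN1r mulrN mulNr.
- by rewrite expr0n add0r sqrrN.
- by apply: eq_integral => z _; rewrite mul1r.
Qed.

(** Jensen's inequality for a concave power, proved with the tangent at [m]; the added [de] keeps
    [m] positive. *)
Lemma heat_powR_le (f : R -> R) (M a t de x : R) : measurable_fun setT f ->
  (forall x, 0 <= f x <= M) -> 0 < a < 1 -> 0 < de ->
  heat t (fun y => f y `^ a) x <= (heat t f x + de) `^ a.
Proof.
move=> mf fM a01 de0; have /andP[a0 a1] := a01.
have /andP[m0 _] := heat_bounds t x mf fM.
set m := heat t f x + de.
have m_gt0 : 0 < m by rewrite ltr_wpDl.
have fB y : `|f y| <= M by have /andP[h1 h2] := fM y; rewrite ger0_norm.
have faB y : `|f y `^ a| <= M `^ a.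
  have /andP[h1 h2] := fM y; rewrite ger0_norm ?powR_ge0// ge0_ler_powR ?nnegrE ?(ltW a0)//.
  exact: le_trans h2.
have mfa : measurable_fun setT (fun y => f y `^ a).
  exact: (measurableT_comp (measurable_powR a)).
have If := integrable_shift_scale x t mf fB.
have Ifa := integrable_shift_scale x t mfa faB.
(* [k1 + k2 * y] is the tangent to the power at [m], evaluated at y + de; its average over the
   values y of [f] is m^a. *)
pose k1 := m `^ a * (1 - a) + m `^ a * a / m * de; pose k2 := m `^ a * a / m.
have Ik2 : N.-integrable setT (EFin \o (fun z => k2 * f (x + t * z))).
  exact: (integrableZl measurableT k2 If).
have I12 : N.-integrable setT (EFin \o (fun z => k1 + k2 * f (x + t * z))).
  exact: (integrableD measurableT (integrable_gauss_cst k1) Ik2).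
have -> : m `^ a = \int[N]_z (k1 + k2 * f (x + t * z)).
  rewrite (RintegralD measurableT (integrable_gauss_cst k1) Ik2) Rintegral_gauss_cst.
  rewrite RintegralZl// -/(heat t f x) (_ : heat t f x = m - de); last by rewrite addrK.
  by rewrite /k1 /k2; field; rewrite gt_eqF.
apply: (le_Rintegral measurableT Ifa I12) => z _.
have /andP[h1 h2] := fM (x + t * z).
have fd : 0 <= f (x + t * z) + de by rewrite addr_ge0// ltW.
apply: (@le_trans _ _ ((f (x + t * z) + de) `^ a)).
  by rewrite ge0_ler_powR ?nnegrE ?(ltW a0)// lerDl ltW.
have := powR_le_tangent (y := (f (x + t * z) + de) / m) (divr_ge0 fd (ltW m_gt0)) a01.
rewrite -(ler_pM2l (powR_gt0 a m_gt0)) -powRM ?(ltW m_gt0) ?divr_ge0 ?(ltW m_gt0)//.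
rewrite mulrCA divff ?gt_eqF// mulr1 => /le_trans; apply.
rewrite le_eqVlt; apply/orP; left; apply/eqP.
by rewrite /k1 /k2; field; rewrite gt_eqF.
Qed.

(** In terms of independent normals X, Y, Z, W the arguments of [F] and [G] are r X + tau Z and r
    (rho X + sg Y) + tau W: each has variance 1, and their covariance is r^2 rho. *)
Lemma heat_correlation (F G : R -> R) (C rho sg r tau ka : R) :
  measurable_fun setT F -> measurable_fun setT G ->
  (forall x, 0 <= F x <= C) -> (forall x, 0 <= G x <= C) ->
  0 <= rho -> 0 <= sg -> rho ^+ 2 + sg ^+ 2 = 1 ->
  0 < r -> 0 < tau -> r ^+ 2 + tau ^+ 2 = 1 -> 0 < ka ->
  (r ^+ 2 * rho) ^+ 2 + ka ^+ 2 = 1 ->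
  (\int[N2]_p (heat tau F (r * p.1) * heat tau G (r * (rho * p.1 + sg * p.2)))%:E =
   \int[N2]_p (F p.1 * G (r ^+ 2 * rho * p.1 + ka * p.2))%:E)%E.
Proof.
move=> mF mG FC GC rho0 sg0 rs1 r0 tau0 rt1 ka0 rka.
have F0 x : 0 <= F x by have /andP[] := FC x.
have G0 x : 0 <= G x by have /andP[] := GC x.
have mhF := measurable_heat_ge0 tau mF F0.
have mhG := measurable_heat_ge0 tau mG G0.
have hF0 x : 0 <= heat tau F x by have /andP[] := heat_bounds tau x mF FC.
have hG0 x : 0 <= heat tau G x by have /andP[] := heat_bounds tau x mG GC.
(* The standard deviation of r sg Y + tau W, the part of the second argument that is independent of
   X. *)
pose k1 := Num.sqrt ((r * sg) ^+ 2 + tau ^+ 2).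
have k12 : (r * sg) ^+ 2 + tau ^+ 2 = k1 ^+ 2.
  by rewrite sqr_sqrtr// addr_ge0 ?sqr_ge0.
have k10 : 0 < k1 by rewrite sqrtr_gt0 ltr_wpDl ?sqr_ge0// exprn_gt0.
pose H1 := heat k1 G.
have mH1 : measurable_fun setT H1 by exact: measurable_heat_ge0.
have H1C x : 0 <= H1 x <= C by exact: heat_bounds.
have H10 x : 0 <= H1 x by have /andP[] := H1C x.
have mid : measurable_fun setT (fun p : R * R => (F (r * p.1 + tau * p.2) * H1 (r * rho * p.1))%:E).
  apply/measurable_EFinP; apply: measurable_funM.
    by apply: measurableT_comp => //; exact: measurable_fun_lin2.
  by apply: measurableT_comp => //; exact: measurable_funM.
have fin : measurable_fun setT (fun p : R * R => (F p.1 * H1 (r * rho * (r * p.1 + - tau * p.2)))%:E).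
  apply/measurable_EFinP; apply: measurable_funM; first exact: measurableT_comp.
  apply: measurableT_comp => //; apply: measurable_funM => //.
  exact: measurable_fun_lin2.
transitivity (\int[N2]_p (F (r * p.1 + tau * p.2) * H1 (r * rho * p.1))%:E)%E.
  have m1 : measurable_fun setT (fun p : R * R =>
      heat tau F (r * p.1) * heat tau G (r * (rho * p.1 + sg * p.2))).
    apply: measurable_funM.
      by apply: (measurableT_comp mhF); exact: measurable_funM.
    apply: (measurableT_comp mhG); apply: measurable_funM => //.
    exact: measurable_fun_lin2.
  rewrite (gauss2_iter (f := fun x y =>
      heat tau F (r * x) * heat tau G (r * (rho * x + sg * y))) m1); last by move=> x y; rewrite mulr_ge0.
  have m2 : measurable_fun setT (fun p : R * R => F (r * p.1 + tau * p.2) * H1 (r * rho * p.1)).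
    exact/measurable_EFinP.
  rewrite (gauss2_iter (f := fun x y => F (r * x + tau * y) * H1 (r * rho * x)) m2); last first.
    by move=> x y; rewrite mulr_ge0.
  apply: eq_integral => x _.
  transitivity (heat tau F (r * x) * H1 (r * rho * x))%:E.
    rewrite /H1 -(heat_semigroup _ mG GC (mulr_ge0 (ltW r0) sg0) k10 k12).
    rewrite (heatZ _ _ mhG (fun y => heat_bounds tau y mG GC) (hF0 _)).
    apply: eq_integral => y _; congr (_ * heat _ _ _)%:E.
    by ring.
  rewrite mulrC (heatZ _ _ mF FC (H10 _)).
  by apply: eq_integral => y _; rewrite mulrC.
(* Rotating the pair X, Z makes the argument of [F] a coordinate, and X becomes r p.1 - tau p.2. *)
transitivity (\int[N2]_p (F p.1 * H1 (r * rho * (r * p.1 + - tau * p.2)))%:E)%E.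
  have := gauss2_rotation (ltW r0) rt1 fin; rewrite /= => <-; last first.
    by move=> p; rewrite lee_fin mulr_ge0.
  apply: eq_integral => p _ /=; congr (_ * H1 _)%:E.
  transitivity (r * rho * ((r ^+ 2 + tau ^+ 2) * p.1)); last by ring.
  by rewrite rt1 mul1r.
have m3 : measurable_fun setT (fun p : R * R => F p.1 * H1 (r * rho * (r * p.1 + - tau * p.2))).
  exact/measurable_EFinP.
rewrite (gauss2_iter (f := fun x y => F x * H1 (r * rho * (r * x + - tau * y))) m3); last first.
  by move=> x y; rewrite mulr_ge0.
have m4 : measurable_fun setT (fun p : R * R => F p.1 * G (r ^+ 2 * rho * p.1 + ka * p.2)).
  apply: measurable_funM; first exact: measurableT_comp.
  by apply: (measurableT_comp mG); exact: measurable_fun_lin2.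
rewrite (gauss2_iter (f := fun x y => F x * G (r ^+ 2 * rho * x + ka * y)) m4); last first.
  by move=> x y; rewrite mulr_ge0.
apply: eq_integral => x _.
(* The part of r rho X independent of [p.1] has deviation r rho tau; combined with [k1] it gives
   [ka]. *)
have kk : (r * rho * tau) ^+ 2 + k1 ^+ 2 = ka ^+ 2.
  have -> : ka ^+ 2 = 1 - (r ^+ 2 * rho) ^+ 2 by rewrite -rka; ring.
  rewrite -k12 !exprMn.
  have -> : tau ^+ 2 = 1 - r ^+ 2 by rewrite -rt1; ring.
  have -> : sg ^+ 2 = 1 - rho ^+ 2 by rewrite -rs1; ring.
  by ring.
have s0 : 0 <= r * rho * tau by rewrite !mulr_ge0// ltW.
transitivity (F x * heat ka G (r ^+ 2 * rho * x))%:E.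
  rewrite -(heat_semigroup _ mG GC s0 ka0 kk) -/H1 -heatN//.
  rewrite (heatZ _ _ mH1 H1C (F0 x)).
  apply: eq_integral => y _; congr (_ * H1 _)%:E.
  by ring.
by rewrite (heatZ _ _ mG GC).
Qed.

End bounded_functions.

(** At a zero limit the power is continuous from the right, hence the positivity of the terms. *)
Lemma cvg_powR {R : realType} (u : nat -> R) (X e : R) : 0 <= X -> 0 < e ->
  (forall n, 0 < u n) -> u n @[n --> \oo] --> X -> u n `^ e @[n --> \oo] --> X `^ e.
Proof.
move=> X0 e0 u0 uX; have [X_gt0|] := ltP 0 X.
  have c : {for X, continuous ((@powR R)^~ e)}.
    apply: differentiable_continuous; apply/derivable1_diffP.
    by apply: derivable_powR; rewrite in_itv/= X_gt0.
  exact: (cvg_comp _ _ uX c).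
rewrite le_eqVlt ltNge X0 orbF => /eqP X_0; rewrite X_0 powR0 ?gt_eqF//.
apply: ((cvg_at_rightP ((@powR R)^~ e) 0 0).1 (powR_cvg0 e0)).
by split=> //; rewrite -X_0.
Qed.

(** * The Gaussian inequality for bounded functions *)

Section gauss_inequality.
Context {R : realType}.
Local Notation mu := (@lebesgue_measure R).
Local Notation N := (@gauss R).
Local Notation N2 := ((@gauss R) \x (@gauss R))%E.

(** By [heat_correlation] the left side is an integral of smoothed powers with correlation [rho];
    [heat_powR_le] bounds these by powers of smoothed functions, which are [nice]. Since r^2 + tau^2
    = 1, the averages at scales r and tau compose to the integral under [gauss]. *)
Lemma gauss_ineq_bounded (a b rho sg r ka M : R) (f g : R -> R) :
  0 < a < 1 -> 0 < b < 1 -> 0 <= rho -> 0 <= sg -> rho ^+ 2 + sg ^+ 2 = 1 ->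
  a * b * rho ^+ 2 <= (1 - a) * (1 - b) -> 0 < r < 1 -> 0 < ka ->
  (r ^+ 2 * rho) ^+ 2 + ka ^+ 2 = 1 ->
  measurable_fun setT f -> measurable_fun setT g ->
  (forall x, 0 <= f x <= M) -> (forall x, 0 <= g x <= M) ->
  (\int[N2]_p (f p.1 `^ a * g (r ^+ 2 * rho * p.1 + ka * p.2) `^ b)%:E
    <= ((\int[N]_z f z) `^ a * (\int[N]_z g z) `^ b)%:E)%E.
Proof.
move=> a01 b01 rho0 sg0 rs1 abr /andP[r0 r1] ka0 rka mf mg fM gM.
have /andP[a0 a1] := a01; have /andP[b0 b1] := b01.
have f0 x : 0 <= f x by have /andP[] := fM x.
have g0 x : 0 <= g x by have /andP[] := gM x.
have M0 : 0 <= M by have /andP[h1 h2] := fM 0; exact: le_trans h2.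
pose tau := Num.sqrt (1 - r ^+ 2).
have r21 : 0 < 1 - r ^+ 2 by rewrite subr_gt0 expr_lt1// ltW.
have tau0 : 0 < tau by rewrite sqrtr_gt0.
have rt1 : r ^+ 2 + tau ^+ 2 = 1 by rewrite sqr_sqrtr ?(ltW r21)// subrKC.
pose F x := f x `^ a; pose G x := g x `^ b.
have mF : measurable_fun setT F by exact: (measurableT_comp (measurable_powR a)).
have mG : measurable_fun setT G by exact: (measurableT_comp (measurable_powR b)).
pose C := M `^ a + M `^ b.
have FC x : 0 <= F x <= C.
  rewrite powR_ge0/= (le_trans (ge0_ler_powR _ _ _ (proj2 (andP (fM x)))))
    ?nnegrE ?(ltW a0)// lerDl ?powR_ge0//.
have GC x : 0 <= G x <= C.
  rewrite powR_ge0/= (le_trans (ge0_ler_powR _ _ _ (proj2 (andP (gM x)))))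
    ?nnegrE ?(ltW b0)// lerDr ?powR_ge0//.
rewrite -(heat_correlation mF mG FC GC rho0 sg0 rs1 r0 tau0 rt1 ka0 rka).
have rt1' : r ^+ 2 + tau ^+ 2 = 1 ^+ 2 by rewrite rt1 expr1n.
have heat1 (u : R -> R) : (forall x, 0 <= u x) -> heat 1 u 0 = \int[N]_z u z.
  by move=> u0; apply: eq_Rintegral => z _; rewrite mul1r add0r.
(* The same [de] is the lower bound in [nice] and the margin in [heat_powR_le]; it tends to 0
   afterwards. *)
have step de : 0 < de ->
  (\int[N2]_p (heat tau F (r * p.1) * heat tau G (r * (rho * p.1 + sg * p.2)))%:E <=
   ((\int[N]_z f z + de) `^ a * (\int[N]_z g z + de) `^ b)%:E)%E.
  move=> de0.
  have [Cf nf] := heat_smooth_nice mf fM tau0 de0.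
  have [Cg ng] := heat_smooth_nice mg gM tau0 de0.
  have Cfm : Cf <= Num.max Cf Cg by rewrite le_max lexx.
  have Cgm : Cg <= Num.max Cf Cg by rewrite le_max lexx orbT.
  have nfm := nf _ Cfm; have ngm := ng _ Cgm.
  have r01 : 0 < r <= 1 by rewrite r0 ltW.
  have := gauss_ineq_nice rho0 rs1 a01 b01 abr de0 nfm ngm r01.
  have mhf := measurable_heat_ge0 tau mf f0; have mhg := measurable_heat_ge0 tau mg g0.
  have hfB x : `|heat tau f x| <= M.
    by have /andP[h1 h2] := heat_bounds tau x mf fM; rewrite ger0_norm.
  have hgB x : `|heat tau g x| <= M.
    by have /andP[h1 h2] := heat_bounds tau x mg gM; rewrite ger0_norm.
  rewrite (heatD_cst r de 0 mhf hfB) (heatD_cst r de 0 mhg hgB).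
  rewrite (heat_semigroup 0 mf fM (ltW r0) ltr01 rt1') (heat_semigroup 0 mg gM (ltW r0) ltr01 rt1').
  rewrite !heat1//; apply: le_trans.
  have mcorr := measurable_fun_lin2 rho sg.
  have hF0 x : 0 <= heat tau F x by have /andP[] := heat_bounds tau x mF FC.
  have hG0 x : 0 <= heat tau G x by have /andP[] := heat_bounds tau x mG GC.
  apply: ge0_le_integral.
  - exact: measurableT.
  - by move=> p _; rewrite lee_fin mulr_ge0.
  - apply/measurable_EFinP; apply: measurable_funM.
      apply: (measurableT_comp (measurable_heat_ge0 tau mF _)); first by move=> x; have /andP[] := FC x.
      exact: measurable_funM.
    apply: (measurableT_comp (measurable_heat_ge0 tau mG _)); first by move=> x; have /andP[] := GC x.
    exact: measurable_funM.
  - apply/measurable_EFinP; apply: measurable_funM.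
      apply: (measurableT_comp (measurable_powR a)); apply: measurable_funD => //.
      by apply: (measurableT_comp mhf); exact: measurable_funM.
    apply: (measurableT_comp (measurable_powR b)); apply: measurable_funD => //.
    by apply: (measurableT_comp mhg); exact: measurable_funM.
  - move=> p _; rewrite lee_fin; apply: ler_pM => //.
      exact: heat_powR_le mf fM a01 de0.
    exact: heat_powR_le mg gM b01 de0.
set L := (\int[N2]_p _)%E in step *.
set A := \int[N]_z f z in step *; set B := \int[N]_z g z in step *.
have A0 : 0 <= A by apply: Rintegral_ge0 => z _.
have B0 : 0 <= B by apply: Rintegral_ge0 => z _.
pose h (n : nat) : R := (A + n.+1%:R^-1) `^ a * (B + n.+1%:R^-1) `^ b.
have hcvg : h n @[n --> \oo] --> A `^ a * B `^ b.
  have c1 (X e : R) : 0 <= X -> 0 < e -> (X + n.+1%:R^-1) `^ e @[n --> \oo] --> X `^ e.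
    move=> X0 e0; apply: cvg_powR => //; first by move=> n; rewrite ltr_wpDl.
    rewrite -[X in _ --> X]addr0; apply: cvgD; first exact: cvg_cst.
    exact: cvg_harmonic.
  by apply: cvgM; apply: c1.
apply/lee_addgt0Pr => e e0.
have /cvgrPdist_lt/(_ _ e0)[n _ /(_ n (leqnn n))/= hn] := hcvg.
apply: (le_trans (step n.+1%:R^-1 _)); first by rewrite invr_gt0.
rewrite -EFinD lee_fin -/(h n) -lerBlDl ltW// (le_lt_trans _ hn)//.
by rewrite distrC ler_norm.
Qed.

End gauss_inequality.

(** * The joint density, and removal of the bounds *)

Section gauss_inequality_general.
Context {R : realType}.
Local Notation mu := (@lebesgue_measure R).
Local Notation N := (@gauss R).
Local Notation N2 := ((@gauss R) \x (@gauss R))%E.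

Lemma lebesgue2_iter (f : R -> R -> R) : measurable_fun setT (fun p : R * R => f p.1 p.2) ->
  (forall x y, 0 <= f x y) ->
  (\int[mu \x mu]_p (f p.1 p.2)%:E = \int[mu]_x \int[mu]_y (f x y)%:E)%E.
Proof.
move=> mf f0; rewrite fubini_tonelli1; first by [].
- by apply/measurable_EFinP; exact: mf.
- by move=> p; rewrite lee_fin; exact: f0.
Qed.

(** The joint density of two standard normals with correlation [rho]: the density of the first times
    the conditional density of the second, of mean rho p.1 and variance 1 - rho^2. *)
Definition bigauss (rho : R) (p : R * R) : R :=
  gauss_pdf p.1 * (gauss_pdf ((p.2 - rho * p.1) / Num.sqrt (1 - rho ^+ 2)) /
    Num.sqrt (1 - rho ^+ 2)).

Lemma bigauss_ge0 rho p : 0 <= bigauss rho p.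
Proof.
by rewrite mulr_ge0// ?divr_ge0 ?sqrtr_ge0// ltW// gauss_pdf_gt0.
Qed.

Lemma measurable_bigauss rho : measurable_fun setT (bigauss rho).
Proof.
apply: measurable_funM.
  by apply: (measurableT_comp measurable_gauss_pdf); exact: measurable_fst.
apply: measurable_funM => //.
apply: (measurableT_comp measurable_gauss_pdf); apply: measurable_funM => //.
by apply: measurable_funB => //; exact: measurable_funM.
Qed.

Lemma integral_bigauss (rho : R) (F G : R -> R) : rho ^+ 2 < 1 ->
  measurable_fun setT F -> measurable_fun setT G ->
  (forall x, 0 <= F x) -> (forall x, 0 <= G x) ->
  (\int[N2]_p (F p.1 * G (rho * p.1 + Num.sqrt (1 - rho ^+ 2) * p.2))%:E =
   \int[mu \x mu]_p (F p.1 * G p.2 * bigauss rho p)%:E)%E.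
Proof.
move=> rho1 mF mG F0 G0; set ka := Num.sqrt (1 - rho ^+ 2).
have ka0 : 0 < ka by rewrite sqrtr_gt0 subr_gt0.
have pdf0 x : 0 <= gauss_pdf x :> R by rewrite ltW// gauss_pdf_gt0.
have mpdf := @measurable_gauss_pdf R.
have m1 : measurable_fun setT (fun p : R * R => (F p.1 * G (rho * p.1 + ka * p.2))%:E).
  apply/measurable_EFinP; apply: measurable_funM; first exact: measurableT_comp.
  by apply: (measurableT_comp mG); exact: measurable_fun_lin2.
rewrite ge0_integral_gauss2//; last by move=> p; rewrite lee_fin mulr_ge0.
under eq_integral do rewrite -EFinM.
have m2 : measurable_fun setT (fun p : R * R => (F p.1 * G (rho * p.1 + ka * p.2)) *
    (gauss_pdf p.1 * gauss_pdf p.2)).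
  apply: measurable_funM; first exact/measurable_EFinP.
  by apply: measurable_funM; apply: (measurableT_comp mpdf).
have m3 : measurable_fun setT (fun p : R * R => F p.1 * G p.2 * bigauss rho p).
  apply: measurable_funM; last exact: measurable_bigauss.
  by apply: measurable_funM; exact: measurableT_comp.
rewrite (lebesgue2_iter (f := fun x y => (F x * G (rho * x + ka * y)) *
    (gauss_pdf x * gauss_pdf y)) m2); last by move=> x y; rewrite mulr_ge0 ?mulr_ge0.
have m3' : measurable_fun setT (fun p : R * R => F p.1 * G p.2 * bigauss rho (p.1, p.2)).
  by move: m3; apply: eq_measurable_fun => -[].
rewrite [RHS](_ : _ = \int[mu \x mu]_p (F p.1 * G p.2 * bigauss rho (p.1, p.2))%:E)%E; last first.
  by apply: eq_integral => -[].
rewrite (lebesgue2_iter (f := fun x y => F x * G y * bigauss rho (x, y)) m3'); last first.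
  by move=> x y; rewrite mulr_ge0 ?bigauss_ge0// mulr_ge0.
apply: eq_integral => x _.
have m4 : measurable_fun setT (fun y => (F x * G y * bigauss rho (x, y))%:E).
  by apply/measurable_EFinP; exact: (measurable_fun_pair2 x m3).
have n4 y : (0 <= (F x * G y * bigauss rho (x, y))%:E)%E.
  by rewrite lee_fin mulr_ge0 ?bigauss_ge0// mulr_ge0.
have := ge0_integral_affine (rho * x) ka0 m4 n4 => /= h.
have ka0' : (0 <= ka%:E)%E by rewrite lee_fin ltW.
have : (ka%:E * (ka^-1%:E * \int[mu]_y (F x * G y * bigauss rho (x, y))%:E) =
   \int[mu]_y (F x * G y * bigauss rho (x, y))%:E)%E.
  by rewrite muleA -EFinM divff ?gt_eqF// mul1e.
move=> <-; rewrite -h -ge0_integralZl//.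
- apply: eq_integral => y _; rewrite -!EFinM /bigauss -/ka/= addrK; congr EFin.
  rewrite [ka * y + rho * x]addrC (_ : ka * y / ka = y); last by field; rewrite gt_eqF.
  by field; rewrite gt_eqF.
- apply: (measurableT_comp m4); exact: measurable_affine.
Qed.

Lemma bigauss_cvg (rho : R) (u : nat -> R) p : rho ^+ 2 < 1 ->
  u n @[n --> \oo] --> rho -> bigauss (u n) p @[n --> \oo] --> bigauss rho p.
Proof.
move=> rho1 ur; pose ka (x : R) : R := Num.sqrt (1 - x ^+ 2).
have cka : ka (u n) @[n --> \oo] --> ka rho.
  have c1 : (1 - u n ^+ 2) @[n --> \oo] --> 1 - rho ^+ 2.
    by apply: cvgB; [exact: cvg_cst|exact: (cvg_comp _ _ ur (@sqr_continuous R rho))].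
  exact: (cvg_comp _ _ c1 (@sqrt_continuous R _)).
have ka0 : ka rho != 0 by rewrite gt_eqF// sqrtr_gt0 subr_gt0.
have ckaV : (ka (u n))^-1 @[n --> \oo] --> (ka rho)^-1 by exact: cvgV.
apply: cvgM; first exact: cvg_cst.
apply: cvgM => //.
have c2 : ((p.2 - u n * p.1) / ka (u n)) @[n --> \oo] --> (p.2 - rho * p.1) / ka rho.
  apply: cvgM => //; apply: cvgB; first exact: cvg_cst.
  by apply: cvgM; [exact: ur|exact: cvg_cst].
exact: (cvg_comp _ _ c2 (@continuous_normal_pdf R 0 1 (oner_neq0 _) _)).
Qed.

(** Writing the inequality with [bigauss] puts the correlation into a continuous factor, so that
    smaller correlations can tend to [rho] although [f] and [g] are only measurable. Fatou's lemma
    takes this limit together with that of the truncations. *)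
Lemma gauss_ineq (a b rho A B : R) (f g : R -> R) :
  0 < a < 1 -> 0 < b < 1 -> 0 <= rho -> rho ^+ 2 < 1 ->
  a * b * rho ^+ 2 <= (1 - a) * (1 - b) ->
  measurable_fun setT f -> measurable_fun setT g ->
  (forall x, 0 <= f x) -> (forall x, 0 <= g x) ->
  (\int[mu]_x (f x * gauss_pdf x)%:E = A%:E)%E ->
  (\int[mu]_x (g x * gauss_pdf x)%:E = B%:E)%E ->
  (\int[mu \x mu]_p (f p.1 `^ a * g p.2 `^ b * bigauss rho p)%:E
    <= (A `^ a * B `^ b)%:E)%E.
Proof.
move=> a01 b01 rho0 rho1 abr mf mg f0 g0 fA gB.
have /andP[a0 a1] := a01; have /andP[b0 b1] := b01.
have trunc_int (h : R -> R) (n : nat) (H : R) : measurable_fun setT h -> (forall x, 0 <= h x) ->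
    (\int[mu]_x (h x * gauss_pdf x)%:E = H%:E)%E ->
    0 <= \int[N]_z (Num.min (h z) n%:R) <= H.
  move=> mh h0 hH.
  have m0 z : 0 <= Num.min (h z) n%:R by rewrite le_min h0/=.
  have mm : measurable_fun setT (fun z => Num.min (h z) n%:R) by exact: measurable_minr.
  rewrite Rintegral_ge0//= -lee_fin /Rintegral fineK; last first.
    apply: integrable_fin_num => //; apply: (integrable_gauss_bounded (c := n%:R)) => // z.
    by rewrite ger0_norm// ge_min lexx orbT.
  rewrite -hH ge0_integral_gauss; last 2 first.
  - by apply/measurable_EFinP.
  - by move=> z; rewrite lee_fin.
  apply: ge0_le_integral => //.
  - by move=> z _; rewrite -EFinM lee_fin mulr_ge0// ltW// gauss_pdf_gt0.
  - apply: emeasurable_funM; apply/measurable_EFinP => //; exact: measurable_gauss_pdf.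
  - apply/measurable_EFinP; apply: measurable_funM => //; exact: measurable_gauss_pdf.
  - move=> z _; rewrite -EFinM lee_fin ler_wpM2r//; first by rewrite ltW// gauss_pdf_gt0.
    by rewrite ge_min lexx.
(* The offset 2 keeps [s n] strictly between 0 and 1 from n = 0 on; its square root is the [r] of
   [gauss_ineq_bounded]. *)
pose s (n : nat) : R := 1 - n.+2%:R^-1.
have s01 n : 0 < s n < 1.
  by rewrite /s subr_gt0 invf_lt1 ?ltr0n// ltr1n/= gtrBl invr_gt0 ltr0n.
pose f_ (n : nat) (p : R * R) := (Num.min (f p.1) n%:R `^ a * Num.min (g p.2) n%:R `^ b
  * bigauss (s n * rho) p)%:E.
have mfn n : measurable_fun setT (fun x => Num.min (f x) n%:R) by exact: measurable_minr.
have mgn n : measurable_fun setT (fun x => Num.min (g x) n%:R) by exact: measurable_minr.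
have mfna n : measurable_fun setT (fun x => Num.min (f x) n%:R `^ a).
  exact: (measurableT_comp (measurable_powR a)).
have mgnb n : measurable_fun setT (fun x => Num.min (g x) n%:R `^ b).
  exact: (measurableT_comp (measurable_powR b)).
have mf_ n : measurable_fun setT (f_ n).
  apply/measurable_EFinP; apply: measurable_funM; last exact: measurable_bigauss.
  by apply: measurable_funM; [exact: (measurableT_comp (mfna n))|exact: (measurableT_comp (mgnb n))].
have f_0 n p : (0 <= f_ n p)%E.
  by rewrite lee_fin mulr_ge0 ?bigauss_ge0// mulr_ge0 ?powR_ge0.
have f_le n : (\int[mu \x mu]_p f_ n p <= (A `^ a * B `^ b)%:E)%E.
  have /andP[sn0 sn1] := s01 n.
  have srho : (s n * rho) ^+ 2 < 1.
    rewrite exprMn (le_lt_trans _ rho1)// ler_piMl ?sqr_ge0//.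
    by rewrite expr_le1// ltW.
  rewrite -(integral_bigauss srho (mfna n) (mgnb n)); try by move=> x; exact: powR_ge0.
  have rs : rho ^+ 2 + Num.sqrt (1 - rho ^+ 2) ^+ 2 = 1.
    by rewrite sqr_sqrtr ?subrKC// subr_ge0 ltW.
  have r01 : 0 < Num.sqrt (s n) < 1.
    by rewrite sqrtr_gt0 sn0/= -[ltRHS]sqrtr1 ltr_sqrt.
  have ka0 : 0 < Num.sqrt (1 - (s n * rho) ^+ 2) by rewrite sqrtr_gt0 subr_gt0.
  have r2 : Num.sqrt (s n) ^+ 2 = s n by rewrite sqr_sqrtr// ltW.
  have rka : (Num.sqrt (s n) ^+ 2 * rho) ^+ 2 + Num.sqrt (1 - (s n * rho) ^+ 2) ^+ 2 = 1.
    by rewrite r2 sqr_sqrtr ?subrKC// subr_ge0 ltW.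
  have minB (h : R -> R) : (forall x, 0 <= h x) -> forall x, 0 <= Num.min (h x) n%:R <= n%:R.
    by move=> h0 x; rewrite le_min h0 ge_min lexx orbT/= ler0n.
  have := gauss_ineq_bounded a01 b01 rho0 (sqrtr_ge0 _) rs abr r01 ka0 rka
    (mfn n) (mgn n) (minB _ f0) (minB _ g0).
  rewrite r2 => /le_trans; apply; rewrite lee_fin.
  have /andP[A1 A2] := trunc_int f n A mf f0 fA.
  have /andP[B1 B2] := trunc_int g n B mg g0 gB.
  by rewrite ler_pM ?powR_ge0// ge0_ler_powR ?nnegrE ?(ltW a0) ?(ltW b0)// (le_trans _ A2, le_trans _ B2).
have f_cvg p : f_ n p @[n --> \oo] --> (f p.1 `^ a * g p.2 `^ b * bigauss rho p)%:E.
  apply: cvg_EFin; first by near=> n.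
  have stab (x e : R) : Num.min x n%:R `^ e @[n --> \oo] --> x `^ e.
    apply: cvg_near_cst; near=> n; rewrite min_l//.
    by near: n; exact: nbhs_infty_ger.
  apply: cvgM; first by apply: cvgM; exact: stab.
  apply: bigauss_cvg => //.
  rewrite -[X in _ --> X]mul1r; apply: cvgM; last exact: cvg_cst.
  rewrite -[X in _ --> X]subr0; apply: cvgB; first exact: cvg_cst.
  have := @cvg_harmonic R; rewrite -cvg_shiftS; exact.
rewrite (_ : (\int[mu \x mu]_p _)%E = \int[mu \x mu]_p limn_einf (f_ ^~ p))%E; last first.
  apply: eq_integral => p _; have := f_cvg p => /cvg_lim h.
  rewrite is_cvg_limn_einfE; first by rewrite h.
  by apply/cvg_ex; eexists; exact: f_cvg.
have hf : (\int[mu \x mu]_p limn_einf (f_ ^~ p) <=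
    limn_einf (fun n => \int[mu \x mu]_p f_ n p))%E by apply: fatou => //.
apply: (le_trans hf); rewrite limn_einf_lim; apply: lime_le; first exact: is_cvg_einfs.
apply: nearW => n; apply: le_trans (f_le n); apply: ereal_inf_lbound.
by exists n => /=.
Unshelve. all: end_near. Qed.

End gauss_inequality_general.

(** * Young's inequality with the sharp constant *)

Section sharp_bilinear.
Context {R : realType}.
Local Notation mu := (@lebesgue_measure R).

Lemma heat_kernel_ge0 (t x : R) : 0 <= heat_kernel t x.
Proof. by rewrite mulr_ge0 ?expR_ge0// invr_ge0 mulr_ge0// sqrtr_ge0. Qed.

Lemma measurable_heat_kernel (t : R) : measurable_fun setT (heat_kernel t).
Proof.
apply: measurable_funM => //; apply: measurableT_comp => //.
apply: measurableT_comp => //; apply: measurable_funM => //.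
Qed.

Lemma gauss_pdfV_powR (x a : R) : (gauss_pdf x)^-1 `^ a =
  Num.sqrt (2 * pi) `^ a * expR (a * x ^+ 2 / 2).
Proof.
rewrite gauss_pdfE invfM invrK -expRN opprK powRM ?sqrtr_ge0 ?expR_ge0// -expRM.
by congr (_ * expR _); ring.
Qed.

Lemma lebesgue2_scale (la mu' : R) (f : R -> R -> R) : 0 < la -> 0 < mu' ->
  measurable_fun setT (fun p : R * R => f p.1 p.2) -> (forall x y, 0 <= f x y) ->
  (\int[mu \x mu]_p (f (la * p.1) (mu' * p.2))%:E =
   ((la * mu')^-1)%:E * \int[mu \x mu]_p (f p.1 p.2)%:E)%E.
Proof.
move=> la0 mu0 mf f0.
have ms : measurable_fun setT (fun p : R * R => f (la * p.1) (mu' * p.2)).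
  have m1 : measurable_fun setT (fun p : R * R => la * p.1) by exact: measurable_funM.
  have m2 : measurable_fun setT (fun p : R * R => mu' * p.2) by exact: measurable_funM.
  exact: (measurableT_comp mf (measurable_fun_pair m1 m2)).
rewrite (lebesgue2_iter (f := fun x y => f (la * x) (mu' * y)) ms) ?(lebesgue2_iter mf)//.
have mfx x : measurable_fun setT (fun y => (f x y)%:E).
  by apply/measurable_EFinP; exact: (measurable_fun_pair2 x mf).
pose h x := (\int[mu]_y (f x y)%:E)%E.
have mh : measurable_fun setT h.
  apply: (measurable_fun_fubini_tonelli_F (m2 := mu) (fun p : R * R => (f p.1 p.2)%:E)) => //.
    exact/measurable_EFinP.
  by move=> p; rewrite lee_fin.
have h0 x : (0 <= h x)%E by apply: integral_ge0 => y _; rewrite lee_fin.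
transitivity (\int[mu]_x (mu'^-1%:E * h (la * x + 0)%R))%E.
  apply: eq_integral => x _; rewrite addr0.
  rewrite -(ge0_integral_affine 0 mu0 (mfx (la * x))); last by move=> y; rewrite lee_fin.
  by apply: eq_integral => y _; rewrite addr0.
rewrite ge0_integralZl_EFin; last 4 first.
- exact: measurableT.
- by move=> x _; exact: h0.
- exact: (measurableT_comp mh (measurable_affine la 0)).
- by rewrite invr_ge0 ltW.
by rewrite (ge0_integral_affine 0 la0 mh h0) muleA -EFinM -invfM mulrC.
Qed.

(* The scales la and nu and the correlation are chosen so that bigauss divided by
   the 1/p-th and 1/s-th powers of the two Gaussian densities is a multiple of
   the heat kernel. *)
Lemma sharp_bilinear (p s t al be : R) (F G : R -> R) :
  let a := p^-1 in let b := s^-1 in let d := a + b - 1 in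
  1 < p -> 1 < s -> 0 < d -> 0 < t ->
  measurable_fun setT F -> measurable_fun setT G ->
  (forall x, 0 <= F x) -> (forall x, 0 <= G x) ->
  (\int[mu]_x (F x `^ p)%:E = al%:E)%E ->
  (\int[mu]_x (G x `^ s)%:E = be%:E)%E ->
  forall la nu sg c : R,
  la = Num.sqrt (2 * t * a * (1 - a) / d) ->
  nu = Num.sqrt (2 * t * b * (1 - b) / d) ->
  sg = Num.sqrt (d / (a * b)) ->
  c = Num.sqrt (2 * pi) `^ a * Num.sqrt (2 * pi) `^ b / (2 * pi * sg) ->
  (\int[mu \x mu]_q (F q.1 * G q.2 * heat_kernel t (q.2 - q.1))%:E <=
   (la * nu / (c * (2 * Num.sqrt (pi * t))) * ((al / la) `^ a * (be / nu) `^ b))%:E)%E.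
Proof.
move=> a b d p1 s1 d0 t0 mF mG F0 G0 Fal Gbe la nu sg c laE nuE sgE cE.
have p0 : 0 < p by exact: lt_trans p1.
have s0 : 0 < s by exact: lt_trans s1.
have a0 : 0 < a by rewrite invr_gt0.
have b0 : 0 < b by rewrite invr_gt0.
have a1 : a < 1 by rewrite invf_lt1.
have b1 : b < 1 by rewrite invf_lt1.
have a01 : 0 < a < 1 by rewrite a0.
have b01 : 0 < b < 1 by rewrite b0.
have a'0 : 0 < 1 - a by rewrite subr_gt0.
have b'0 : 0 < 1 - b by rewrite subr_gt0.
have la20 : 0 < 2 * t * a * (1 - a) / d by rewrite divr_gt0// !mulr_gt0.
have nu20 : 0 < 2 * t * b * (1 - b) / d by rewrite divr_gt0// !mulr_gt0.
have la0 : 0 < la by rewrite laE sqrtr_gt0.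
have nu0 : 0 < nu by rewrite nuE sqrtr_gt0.
pose w : R := Num.sqrt (a * (1 - a) * (b * (1 - b))).
have w0 : 0 <= w by exact: sqrtr_ge0.
have w2 : w ^+ 2 = a * (1 - a) * (b * (1 - b)).
  by rewrite sqr_sqrtr// !mulr_ge0// ltW.
have lanu : la * nu = 2 * t * w / d.
  rewrite laE nuE; apply/eqP; rewrite -(eqrXn2 (n := 2))// ?mulr_ge0 ?sqrtr_ge0 ?invr_ge0// ?(ltW d0) ?(ltW t0)//.
  rewrite !exprMn w2 !sqr_sqrtr ?(ltW la20) ?(ltW nu20)// exprVn.
  by apply/eqP; field; rewrite gt_eqF.
(* The largest correlation allowed: a b rho^2 = (1 - a)(1 - b). Then 1 - rho^2 = d / (a b), positive
   because d is. *)
pose rho := w / (a * b).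
have ab0 : 0 < a * b by rewrite mulr_gt0.
have rho0 : 0 <= rho by rewrite divr_ge0// ltW.
have rho2 : rho ^+ 2 = (1 - a) * (1 - b) / (a * b).
  by rewrite /rho expr_div_n w2; field; rewrite !gt_eqF.
have sg2 : 1 - rho ^+ 2 = d / (a * b).
  by rewrite rho2 /d; field; rewrite !gt_eqF.
have sqE : Num.sqrt (1 - rho ^+ 2) = sg by rewrite sg2 sgE.
have dab0 : 0 < d / (a * b) by rewrite divr_gt0.
have sgsq : sg ^+ 2 = d / (a * b) by rewrite sgE sqr_sqrtr// ltW.
have sg0 : 0 < sg by rewrite sgE sqrtr_gt0 divr_gt0.
have rho1 : rho ^+ 2 < 1 by rewrite -subr_gt0 sg2 divr_gt0.
have abr : a * b * rho ^+ 2 <= (1 - a) * (1 - b).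
  by rewrite rho2 mulrCA divff ?mulr1// gt_eqF.
(* Division by the density turns integrals under [gauss] into Lebesgue integrals, and the powers a =
   1/p and b = 1/s bring back [F] and [G] linearly. *)
pose f x := F (la * x) `^ p / gauss_pdf x.
pose g x := G (nu * x) `^ s / gauss_pdf x.
have pdf0 x : 0 < gauss_pdf x :> R by exact: gauss_pdf_gt0.
have mpdf := @measurable_gauss_pdf R.
have mpdfV : measurable_fun setT (fun x : R => (gauss_pdf x)^-1).
  rewrite (_ : (fun x => _) = (fun x => (gauss_pdf x) `^ (-1))); last first.
    by apply/funext => x; rewrite powR_inv1// ltW.
  exact: (measurableT_comp (measurable_powR (-1))).
have mFp : measurable_fun setT (fun x => F x `^ p) by exact: (measurableT_comp (measurable_powR p)).
have mGs : measurable_fun setT (fun x => G x `^ s) by exact: (measurableT_comp (measurable_powR s)).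
have mf : measurable_fun setT f.
  by apply: measurable_funM => //; apply: (measurableT_comp mFp); exact: measurable_funM.
have mg : measurable_fun setT g.
  by apply: measurable_funM => //; apply: (measurableT_comp mGs); exact: measurable_funM.
have f0 x : 0 <= f x by rewrite divr_ge0 ?powR_ge0// ltW.
have g0 x : 0 <= g x by rewrite divr_ge0 ?powR_ge0// ltW.
have fA : (\int[mu]_x (f x * gauss_pdf x)%:E = (al / la)%:E)%E.
  rewrite mulrC EFinM -Fal -(ge0_integral_affine 0 la0); last 2 first.
  - exact/measurable_EFinP.
  - by move=> x; rewrite lee_fin powR_ge0.
  by apply: eq_integral => x _; rewrite /f divfK ?gt_eqF// addr0.
have gB : (\int[mu]_x (g x * gauss_pdf x)%:E = (be / nu)%:E)%E.
  rewrite mulrC EFinM -Gbe -(ge0_integral_affine 0 nu0); last 2 first.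
  - exact/measurable_EFinP.
  - by move=> x; rewrite lee_fin powR_ge0.
  by apply: eq_integral => x _; rewrite /g divfK ?gt_eqF// addr0.
have := gauss_ineq a01 b01 rho0 rho1 abr mf mg f0 g0 fA gB.
have pa : p * a = 1 by rewrite /a divff// gt_eqF.
have sb : s * b = 1 by rewrite /b divff// gt_eqF.
have fa x : f x `^ a = F (la * x) * (Num.sqrt (2 * pi) `^ a * expR (a * x ^+ 2 / 2)).
  rewrite powRM ?powR_ge0 ?invr_ge0 ?(ltW (pdf0 x))// -powRrM pa powRr1//.
  by rewrite gauss_pdfV_powR.
have gb x : g x `^ b = G (nu * x) * (Num.sqrt (2 * pi) `^ b * expR (b * x ^+ 2 / 2)).
  rewrite powRM ?powR_ge0 ?invr_ge0 ?(ltW (pdf0 x))// -powRrM sb powRr1//.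
  by rewrite gauss_pdfV_powR.
pose k := c * (2 * Num.sqrt (pi * t)).
have pi0 := pi_gt0 R.
have c0 : 0 < c by rewrite cE divr_gt0// !mulr_gt0// powR_gt0// sqrtr_gt0 mulr_gt0.
have st0 : 0 < Num.sqrt (pi * t) by rewrite sqrtr_gt0 mulr_gt0.
have k0 : 0 < k by rewrite !mulr_gt0.
pose H x y := F x * G y * heat_kernel t (y - x).
have H0 x y : 0 <= H x y by rewrite mulr_ge0 ?heat_kernel_ge0// mulr_ge0.
have mH : measurable_fun setT (fun q : R * R => H q.1 q.2).
  apply: measurable_funM; first by apply: measurable_funM; exact: measurableT_comp.
  by apply: (measurableT_comp (measurable_heat_kernel t)); exact: measurable_funB.
have mHs : measurable_fun setT (fun q : R * R => (H (la * q.1) (nu * q.2))%:E).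
  have m1 : measurable_fun setT (fun p : R * R => la * p.1) by exact: measurable_funM.
  have m2 : measurable_fun setT (fun p : R * R => nu * p.2) by exact: measurable_funM.
  by apply/measurable_EFinP; exact: (measurableT_comp mH (measurable_fun_pair m1 m2)).
have -> : (\int[mu \x mu]_q (f q.1 `^ a * g q.2 `^ b * bigauss rho q)%:E =
    k%:E * \int[mu \x mu]_q (H (la * q.1) (nu * q.2))%:E)%E.
  rewrite -ge0_integralZl_EFin//; last 2 first.
  - by move=> q _; rewrite lee_fin.
  - exact: ltW.
  apply: eq_integral => -[x y] _; rewrite -EFinM; congr EFin => /=.
  rewrite fa gb /bigauss sqE/= !gauss_pdfE /H /heat_kernel /k cE.
  have sq : Num.sqrt (2 * pi) ^+ 2 = 2 * pi :> R by rewrite sqr_sqrtr// mulr_ge0 ?(ltW pi0).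
  have sq0 : Num.sqrt (2 * pi) != 0 :> R by rewrite gt_eqF// sqrtr_gt0 mulr_gt0.
  (* The coefficients of x^2, x y and y^2 agree; the mixed one uses la nu = 2 t w / d. *)
  have E1 : expR (- ((nu * y - la * x) ^+ 2 / (4 * t))) =
      expR (a * x ^+ 2 / 2) * expR (b * y ^+ 2 / 2) *
      (expR (- (x ^+ 2 / 2)) * expR (- (((y - rho * x) / sg) ^+ 2 / 2))).
    rewrite -!expRD; congr expR.
    rewrite expr_div_n sgsq.
    have -> : (nu * y - la * x) ^+ 2 = nu ^+ 2 * y ^+ 2 - 2 * (la * nu) * x * y + la ^+ 2 * x ^+ 2 by ring.
    rewrite lanu laE nuE !sqr_sqrtr ?(ltW la20) ?(ltW nu20)//.
    have -> : (y - rho * x) ^+ 2 = y ^+ 2 - 2 * rho * x * y + rho ^+ 2 * x ^+ 2 by ring.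
    rewrite rho2 /rho /d; field; rewrite !gt_eqF//.
  rewrite E1.
  move: (expR (a * x ^+ 2 / 2)) (expR (b * y ^+ 2 / 2)) (expR (- (x ^+ 2 / 2)))
    (expR (- (((y - rho * x) / sg) ^+ 2 / 2))) => e1 e2 e3 e4.
  move: (F (la * x)) (G (nu * y)) => Fx Gy.
  move: sq sq0; move: (Num.sqrt (2 * pi)) => S sq sq0; rewrite -sq.
  move: (S `^ a) (S `^ b) => Sa Sb; field.
  by rewrite sq0 !gt_eqF.
rewrite (lebesgue2_scale la0 nu0 mH H0).
set I := (\int[mu \x mu]_q (H q.1 q.2)%:E)%E.
rewrite -/I muleA -EFinM -lee_pdivlMl; last by rewrite mulr_gt0// invr_gt0 mulr_gt0.
rewrite -EFinM invfM invrK => /le_trans; apply; rewrite lee_fin -/k.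
by rewrite [k^-1 * _]mulrC.
Qed.

End sharp_bilinear.

(** * Evaluation of the sharp constant *)

Section sharp_constant.
Context {R : realType}.

Lemma sqrt_expR (x : R) : Num.sqrt (expR x) = expR (x / 2).
Proof.
apply/eqP; rewrite -(eqrXn2 (n := 2))// ?sqrtr_ge0 ?expR_ge0// sqr_sqrtr ?expR_ge0//.
by rewrite -expRM_natl; apply/eqP; congr expR; field.
Qed.

(* The identity only involves products, quotients, powers and square roots of
   positive numbers, so it is checked on logarithms. *)
Let sharp_constant_exp (A A' B B' D E T L P a b : R) :
  let la := Num.sqrt (expR L * expR T * expR A * expR A' / expR D) in
  let nu := Num.sqrt (expR L * expR T * expR B * expR B' / expR D) in
  let sg := Num.sqrt (expR D / (expR A * expR B)) in
  let c := Num.sqrt (expR L * expR P) `^ a * Num.sqrt (expR L * expR P) `^ b /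
    (expR L * expR P * sg) in
  let K := Num.sqrt (((expR A)^-1 `^ a / (expR A')^-1 `^ (1 - a)) *
      ((expR E)^-1 `^ (2 - a - b) / (expR D)^-1 `^ (a + b - 1)) /
      ((expR B')^-1 `^ (1 - b) / (expR B)^-1 `^ b)) *
    ((expR L * Num.sqrt (expR P)) `^ (1 - (2 - a - b)) *
      (expR E)^-1 `^ ((2 - a - b) / 2))^-1 in
  la * nu / (c * (expR L * Num.sqrt (expR P * expR T))) / (la `^ a * nu `^ b) =
  K * expR T `^ (- ((a + b - 1) / 2)).
Proof.
move=> /=.
do !rewrite ?(=^~ expRM, =^~ expRN, =^~ expRD, sqrt_expR).
by congr expR; field.
Qed.

(** With a = 1/p and b = 1 - 1/r one has e = 1/q, d = 1 - 1/q and 1 - b = 1/r, so the right side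
    spells out [young_K] in reciprocal exponents. *)
Lemma sharp_constant (a b t al be la nu sg c : R) : 0 < a < 1 -> 0 < b < 1 ->
  let d := a + b - 1 in let e := 2 - a - b in 0 < d -> 0 < t -> 0 <= al -> 0 <= be ->
  la = Num.sqrt (2 * t * a * (1 - a) / d) ->
  nu = Num.sqrt (2 * t * b * (1 - b) / d) ->
  sg = Num.sqrt (d / (a * b)) ->
  c = Num.sqrt (2 * pi) `^ a * Num.sqrt (2 * pi) `^ b / (2 * pi * sg) ->
  la * nu / (c * (2 * Num.sqrt (pi * t))) * ((al / la) `^ a * (be / nu) `^ b) =
  Num.sqrt ((a^-1 `^ a / (1 - a)^-1 `^ (1 - a)) * (e^-1 `^ e / d^-1 `^ d) /
    ((1 - b)^-1 `^ (1 - b) / b^-1 `^ b)) *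
    ((2 * Num.sqrt pi) `^ (1 - e) * e^-1 `^ (e / 2))^-1 *
    t `^ (- (d / 2)) * (al `^ a * be `^ b).
Proof.
move=> /andP[a0 a1] /andP[b0 b1] d e d0 t0 al0 be0 laE nuE sgE cE.
have e0 : 0 < e by rewrite /e; lra.
have a'0 : 0 < 1 - a by rewrite subr_gt0.
have b'0 : 0 < 1 - b by rewrite subr_gt0.
have := sharp_constant_exp (ln a) (ln (1 - a)) (ln b) (ln (1 - b)) (ln d) (ln e)
  (ln t) (ln 2) (ln pi) a b.
rewrite !lnK ?posrE ?pi_gt0// -laE -nuE -sgE /= -cE -/d -/e => h; rewrite -h.
have la0 : 0 <= la by rewrite laE sqrtr_ge0.
have nu0 : 0 <= nu by rewrite nuE sqrtr_ge0.
rewrite !powRM ?invr_ge0//.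
have powRVi (x y : R) : 0 <= x -> x^-1 `^ y = (x `^ y)^-1.
  by move=> x0; rewrite -powR_inv1// -powRrM mulN1r powRN.
by rewrite !powRVi// (invfM (la `^ a)); ring.
Qed.

End sharp_constant.

(** * Convolution with an integrable kernel *)

Section young.
Context {R : realType}.
Local Notation mu := (@lebesgue_measure R).

(** The integrand may change sign, so its positive and negative parts are integrated separately,
    each measurable by Tonelli. *)
Lemma measurable_fine_integral (k : R * R -> R) : measurable_fun setT k ->
  measurable_fun setT (fun x => fine (\int[mu]_y (k (x, y))%:E)%E).
Proof.
move=> mk; apply: (@measurableT_comp _ _ _ _ _ _ (@fine R)) => //.
have mk' : measurable_fun setT (EFin \o k) by exact/measurable_EFinP.
under eq_fun do rewrite integralE.
apply: emeasurable_funB.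
- rewrite (_ : (fun x => _) = fubini_F mu (EFin \o k)^\+%E); last first.
    by apply/funext => x; apply: eq_integral => y _; rewrite !funeposE.
  by apply: measurable_fun_fubini_tonelli_F => //; exact: measurable_funepos.
- rewrite (_ : (fun x => _) = fubini_F mu (EFin \o k)^\-%E); last first.
    by apply/funext => x; apply: eq_integral => y _; rewrite !funenegE.
  by apply: measurable_fun_fubini_tonelli_F => //; exact: measurable_funeneg.
Qed.

Lemma le_poweR (x y : \bar R) (s : R) : 0 <= s -> (0 <= x)%E -> (x <= y)%E ->
  (x `^ s <= y `^ s)%E.
Proof.
move=> s0 x0 xy; apply: gt0_ler_poweR => //; rewrite in_itv/= leey andbT//.
exact: le_trans xy.
Qed.

(** [fine] sends infinite values to 0, so bounds on the real-valued convolution hold even at points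
    where the integral diverges. *)
Lemma fine_abse_le (z : \bar R) : (`|fine z|%:E <= `|z|)%E.
Proof. by case: z => //= [|]; rewrite normr0 leey. Qed.

Lemma measurable_conv_kernel (H k : R -> R) : measurable_fun setT H -> measurable_fun setT k ->
  measurable_fun setT (fun q : R * R => H q.2 * k (q.1 - q.2)).
Proof.
move=> mH mk; apply: measurable_funM; first exact: measurableT_comp.
by apply: (measurableT_comp mk); exact: measurable_funB.
Qed.

Lemma measurable_Rintegral_conv (H k : R -> R) : measurable_fun setT H -> measurable_fun setT k ->
  measurable_fun setT (fun x : R => \int[mu]_y (H y * k (x - y))).
Proof.
move=> mH mk; apply: (measurable_fine_integral (k := fun q => H q.2 * k (q.1 - q.2))).
exact: measurable_conv_kernel.
Qed.

Lemma measurable_heat_conv (H : R -> R) t : measurable_fun setT H ->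
  measurable_fun setT (heat_conv_fun H t).
Proof. by move=> mH; apply: measurable_Rintegral_conv => //; exact: measurable_heat_kernel. Qed.

Lemma Rintegral_conv_le (H k : R -> R) x : measurable_fun setT H -> measurable_fun setT k ->
  (forall y, 0 <= k y) ->
  (`|\int[mu]_y (H y * k (x - y))|%:E <= \int[mu]_y (`|H y| * k (x - y))%:E)%E.
Proof.
move=> mH mk k0; apply: (le_trans (fine_abse_le _)).
have mHk : measurable_fun setT (fun y => (H y * k (x - y))%:E).
  by apply/measurable_EFinP; exact: (measurable_fun_pair2 x (measurable_conv_kernel mH mk)).
have := le_abse_integral mu measurableT mHk; move/le_trans; apply.
rewrite le_eqVlt; apply/orP; left; apply/eqP; apply: eq_integral => y _.
by rewrite abse_EFin normrM (ger0_norm (k0 _)).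
Qed.

Lemma heat_conv_le (H : R -> R) t x : measurable_fun setT H ->
  (`|heat_conv_fun H t x|%:E <= \int[mu]_y (`|H y| * heat_kernel t (x - y))%:E)%E.
Proof.
move=> mH; apply: Rintegral_conv_le => //; first exact: measurable_heat_kernel.
exact: heat_kernel_ge0.
Qed.

Lemma heat_kernel_normal (t x : R) : 0 < t -> heat_kernel t x = normal_pdf 0 (Num.sqrt (2 * t)) x.
Proof.
move=> t0; have s0 : Num.sqrt (2 * t) != 0 :> R by rewrite gt_eqF// sqrtr_gt0 mulr_gt0.
have s2 : Num.sqrt (2 * t) ^+ 2 = 2 * t :> R by rewrite sqr_sqrtr// mulr_ge0 ?ltW.
rewrite normal_pdfE// /normal_peak /normal_fun s2 /heat_kernel subr0; congr (_^-1 * expR _).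
  have -> : 2 * t * pi *+ 2 = 2 ^+ 2 * (pi * t) :> R by rewrite -mulr_natl; ring.
  by rewrite [RHS]sqrtrM ?sqr_ge0// sqrtr_sqr ger0_norm.
by rewrite -mulr_natl mulNr; congr (- (_ / _)); ring.
Qed.

Lemma integral_heat_kernel (t : R) : 0 < t -> (\int[mu]_x (heat_kernel t x)%:E = 1)%E.
Proof.
by move=> t0; under eq_integral do rewrite heat_kernel_normal//; exact: integral_normal_pdf.
Qed.

Lemma ge0_integral_reflect (k : R -> R) x : measurable_fun setT k -> (forall z, 0 <= k z) ->
  (\int[mu]_y (k (x - y))%:E = \int[mu]_y (k y)%:E)%E.
Proof.
move=> mk k0; have mk' : measurable_fun setT (fun y => (k y)%:E) by exact/measurable_EFinP.
have k0' y : (0 <= (k y)%:E)%E by rewrite lee_fin.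
have mk2 : measurable_fun setT (fun y : R => (k (y + x))%:E).
  by apply/measurable_EFinP; apply: (measurableT_comp mk); exact: measurable_funD.
rewrite -(ge0_integral_shift x mk' k0') -(ge0_integral_opp mk2 (fun=> k0' _)).
by apply: eq_integral => y _; rewrite addrC.
Qed.

(** Hoelder's inequality, after splitting the weight w between the two factors according to the
    conjugate exponents s / (s - 1) and s. *)
Lemma jensen_powR (w k : R -> R) (s : R) : 1 <= s -> measurable_fun setT w ->
  measurable_fun setT k -> (forall y, 0 <= w y) -> (forall y, 0 <= k y) ->
  ((\int[mu]_y (w y * k y)%:E) `^ s <=
   (\int[mu]_y (w y)%:E) `^ (s - 1) * \int[mu]_y (w y * k y `^ s)%:E)%E.
Proof.
rewrite le_eqVlt => /predU1P[<-|s1] mw mk w0 k0.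
  rewrite subrr poweRe0 mul1e poweRe1; last by apply: integral_ge0 => y _; rewrite lee_fin mulr_ge0.
  by under [leRHS]eq_integral do rewrite powRr1//.
have s0 : 0 < s by exact: lt_trans s1.
pose s' := s / (s - 1).
have s11 : 0 < s - 1 by rewrite subr_gt0.
have s'0 : 0 < s' by rewrite divr_gt0.
have ss : s'^-1 + s^-1 = 1 by rewrite /s'; field; rewrite !gt_eqF.
pose f y := w y `^ s'^-1; pose g y := w y `^ s^-1 * k y.
have mf : measurable_fun setT f by exact: (measurableT_comp (measurable_powR _)).
have mg : measurable_fun setT g.
  by apply: measurable_funM => //; exact: (measurableT_comp (measurable_powR _)).
have := hoelder mu mf mg s'0 s0 ss.
have f0 y : 0 <= f y by exact: powR_ge0.
have g0 y : 0 <= g y by rewrite mulr_ge0 ?powR_ge0.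
have -> : 'N[mu]_1[EFin \o (f \* g)%R]%E = (\int[mu]_y (w y * k y)%:E)%E.
  rewrite Lnorm1; apply: eq_integral => y _ /=.
  rewrite (ger0_norm (mulr_ge0 (f0 y) (g0 y))) /f /g mulrA -powRD ?ss ?powRr1//.
  by rewrite oner_eq0.
have -> : 'N[mu]_s'%:E[EFin \o f]%E = ((\int[mu]_y (w y)%:E) `^ s'^-1)%E.
  rewrite unlock; congr (_ `^ _)%E; apply: eq_integral => y _ /=.
  by rewrite ger0_norm// /f -powRrM mulVf ?gt_eqF// powRr1.
have -> : 'N[mu]_s%:E[EFin \o g]%E = ((\int[mu]_y (w y * k y `^ s)%:E) `^ s^-1)%E.
  rewrite unlock; congr (_ `^ _)%E; apply: eq_integral => y _ /=.
  by rewrite ger0_norm// /g powRM ?powR_ge0// -powRrM mulVf ?gt_eqF// powRr1.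
set I1 := (\int[mu]_y (w y * k y)%:E)%E; set I2 := (\int[mu]_y (w y)%:E)%E.
set I3 := (\int[mu]_y (w y * k y `^ s)%:E)%E.
have I10 : (0 <= I1)%E by apply: integral_ge0 => y _; rewrite lee_fin mulr_ge0.
have I20 : (0 <= I2)%E by apply: integral_ge0 => y _; rewrite lee_fin.
have I30 : (0 <= I3)%E by apply: integral_ge0 => y _; rewrite lee_fin mulr_ge0 ?powR_ge0.
move=> h.
have : (I1 `^ s <= (I2 `^ s'^-1 * I3 `^ s^-1) `^ s)%E.
  by apply: le_poweR => //; rewrite ltW.
rewrite poweRM ?poweR_ge0// -!poweRrM mulVf ?gt_eqF// (poweRe1 I30).
by rewrite (_ : s'^-1 * s = s - 1)//; rewrite /s'; field; rewrite !gt_eqF.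
Qed.

Lemma integral_conv (H k : R -> R) : measurable_fun setT H -> measurable_fun setT k ->
  (forall y, 0 <= H y) -> (forall y, 0 <= k y) ->
  (\int[mu]_x \int[mu]_y (H y * k (x - y))%:E =
   \int[mu]_y (H y)%:E * \int[mu]_y (k y)%:E)%E.
Proof.
move=> mH mk H0 k0.
have m := measurable_conv_kernel mH mk.
have := fubini_tonelli (m1 := mu) (m2 := mu) (fun q => (H q.2 * k (q.1 - q.2))%:E).
rewrite /= => -> //; last 2 first.
- exact/measurable_EFinP.
- by move=> q; rewrite lee_fin mulr_ge0.
have K0 : (0 <= \int[mu]_y (k y)%:E)%E by apply: integral_ge0 => y _; rewrite lee_fin.
rewrite muleC -ge0_integralZl//; last 2 first.
- exact/measurable_EFinP.
- by move=> y _; rewrite lee_fin.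
apply: eq_integral => y _; rewrite muleC -ge0_integralZl//; last 3 first.
- exact/measurable_EFinP.
- by move=> x _; rewrite lee_fin.
- by rewrite lee_fin.
have mky : measurable_fun setT (fun x => (H y)%:E * (k x)%:E)%E.
  by apply/measurable_funeM/measurable_EFinP.
have Hk0 x : (0 <= (H y)%:E * (k x)%:E)%E by rewrite mule_ge0 ?lee_fin.
by rewrite -(ge0_integral_shift (- y) mky Hk0).
Qed.

(** Jensen's inequality for the weight k (x - y) at each x, then Tonelli over x. *)
Lemma young_L1 (H k : R -> R) (p : R) : 1 <= p -> measurable_fun setT H ->
  measurable_fun setT k -> (forall y, 0 <= k y) ->
  (\int[mu]_x (`|\int[mu]_y (H y * k (x - y))| `^ p)%:E <=
   (\int[mu]_y (k y)%:E) `^ (p - 1) * (\int[mu]_x (`|H x| `^ p)%:E * \int[mu]_y (k y)%:E))%E.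
Proof.
move=> p1 mH mk k0; have p0 : 0 < p by exact: lt_le_trans p1.
have mN : measurable_fun setT (fun y => `|H y|) by exact: measurableT_comp.
have mHp : measurable_fun setT (fun y => `|H y| `^ p).
  exact: (measurableT_comp (measurable_powR p)).
rewrite -(integral_conv mHp mk (fun y => powR_ge0 _ _) k0).
have mc : measurable_fun setT (fun x : R => \int[mu]_y (`|H y| `^ p * k (x - y))%:E)%E.
  apply: (measurable_fun_fubini_tonelli_F (m2 := mu)
    (fun q : R * R => (`|H q.2| `^ p * k (q.1 - q.2))%:E)) => //.
    apply/measurable_EFinP; exact: (measurable_conv_kernel mHp mk).
  by move=> q; rewrite lee_fin mulr_ge0 ?powR_ge0.
have c0 (x : R) : (0 <= \int[mu]_y (`|H y| `^ p * k (x - y))%:E)%E.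
  by apply: integral_ge0 => y _; rewrite lee_fin mulr_ge0 ?powR_ge0.
rewrite -ge0_integralZl//; last by rewrite poweR_ge0.
apply: ge0_le_integral.
- exact: measurableT.
- by move=> x _; rewrite lee_fin powR_ge0.
- apply/measurable_EFinP; apply: (measurableT_comp (measurable_powR p)).
  by apply: measurableT_comp => //; exact: measurable_Rintegral_conv.
- exact: measurable_funeM.
- move=> x _; rewrite -poweR_EFin.
  have mkx : measurable_fun setT (fun y : R => k (x - y)).
    by apply: (measurableT_comp mk); exact: measurable_funB.
  have := jensen_powR p1 mkx mN (fun y => k0 _) (fun y => normr_ge0 _).
  rewrite (ge0_integral_reflect x mk k0).
  have -> : (\int[mu]_y (k (x - y) * `|H y| `^ p)%:E = \int[mu]_y (`|H y| `^ p * k (x - y))%:E)%E.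
    by apply: eq_integral => y _; rewrite mulrC.
  apply: le_trans; apply: le_poweR; rewrite ?(ltW p0) ?lee_fin//.
  rewrite (le_trans (Rintegral_conv_le x mH mk k0))// le_eqVlt; apply/orP; left; apply/eqP.
  by apply: eq_integral => y _; rewrite mulrC.
Qed.

Lemma young_diag (H : R -> R) (p t : R) : 1 <= p -> 0 < t -> measurable_fun setT H ->
  (\int[mu]_x (`|heat_conv_fun H t x| `^ p)%:E <= \int[mu]_x (`|H x| `^ p)%:E)%E.
Proof.
move=> p1 t0 mH.
have := young_L1 p1 mH (measurable_heat_kernel t) (heat_kernel_ge0 t).
by rewrite (integral_heat_kernel t0) poweR1r mul1e mule1; apply.
Qed.

End young.

(** * Norms of the heat kernel and the end-point cases *)

Section young_norms.
Context {R : realType}.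
Local Notation mu := (@lebesgue_measure R).

Lemma Lnorm_EFin (p : R) (f : R -> R) :
  ('N[mu]_p%:E[EFin \o f] = (\int[mu]_x (`|f x| `^ p)%:E) `^ p^-1)%E.
Proof. by rewrite unlock. Qed.

(** The L^q norm of the heat kernel at time t. For q = +oo, [fine] of the inverse is 0 and this is
    the value of the kernel at the origin. *)
Definition kernel_norm (q : \bar R) (t : R) : R :=
  young_alpha q * t `^ (- ((1 - fine (q^-1)%E) / 2)).

Let kernel_const_exp (L P T Q r r1 : R) : r != 0 -> r1 = r^-1 ->
  (expR L * Num.sqrt (expR P * expR T))^-1 `^ r *
    (expR L * Num.sqrt (expR P * (expR T / expR Q))) =
  (((expR L * Num.sqrt (expR P)) `^ (1 - r1) * expR Q `^ (r1 / 2))^-1 *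
    expR T `^ (- ((1 - r1) / 2))) `^ r.
Proof.
move=> r0 ->; do !rewrite ?(=^~ expRM, =^~ expRN, =^~ expRD, sqrt_expR).
by congr expR; field.
Qed.

Lemma kernel_norm_powR (r t : R) : 1 <= r -> 0 < t ->
  (2 * Num.sqrt (pi * t))^-1 `^ r * (2 * Num.sqrt (pi * (t / r))) = kernel_norm r%:E t `^ r.
Proof.
move=> r1 t0; have r0 : 0 < r by exact: lt_le_trans r1.
have := @kernel_const_exp (ln 2) (ln pi) (ln t) (ln r) r r^-1 (lt0r_neq0 r0) erefl.
have E2 : expR (ln 2) = 2 :> R by apply: lnK; rewrite posrE ltr0n.
have Epi : expR (ln pi) = pi :> R by apply: lnK; rewrite posrE pi_gt0.
have Et : expR (ln t) = t by apply: lnK; rewrite posrE.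
have Er : expR (ln r) = r by apply: lnK; rewrite posrE.
rewrite E2 Epi Et Er => ->; rewrite /kernel_norm /young_alpha inver (negbTE (lt0r_neq0 r0)).
have -> : r^-1 / 2 = (2 * r)^-1 by rewrite invfM mulrC.
case: eqP => [->|_]; last by [].
by rewrite invr1 subrr powRr0 powR1 mulr1 invr1.
Qed.

(** The r-th power of the kernel at time t is a multiple of the kernel at time t / r, which has mass
    1. *)
Lemma integral_heat_kernel_powR (r t : R) : 1 <= r -> 0 < t ->
  (\int[mu]_x (heat_kernel t x `^ r)%:E = (kernel_norm r%:E t `^ r)%:E)%E.
Proof.
move=> r1 t0; have r0 : 0 < r by exact: lt_le_trans r1.
have tr0 : 0 < t / r by rewrite divr_gt0.
pose k := (2 * Num.sqrt (pi * t))^-1 `^ r * (2 * Num.sqrt (pi * (t / r))).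
rewrite -kernel_norm_powR// -/k.
have k0 : 0 <= k by rewrite mulr_ge0 ?powR_ge0// mulr_ge0// sqrtr_ge0.
rewrite -[RHS]mule1 -(integral_heat_kernel tr0) -ge0_integralZl_EFin//; last 2 first.
- by move=> x _; rewrite lee_fin heat_kernel_ge0.
- by apply/measurable_EFinP; exact: measurable_heat_kernel.
apply: eq_integral => x _; rewrite -EFinM /heat_kernel; congr EFin.
rewrite powRM ?invr_ge0 ?mulr_ge0 ?sqrtr_ge0 ?expR_ge0// /k -expRM.
have s0 : 2 * Num.sqrt (pi * (t / r)) != 0 :> R.
  by rewrite gt_eqF// mulr_gt0// sqrtr_gt0 mulr_gt0// pi_gt0.
rewrite -[in RHS]mulrA [X in _ = _ * X]mulrA divff// mul1r; congr (_ * expR _).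
by field; rewrite !gt_eqF.
Qed.

Lemma kernel_norm_ge0 (q : \bar R) t : 0 <= kernel_norm q t.
Proof.
rewrite mulr_ge0 ?powR_ge0// /young_alpha.
have h : 0 <= 2 * Num.sqrt pi :> R by rewrite mulr_ge0 ?sqrtr_ge0.
case: q => [q| |]; [|by rewrite invr_ge0|by rewrite invr_ge0].
by case: eqP => // _; rewrite invr_ge0 mulr_ge0 ?powR_ge0.
Qed.

(** The roles in Jensen's inequality are exchanged: |H| is the weight and the kernel is raised to
    the power r. *)
Lemma young_one (H : R -> R) (r t : R) : 1 <= r -> 0 < t -> measurable_fun setT H ->
  ('N[mu]_r%:E[EFin \o heat_conv_fun H t] <= (kernel_norm r%:E t)%:E * 'N[mu]_1[EFin \o H])%E.
Proof.
move=> r1 t0 mH; have r0 : 0 < r by exact: lt_le_trans r1.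
have mK := measurable_heat_kernel (R := R) t.
have mN : measurable_fun setT (fun y => `|H y|) by exact: measurableT_comp.
have mKr : measurable_fun setT (fun y => heat_kernel t y `^ r).
  exact: (measurableT_comp (measurable_powR r)).
rewrite Lnorm_EFin (Lnorm_EFin 1) invr1 poweRe1; last first.
  by apply: integral_ge0 => y _; rewrite lee_fin powR_ge0.
under [in leRHS]eq_integral do rewrite powRr1//.
set I := (\int[mu]_x (`|H x|)%:E)%E.
have I0 : (0 <= I)%E by apply: integral_ge0 => y _; rewrite lee_fin.
have main : (\int[mu]_x (`|heat_conv_fun H t x| `^ r)%:E <=
    I `^ (r - 1) * (I * (kernel_norm r%:E t `^ r)%:E))%E.
  rewrite -(integral_heat_kernel_powR r1 t0) /I.
  rewrite -(integral_conv mN mKr (fun y => normr_ge0 _) (fun y => powR_ge0 _ _)) -/I.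
  have mc : measurable_fun setT (fun x : R => \int[mu]_y (`|H y| * heat_kernel t (x - y) `^ r)%:E)%E.
    apply: (measurable_fun_fubini_tonelli_F (m2 := mu)
      (fun q : R * R => (`|H q.2| * heat_kernel t (q.1 - q.2) `^ r)%:E)) => //.
      apply/measurable_EFinP; exact: (measurable_conv_kernel mN mKr).
    by move=> q; rewrite lee_fin mulr_ge0 ?powR_ge0.
  have c0 (x : R) : (0 <= \int[mu]_y (`|H y| * heat_kernel t (x - y) `^ r)%:E)%E.
    by apply: integral_ge0 => y _; rewrite lee_fin mulr_ge0 ?powR_ge0.
  rewrite -ge0_integralZl//; last by rewrite poweR_ge0.
  apply: ge0_le_integral.
  - exact: measurableT.
  - by move=> x _; rewrite lee_fin powR_ge0.
  - apply/measurable_EFinP; apply: (measurableT_comp (measurable_powR r)).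
    by apply: measurableT_comp => //; exact: measurable_heat_conv.
  - exact: measurable_funeM.
  - move=> x _; rewrite -poweR_EFin.
    have mKx : measurable_fun setT (fun y : R => heat_kernel t (x - y)).
      by apply: (measurableT_comp mK); exact: measurable_funB.
    apply: (le_trans _ (jensen_powR r1 mN mKx (fun y => normr_ge0 _) (fun y => heat_kernel_ge0 _ _))).
    apply: le_poweR; rewrite ?(ltW r0) ?lee_fin//.
    exact: heat_conv_le.
apply: (le_trans (le_poweR _ _ main)).
- by rewrite invr_ge0 ltW.
- by apply: integral_ge0 => y _; rewrite lee_fin powR_ge0.
have kn0 := kernel_norm_ge0 r%:E t.
rewrite muleA.
have -> : (I `^ (r - 1) * I = I `^ r)%E.
  rewrite -{2}(poweRe1 I0) -poweRD ?subrK//.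
  by apply: add_neq0_poweRD_def; rewrite subrK gt_eqF.
rewrite poweRM ?poweR_ge0// ?lee_fin ?powR_ge0// -poweRrM divff ?gt_eqF// poweRe1//.
by rewrite poweR_EFin -powRrM divff ?gt_eqF// powRr1// muleC.
Qed.

Lemma Lnorm_heat_kernel_reflect (q t x : R) : 1 <= q -> 0 < t ->
  'N[mu]_q%:E[EFin \o (fun y => heat_kernel t (x - y))]%E = (kernel_norm q%:E t)%:E.
Proof.
move=> q1 t0; have q0 : 0 < q by exact: lt_le_trans q1.
rewrite Lnorm_EFin; under eq_integral do rewrite (ger0_norm (heat_kernel_ge0 _ _)).
have mKq : measurable_fun setT (fun y => heat_kernel t y `^ q).
  exact: (measurableT_comp (measurable_powR q) (measurable_heat_kernel t)).
rewrite (ge0_integral_reflect x mKq (fun=> powR_ge0 _ _)).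
rewrite integral_heat_kernel_powR// poweR_EFin -powRrM divff ?gt_eqF// powRr1//.
exact: kernel_norm_ge0.
Qed.

Lemma heat_kernel_le_sup (t x : R) : 0 < t -> heat_kernel t x <= kernel_norm +oo%E t.
Proof.
move=> t0; rewrite /kernel_norm /young_alpha invey/=.
have -> : (2 * Num.sqrt pi)^-1 * t `^ (- ((1 - 0) / 2)) = (2 * Num.sqrt (pi * t))^-1 :> R.
  rewrite subr0 powRN mul1r powR12_sqrt ?(ltW t0)// sqrtrM ?(ltW (pi_gt0 _))//.
  by rewrite -invfM mulrA.
rewrite /heat_kernel ler_piMr ?invr_ge0 ?mulr_ge0 ?sqrtr_ge0//.
by rewrite -expR0 ler_expR oppr_le0 divr_ge0 ?sqr_ge0// mulr_ge0// ltW.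
Qed.

(** Hoelder's inequality with the exact norm of the kernel; q = +oo forces p = 1 and uses the sup of
    the kernel. *)
Lemma heat_conv_sup_le (H : R -> R) (p t x : R) (q : \bar R) : 1 <= p -> (1 <= q)%E -> 0 < t ->
  ((p%:E)^-1 + q^-1 = 1)%E -> measurable_fun setT H ->
  (`|heat_conv_fun H t x|%:E <= (kernel_norm q t)%:E * 'N[mu]_p%:E[EFin \o H])%E.
Proof.
move=> p1 q1 t0 pq mH; apply: (le_trans (heat_conv_le t x mH)).
have p0 : 0 < p by exact: lt_le_trans p1.
have mKx : measurable_fun setT (fun y : R => heat_kernel t (x - y)).
  by apply: (measurableT_comp (measurable_heat_kernel t)); exact: measurable_funB.
case: q q1 pq => [q q1 pq|_ pq|//].
  rewrite lee_fin in q1; have q0 : 0 < q by exact: lt_le_trans q1.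
  have {}pq : p^-1 + q^-1 = 1.
    by move: pq; rewrite !inver !gt_eqF// -EFinD => -[].
  have := hoelder mu mH mKx p0 q0 pq.
  rewrite (Lnorm_heat_kernel_reflect x q1 t0) [leRHS]muleC; apply: le_trans.
  rewrite Lnorm1 le_eqVlt; apply/orP; left; apply/eqP; apply: eq_integral => y _ /=.
  by rewrite normrM (ger0_norm (heat_kernel_ge0 _ _)).
have {}pq : p = 1.
  move: pq; rewrite inver invey gt_eqF//= adde0 => -[] h.
  by rewrite -[p]invrK h invr1.
rewrite pq Lnorm1 -ge0_integralZl_EFin//; last 2 first.
- by apply: measurableT_comp => //; exact/measurable_EFinP.
- exact: kernel_norm_ge0.
apply: ge0_le_integral.
- exact: measurableT.
- by move=> y _; rewrite lee_fin mulr_ge0 ?heat_kernel_ge0.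
- apply/measurable_EFinP; apply: measurable_funM => //; exact: measurableT_comp.
- apply: measurable_funeM; apply: measurableT_comp => //; exact/measurable_EFinP.
- by move=> y _; rewrite -EFinM lee_fin mulrC ler_wpM2r// heat_kernel_le_sup.
Qed.

End young_norms.

(** * Duality *)

Section sharp_young.
Context {R : realType}.
Local Notation mu := (@lebesgue_measure R).

(** In terms of u = 1/p the conjugate exponent corresponds to 1 - u, the symmetric form in which
    [sharp_constant] is stated. *)
Lemma young_cE (u : R) : u != 0 -> u != 1 ->
  young_c (u^-1)%:E = u^-1 `^ u / (1 - u)^-1 `^ (1 - u).
Proof.
move=> u0 u1; rewrite /young_c; case: eqP => [h|_].
  by move/eqP: u1; case; rewrite -[u]invrK h invr1.
have -> : fine (hoelder_conjugate (u^-1)%:E) = (1 - u)^-1.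
  rewrite /hoelder_conjugate/= eqe (negbTE (invr_neq0 u0)) -EFinD inver.
  rewrite subr_eq0 ifF; last first.
    by apply/negbTE; apply: contra u1 => /eqP h; rewrite -[u]invrK h invr1.
  rewrite -EFinM/=; field; rewrite u0 andbT/=.
  by rewrite subr_eq0 eq_sym u1.
by rewrite !invrK.
Qed.

(** [sharp_bilinear] with [s] conjugate to r; p < r gives d = 1/p - 1/r > 0. *)
Lemma young_bilinear (p q r t al be : R) (F G : R -> R) :
  1 < p -> p < r -> p^-1 + q^-1 = 1 + r^-1 -> 0 < t ->
  measurable_fun setT F -> measurable_fun setT G ->
  (forall x, 0 <= F x) -> (forall x, 0 <= G x) ->
  (\int[mu]_x (F x `^ p)%:E = al%:E)%E ->
  (\int[mu]_x (G x `^ (1 - r^-1)^-1)%:E = be%:E)%E ->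
  (\int[mu \x mu]_z (F z.1 * G z.2 * heat_kernel t (z.2 - z.1))%:E <=
   (young_K p%:E q%:E r%:E * t `^ (- ((1 - q^-1) / 2)) *
     (al `^ p^-1 * be `^ (1 - r^-1)))%:E)%E.
Proof.
move=> p1 pr pqr t0 mF mG F0 G0 alE beE.
have p0 : 0 < p by exact: lt_trans p1.
have r0 : 0 < r by exact: lt_trans pr.
have al0 : 0 <= al.
  by rewrite -lee_fin -alE; apply: integral_ge0 => x _; rewrite lee_fin powR_ge0.
have be0 : 0 <= be.
  by rewrite -lee_fin -beE; apply: integral_ge0 => x _; rewrite lee_fin powR_ge0.
pose a := p^-1; pose b := 1 - r^-1.
have a0 : 0 < a by rewrite invr_gt0.
have a1 : a < 1 by rewrite invf_lt1.
have ri0 : 0 < r^-1 by rewrite invr_gt0.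
have ra : r^-1 < a by rewrite ltf_pV2.
have ri1 : r^-1 < 1 by exact: lt_trans ra a1.
have b0 : 0 < b by rewrite subr_gt0.
have b1 : b < 1 by rewrite ltrBlDr ltrDl.
have d0 : 0 < a + b - 1 by rewrite /b; lra.
have qE : q^-1 = 2 - a - b by rewrite /a /b; lra.
have e0 : 0 < q^-1 by rewrite qE; lra.
have e1 : q^-1 < 1 by rewrite qE; lra.
have s1 : 1 < b^-1 by rewrite invf_gt1.
have d0' : 0 < p^-1 + b^-1^-1 - 1 by rewrite invrK.
have := sharp_bilinear p1 s1 d0' t0 mF mG F0 G0 alE beE.
move=> /(_ _ _ _ _ erefl erefl erefl erefl); rewrite invrK => h.
have a01 : 0 < a < 1 by rewrite a0.
have b01 : 0 < b < 1 by rewrite b0.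
have := sharp_constant a01 b01 d0 t0 al0 be0 erefl erefl erefl erefl.
rewrite -/a => k; apply: (le_trans h); rewrite lee_fin k.
rewrite le_eqVlt; apply/orP; left; apply/eqP.
have -> : 2 - a - b = q^-1 by [].
have -> : a + b - 1 = 1 - q^-1 by rewrite qE; ring.
have -> : 1 - b = r^-1 by rewrite /b; ring.
rewrite /young_K -[in young_c p%:E](invrK p) -[in young_c q%:E](invrK q) -[in young_c r%:E](invrK r).
rewrite !young_cE ?(lt0r_neq0 _) ?(lt_eqF _)//.
rewrite -/a -/b.
congr (_ * _ * _ * _).
rewrite /young_alpha; case: eqP => [h1|_]; first by move: e1; rewrite h1 invr1 ltxx.
by rewrite invrK [(2 * q)^-1]invfM [2^-1 * _]mulrC.
Qed.

Lemma young_K_ge0 (p q r : \bar R) : 0 <= young_K p q r.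
Proof.
rewrite mulr_ge0 ?sqrtr_ge0//.
by have := kernel_norm_ge0 q (1 : R); rewrite /kernel_norm powR1 mulr1.
Qed.

(** Cut off in height and in support, so that every positive power is integrable; the increasing
    limit is |u|. *)
Definition truncation (u : R -> R) (n : nat) (y : R) : R :=
  Num.min `|u y| n%:R * \1_(`[- n%:R, n%:R]%classic : set R) y.

Lemma truncation_ge0 u n y : 0 <= truncation u n y.
Proof. by rewrite mulr_ge0 ?indic_ge0// le_min normr_ge0 ler0n. Qed.

Lemma truncation_le u n y : truncation u n y <= `|u y|.
Proof.
rewrite /truncation indicE; case: (_ \in _); rewrite ?mulr0 ?mulr1 ?normr_ge0//.
by rewrite ge_min lexx.
Qed.

Lemma truncation_nondecreasing u y : nondecreasing_seq (truncation u ^~ y).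
Proof.
move=> m n mn; rewrite /truncation !indicE.
case: (boolP (y \in _)) => [|_]; last first.
  by rewrite mulr0; exact: truncation_ge0.
rewrite inE/= in_itv/= => /andP[y1 y2]; rewrite mem_set/=; last first.
  rewrite in_itv/= (le_trans _ y1) ?(le_trans y2) ?ler_nat//.
  by rewrite lerN2 ler_nat.
rewrite !mulr1 le_min ge_min lexx/= ge_min ler_nat mn orbT//.
Qed.

Lemma truncation_cvg u y : \forall n \near \oo, truncation u n y = `|u y|.
Proof.
have [N hN] : exists N : nat, `|u y| + `|y| <= N%:R.
  by exists (Num.trunc (`|u y| + `|y|)).+1; rewrite ltW// truncnS_gt.
exists N => // n /= Nn.
have {}hN : `|u y| + `|y| <= n%:R by rewrite (le_trans hN)// ler_nat.
have yn : `|y| <= n%:R by rewrite (le_trans _ hN)// lerDr.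
have un : `|u y| <= n%:R by rewrite (le_trans _ hN)// lerDl.
rewrite /truncation indicE mem_set/=; last by rewrite in_itv/= -ler_norml.
by rewrite mulr1; apply/min_idPl.
Qed.

Lemma measurable_truncation u n : measurable_fun setT u ->
  measurable_fun setT (truncation u n).
Proof.
move=> mu_; apply: measurable_funM; last exact: measurable_indic.
by apply: measurable_minr => //; exact: measurableT_comp.
Qed.

Lemma integral_truncation u n (r : R) : 0 < r -> measurable_fun setT u ->
  (\int[mu]_y (truncation u n y `^ r)%:E < +oo)%E.
Proof.
move=> r0 mu_; have mI : measurable (`[- n%:R, n%:R]%classic : set R) by exact: measurable_itv.
apply: (@le_lt_trans _ _ (\int[mu]_y (n%:R `^ r * \1_(`[- n%:R, n%:R]%classic : set R) y)%:E)%E).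
  apply: ge0_le_integral.
  - exact: measurableT.
  - by move=> y _; rewrite lee_fin powR_ge0.
  - apply/measurable_EFinP; apply: (measurableT_comp (measurable_powR r)).
    exact: measurable_truncation.
  - apply/measurable_EFinP; apply: measurable_funM; first exact: measurable_cst.
    exact: measurable_indic.
  - move=> y _; rewrite lee_fin /truncation indicE.
    case: (_ \in _); rewrite ?mulr0 ?mulr1 ?powR0 ?gt_eqF//.
    have m0 : 0 <= Num.min `|u y| n%:R by rewrite le_min normr_ge0 ler0n.
    by apply: ge0_ler_powR; rewrite ?nnegrE ?(ltW r0)// ge_min lexx orbT.
under eq_integral do rewrite EFinM.
rewrite ge0_integralZl_EFin ?powR_ge0//; last first.
  by apply/measurable_EFinP; exact: measurable_indic.
rewrite integral_indic// setIT.
have fin : (mu ([set` `[- n%:R, n%:R]%R] : set R) < +oo)%E.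
  apply: (@le_lt_trans _ _ (if - n%:R < n%:R :> R then n%:R - - n%:R else 0)%R%:E).
    rewrite (@lebesgue_measure_itv R `[- n%:R, n%:R]%R)/= lte_fin.
    by case: ifP.
  exact: ltry.
apply: lte_mul_pinfty; [by rewrite lee_fin powR_ge0|by []|exact: fin].
Qed.

(** With T a truncation of the convolution U and be the integral of T^r, the test function is T^(r -
    1), and T^r <= T^(r - 1) |U|. The bilinear bound then reads be <= C be^(1 - 1/r); as be is
    finite, a power of it can be divided out, and monotone convergence removes the truncation. *)
Lemma young_sharp (H : R -> R) (p q r t al : R) :
  1 < p -> p < r -> p^-1 + q^-1 = 1 + r^-1 -> 0 < t -> measurable_fun setT H ->
  (\int[mu]_x (`|H x| `^ p)%:E = al%:E)%E ->
  (\int[mu]_x (`|heat_conv_fun H t x| `^ r)%:E <=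
   ((young_K p%:E q%:E r%:E * t `^ (- ((1 - q^-1) / 2)) * al `^ p^-1) `^ r)%:E)%E.
Proof.
move=> p1 pr pqr t0 mH alE.
set C := young_K _ _ _ * _ * _; set U := heat_conv_fun H t.
have p0 : 0 < p by exact: lt_trans p1.
have r0 : 0 < r by exact: lt_trans pr.
have r1 : 1 < r by exact: lt_trans pr.
have C0 : 0 <= C.
  apply: mulr_ge0; last exact: powR_ge0.
  by apply: mulr_ge0; [exact: young_K_ge0|exact: powR_ge0].
have b0 : 0 < 1 - r^-1 by rewrite subr_gt0 invf_lt1.
have mU : measurable_fun setT U by exact: measurable_heat_conv.
have mN : measurable_fun setT (fun y => `|H y|) by exact: measurableT_comp.
have mT n : measurable_fun setT (truncation U n) by exact: measurable_truncation.
have mTp n s : measurable_fun setT (fun y => truncation U n y `^ s).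
  exact: (measurableT_comp (measurable_powR s)).
have step n : (\int[mu]_y (truncation U n y `^ r)%:E <= (C `^ r)%:E)%E.
  have I0 : (0 <= \int[mu]_y (truncation U n y `^ r)%:E)%E.
    by apply: integral_ge0 => y _; rewrite lee_fin powR_ge0.
  have [be beE] : exists be : R, (\int[mu]_y (truncation U n y `^ r)%:E = be%:E)%E.
    eexists; apply/esym/fineK; rewrite (ge0_fin_numE I0).
    exact: integral_truncation.
  rewrite beE lee_fin.
  have be0 : 0 <= be by rewrite -lee_fin -beE.
  (* The exponent conjugate to r takes T^(r - 1) back to T^r. *)
  have beE' : (\int[mu]_y ((truncation U n y `^ (r - 1)) `^ (1 - r^-1)^-1)%:E = be%:E)%E.
    rewrite -beE; apply: eq_integral => y _; rewrite -powRrM.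
    by rewrite (_ : (r - 1) / (1 - r^-1) = r)//; field; rewrite !gt_eqF// subr_gt0.
  have := young_bilinear p1 pr pqr t0 mN (mTp n (r - 1)) (fun=> normr_ge0 _)
    (fun=> powR_ge0 _ _) alE beE'.
  rewrite mulrA -/C => hb.
  have le1 : be <= C * be `^ (1 - r^-1).
    rewrite -lee_fin; apply: le_trans hb; rewrite -beE.
    have mk : measurable_fun setT (fun z : R * R =>
        `|H z.1| * truncation U n z.2 `^ (r - 1) * heat_kernel t (z.2 - z.1)).
      apply: measurable_funM; first apply: measurable_funM.
      - by apply: (measurableT_comp mN); exact: measurable_fst.
      - by apply: (measurableT_comp (mTp n (r - 1))); exact: measurable_snd.
      - by apply: (measurableT_comp (measurable_heat_kernel t)); exact: measurable_funB.
    have k0 (z : R * R) : (0 <= (`|H z.1| * truncation U n z.2 `^ (r - 1) *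
        heat_kernel t (z.2 - z.1))%:E)%E.
      by rewrite lee_fin !mulr_ge0 ?powR_ge0 ?heat_kernel_ge0.
    have mkE := (measurable_EFinP _ _).2 mk.
    have E := fubini_tonelli2 (m1 := mu) (m2 := mu) (fun z : R * R =>
      (`|H z.1| * truncation U n z.2 `^ (r - 1) * heat_kernel t (z.2 - z.1))%:E) mkE k0.
    rewrite {}E.
    apply: ge0_le_integral.
    - exact: measurableT.
    - by move=> y _; rewrite lee_fin powR_ge0.
    - by apply/measurable_EFinP; exact: mTp.
    - exact: (measurable_fun_fubini_tonelli_G (m1 := mu) (fun z : R * R =>
        (`|H z.1| * truncation U n z.2 `^ (r - 1) * heat_kernel t (z.2 - z.1))%:E) mkE k0).
    - move=> y _; rewrite /fubini_G/=.
      under eq_integral => x _ do rewrite mulrAC mulrC EFinM.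
      have mx : measurable_fun setT (fun x : R => (`|H x| * heat_kernel t (y - x))%:E).
        apply/measurable_EFinP; apply: measurable_funM => //.
        by apply: (measurableT_comp (measurable_heat_kernel t)); exact: measurable_funB.
      rewrite ge0_integralZl_EFin//; last 2 first.
      - by move=> x _; rewrite lee_fin mulr_ge0 ?heat_kernel_ge0.
      - exact: powR_ge0.
      apply: (@le_trans _ _ ((truncation U n y `^ (r - 1))%:E * `|U y|%:E)%E); last first.
        by apply: lee_wpmul2l; rewrite ?lee_fin ?powR_ge0//; exact: heat_conv_le.
      rewrite -EFinM lee_fin.
      have [->|T0] := eqVneq (truncation U n y) 0.
        by rewrite powR0 ?gt_eqF// mulr_ge0 ?powR_ge0.
      have -> : truncation U n y `^ r = truncation U n y `^ (r - 1) * truncation U n y.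
        have := @powRD _ (truncation U n y) (r - 1) 1.
        by rewrite subrK T0 implybT powRr1 ?truncation_ge0// => ->.
      by apply: ler_wpM2l; rewrite ?powR_ge0 ?truncation_le.
  have [->|ben0] := eqVneq be 0; first exact: powR_ge0.
  have beP : 0 < be by rewrite lt_neqAle eq_sym ben0.
  have : be `^ r^-1 <= C.
    have := le1; rewrite -{1}(powRr1 be0) -{1}(subrK r^-1 1) powRD ?ben0 ?implybT//.
    by rewrite [_ * be `^ r^-1]mulrC ler_pM2r// powR_gt0.
  move=> h; rewrite -(powRr1 be0) -(mulVf (lt0r_neq0 r0)) powRrM.
  by apply: ge0_ler_powR; rewrite ?nnegrE ?(ltW r0) ?powR_ge0.
have cvgT := @cvg_monotone_convergence _ _ _ mu _ measurableT
  (fun n y => (truncation U n y `^ r)%:E)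
  (fun n => (measurable_EFinP _ _).2 (mTp n r))
  (fun n y _ => powR_ge0 _ _ : (0 <= (truncation U n y `^ r)%:E)%E).
have -> : (\int[mu]_x (`|U x| `^ r)%:E =
    \int[mu]_x limn (fun n => (truncation U n x `^ r)%:E))%E.
  apply: eq_integral => x _; apply/esym/cvg_lim => //.
  apply: cvg_near_cst; have [N _ hN] := truncation_cvg U x.
  by exists N => // n /= Nn; rewrite hN.
have nd x : setT x -> nondecreasing_seq (fun n => (truncation U n x `^ r)%:E).
  move=> _ m n mn; rewrite lee_fin; apply: ge0_ler_powR;
    rewrite ?nnegrE ?truncation_ge0 ?(ltW r0)//.
  exact: truncation_nondecreasing.
have {cvgT nd} c := cvgT nd.
rewrite -(cvg_lim _ c)//; apply: lime_le; first by apply/cvg_ex; eexists; exact: c.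
by near=> n; exact: step.
Unshelve. all: by end_near. Qed.

End sharp_young.

(** * Young's inequality for the heat kernel, all exponents *)

Section young_heat.
Context {R : realType}.
Local Notation mu := (@lebesgue_measure R).

Lemma young_c_gt0 (p : R) : 1 <= p -> 0 < young_c p%:E.
Proof.
rewrite le_eqVlt => /predU1P[<-|p1]; first by rewrite /young_c eqxx.
have p0 : 0 < p by exact: lt_trans p1.
rewrite -[p]invrK young_cE ?invr_neq0 ?(lt0r_neq0 p0)//; last first.
  by rewrite lt_eqF// invf_lt1.
by rewrite divr_gt0// powR_gt0 ?invr_gt0// subr_gt0 invf_lt1.
Qed.

Lemma young_K_one (r : R) : 1 <= r -> young_K 1%:E r%:E r%:E = young_alpha r%:E.
Proof.
move=> r1; rewrite /young_K {1}/young_c eqxx mul1r divff ?sqrtr1 ?mul1r//.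
by rewrite gt_eqF// young_c_gt0.
Qed.

Lemma young_K_diag (p : R) : 1 <= p -> young_K p%:E 1 p%:E = 1.
Proof.
move=> p1; rewrite /young_K /young_alpha eqxx mulr1 {2}/young_c eqxx mulr1.
by rewrite divff ?sqrtr1// gt_eqF// young_c_gt0.
Qed.

(** For conjugate exponents [young_c p] and [young_c q] are reciprocal to each other. *)
Lemma young_K_sup (p : R) (q : \bar R) : 1 <= p -> (1 <= q)%E ->
  ((p%:E)^-1 + q^-1 = 1)%E -> young_K p%:E q +oo = young_alpha q.
Proof.
move=> p1 q1 pq; have p0 : 0 < p by exact: lt_le_trans p1.
suff -> : young_K p%:E q +oo = Num.sqrt 1 * young_alpha q by rewrite sqrtr1 mul1r.
rewrite /young_K; congr (Num.sqrt _ * _).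
case: q q1 pq => [q q1 pq|_ pq|//]; last first.
  move: pq; rewrite inver invey gt_eqF//= adde0 => -[] h.
  have -> : p = 1 by rewrite -[p]invrK h invr1.
  by rewrite /young_c eqxx invr1 !mulr1.
rewrite lee_fin in q1; have q0 : 0 < q by exact: lt_le_trans q1.
have {}pq : q^-1 = 1 - p^-1.
  by move: pq; rewrite !inver !gt_eqF// -EFinD => -[] <-; ring.
have pi0 : 0 < p^-1 by rewrite invr_gt0.
have pi1 : p^-1 < 1 by rewrite -subr_gt0 -pq invr_gt0.
set u := p^-1 in pq pi0 pi1.
have u'0 : 0 < 1 - u by rewrite subr_gt0.
rewrite -[p]invrK -[q]invrK pq -/u young_cE ?(lt0r_neq0 pi0) ?(negbT (lt_eqF pi1))//.
rewrite young_cE ?(lt0r_neq0 u'0)//; last by rewrite lt_eqF// ltrBlDr ltrDl.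
have -> : 1 - (1 - u) = u by ring.
rewrite [young_c +oo]/young_c divr1 mulrA divfK ?divff//.
  by rewrite gt_eqF// powR_gt0// invr_gt0.
by rewrite gt_eqF// powR_gt0// invr_gt0.
Qed.

Lemma Lnorm_fin_integral (p : R) (H : R -> R) : 0 < p ->
  ('N[mu]_p%:E[EFin \o H] < +oo)%E ->
  exists2 al : R, 0 <= al & (\int[mu]_x (`|H x| `^ p)%:E = al%:E)%E.
Proof.
move=> p0; rewrite Lnorm_EFin => fin.
have I0 : (0 <= \int[mu]_x (`|H x| `^ p)%:E)%E.
  by apply: integral_ge0 => y _; rewrite lee_fin powR_ge0.
move: fin I0; case: (integral _ _ _) => [al|//|//] fin I0; first by exists al; rewrite -?lee_fin.
by move: fin; rewrite poweRyr// gt_eqF// invr_gt0.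
Qed.

Lemma young_heat (H : R -> R) (p t : R) (q r : \bar R) :
  1 <= p -> (1 <= q)%E -> (1 <= r)%E -> ((p%:E)^-1 + q^-1 = 1 + r^-1)%E -> 0 < t ->
  measurable_fun setT H -> ('N[mu]_p%:E[EFin \o H] < +oo)%E ->
  ('N[mu]_r[EFin \o heat_conv_fun H t] <=
   (young_K p%:E q r)%:E * 'N[mu]_p%:E[EFin \o H] * (t `^ (- ((1 - fine (q^-1)%E) / 2)))%:E)%E.
Proof.
move=> p1 q1 r1 pqr t0 mH finH; have p0 : 0 < p by exact: lt_le_trans p1.
rewrite muleAC -EFinM.
case: r r1 pqr => [r r1 pqr|_|//]; last first.
  rewrite invey adde0 => pq; rewrite young_K_sup// -/(kernel_norm q t).
  rewrite [in leLHS]unlock; case: ifP => _.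
    by apply/ess_supP; apply: nearW => x; exact: heat_conv_sup_le.
  by rewrite mule_ge0 ?Lnorm_ge0// lee_fin kernel_norm_ge0.
rewrite lee_fin in r1; have r0 : 0 < r by exact: lt_le_trans r1.
have pi1 : p^-1 <= 1 by rewrite invf_le1.
have ri0 : 0 < r^-1 by rewrite invr_gt0.
(* For finite r, q = +oo is impossible: it would mean 1/p = 1 + 1/r > 1. *)
case: q q1 pqr => [q q1 pqr|_|//]; last first.
  rewrite !inver invey !gt_eqF// adde0 -EFinD => -[] h.
  by exfalso; move: pi1; rewrite h leNgt ltrDl ri0.
rewrite lee_fin in q1; have q0 : 0 < q by exact: lt_le_trans q1.
have {}pqr : p^-1 + q^-1 = 1 + r^-1.
  by move: pqr; rewrite !inver !gt_eqF// -!EFinD => -[].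
have qE : fine ((q%:E)^-1)%E = q^-1 by rewrite inver gt_eqF.
have qi1 : q^-1 <= 1 by rewrite invf_le1.
have [p1'|pn1] := eqVneq p 1.
  rewrite p1' in pqr *; have <- : q = r.
    by move: pqr; rewrite invr1 => /addrI/(congr1 GRing.inv); rewrite !invrK.
  by rewrite young_K_one//; apply: young_one.
have {p1}p1 : 1 < p by rewrite lt_neqAle eq_sym pn1.
have [rp|rnp] := eqVneq r p.
  have q1' : q = 1.
    move: pqr; rewrite rp addrC => /addIr/(congr1 GRing.inv).
    by rewrite invrK invr1.
  rewrite qE q1' rp (young_K_diag (ltW p1)) invr1 subrr mul0r oppr0 powRr0 mulr1 mul1e.
  rewrite !Lnorm_EFin; apply: le_poweR; first by rewrite invr_ge0 ltW.
    by apply: integral_ge0 => x _; rewrite lee_fin powR_ge0.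
  by apply: young_diag; rewrite ?ltW.
have pr : p < r.
  rewrite lt_neqAle eq_sym rnp/= -lef_pV2 ?posrE//.
  by rewrite -(lerD2l 1) -pqr addrC lerD2r.
have [al al0 alE] := Lnorm_fin_integral p0 finH.
have := young_sharp p1 pr pqr t0 mH alE.
rewrite !Lnorm_EFin alE qE poweR_EFin -EFinM => h.
have ri : 0 <= r^-1 by exact: ltW.
have I0 : (0 <= \int[mu]_x (`|heat_conv_fun H t x| `^ r)%:E)%E.
  by apply: integral_ge0 => x _; rewrite lee_fin powR_ge0.
apply: (le_trans (le_poweR ri I0 h)).
rewrite poweR_EFin -powRrM divff ?gt_eqF// powRr1//.
apply: mulr_ge0; last exact: powR_ge0.
by apply: mulr_ge0; [exact: young_K_ge0|exact: powR_ge0].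
Qed.

Lemma measurable_Lfun (p : \bar R) (H : R -> R) : H \in Lfun mu p -> measurable_fun setT H.
Proof. by rewrite inE => /andP[]; rewrite inE. Qed.

Lemma Lnorm_Lfun (p : \bar R) (H : R -> R) : H \in Lfun mu p ->
  ('N[mu]_p[EFin \o H] < +oo)%E.
Proof. by rewrite inE => /andP[_]; rewrite inE. Qed.

Lemma mem_Lfun (p : \bar R) (H : R -> R) : measurable_fun setT H ->
  ('N[mu]_p[EFin \o H] < +oo)%E -> H \in Lfun mu p.
Proof. by move=> mH fH; rewrite inE; apply/andP; split; rewrite inE. Qed.

Lemma Lfun_heat_conv (H : R -> R) (p t : R) (q r : \bar R) :
  1 <= p -> (1 <= q)%E -> (1 <= r)%E -> ((p%:E)^-1 + q^-1 = 1 + r^-1)%E -> 0 < t ->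
  H \in Lfun mu p%:E -> heat_conv_fun H t \in Lfun mu r.
Proof.
move=> p1 q1 r1 pqr t0 LH; have mH := measurable_Lfun LH.
have fH := Lnorm_Lfun LH; apply: mem_Lfun; first exact: measurable_heat_conv.
apply: (le_lt_trans (young_heat p1 q1 r1 pqr t0 mH fH)).
have := Lnorm_ge0 mu p%:E (EFin \o H); move: fH.
by case: (Lnorm _ _ _) => // n _ _; rewrite -!EFinM ltry.
Qed.

End young_heat.

(** * Primitives of distributions *)

Section convolution_integrability.
Context {R : realType}.
Local Notation mu := (@lebesgue_measure R).

Lemma integrable_oneDsqrV : mu.-integrable setT (EFin \o (fun x : R => (oneDsqr x)^-1)).
Proof.
have o0 (x : R) : 0 <= (oneDsqr x)^-1 by rewrite invr_ge0 addr_ge0 ?sqr_ge0.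
have co : continuous (fun x : R => (oneDsqr x)^-1).
  move=> x; apply: cvgV; last exact: continuous_oneDsqr.
  by rewrite gt_eqF// (lt_le_trans ltr01)// oneDsqr_ge1.
apply/integrableP; split.
  by apply/measurable_EFinP; exact: continuous_measurable_fun.
under eq_integral do rewrite /= ger0_norm//.
rewrite ge0_symfun_integralT//; last by move=> x /=; rewrite /oneDsqr sqrrN.
rewrite (_ : [set x : R | 0 <= x] = `[0, +oo[%classic); last first.
  by apply/seteqP; split=> x /=; rewrite in_itv/= andbT.
by rewrite integral0y_oneDsqr -EFinM ltry.
Qed.

(* Since |y| <= 1 + |y|^p, a bounded integrable function can be tested against
   any function in L^p without invoking Hoelder's inequality. *)
Lemma norm_le_powR (p y : R) : 1 <= p -> `|y| <= 1 + `|y| `^ p.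
Proof.
move=> p1; have [y1|y1] := leP `|y| 1; first by rewrite (le_trans y1)// lerDl powR_ge0.
rewrite (@le_trans _ _ (`|y| `^ p))//; last by rewrite lerDr.
rewrite -{1}[`|y|]powRr1//; apply: ler_powR => //; exact: ltW.
Qed.

Lemma Lfun_mul_le (p C h k : R) : 1 <= p -> `|k| <= C ->
  `|h * k| <= `|k| + `|h| `^ p * C.
Proof.
move=> p1 kC; rewrite normrM; apply: (@le_trans _ _ ((1 + `|h| `^ p) * `|k|)).
  by apply: ler_wpM2r; rewrite ?norm_le_powR.
by rewrite mulrDl mul1r lerD2l; apply: ler_wpM2l; rewrite ?powR_ge0.
Qed.

Lemma integrable_Lfun_mul (p C : R) (H k : R -> R) : 1 <= p -> H \in Lfun mu p%:E ->
  mu.-integrable setT (EFin \o k) -> (forall x, `|k x| <= C) ->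
  mu.-integrable setT (EFin \o (H \* k)).
Proof.
move=> p1 LH ik kC; have mH := measurable_Lfun LH.
have mk := (measurable_EFinP _ _).1 (measurable_int mu ik).
have iH := Lfun_integrable p1 LH.
have ib : mu.-integrable setT (fun x => (`|k x|)%:E + (`|H x| `^ p)%:E * C%:E)%E.
  apply: integrableD => //; first exact: integrable_abse ik.
  exact: integrableZr.
apply: le_integrable ib => //; first by apply/measurable_EFinP; exact: measurable_funM.
move=> x _ /=; rewrite lee_fin [leRHS]ger0_norm; first exact: Lfun_mul_le.
by rewrite addr_ge0// mulr_ge0 ?powR_ge0// (le_trans _ (kC x)).
Qed.

Lemma integrable_conv (A k : R -> R) :
  mu.-integrable setT (EFin \o A) -> mu.-integrable setT (EFin \o k) ->
  (mu \x mu)%E.-integrable setT (EFin \o (fun z => A z.2 * k (z.1 - z.2))).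
Proof.
move=> iA ik.
have mA := (measurable_EFinP _ _).1 (measurable_int mu iA).
have mk := (measurable_EFinP _ _).1 (measurable_int mu ik).
apply/integrable12ltyP; first by apply/measurable_EFinP; exact: measurable_conv_kernel.
pose Ik := (\int[mu]_y `|k y|%:E)%E; pose IA := (\int[mu]_y `|A y|%:E)%E.
have Ikf : (Ik < +oo)%E by have /integrableP[] := ik.
have IAf : (IA < +oo)%E by have /integrableP[] := iA.
rewrite [ltLHS](_ : _ = IA * Ik)%E; last first.
  have mAa : measurable_fun setT (fun y => `|A y|) by exact: measurableT_comp.
  have mka : measurable_fun setT (fun y => `|k y|) by exact: measurableT_comp.
  apply: etrans (integral_conv mAa mka (fun=> normr_ge0 _) (fun=> normr_ge0 _)).
  by apply: eq_integral => x _; apply: eq_integral => y _ /=; rewrite normrM.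
have IA0 : (0 <= IA)%E by exact: integral_ge0.
have Ik0 : (0 <= Ik)%E by exact: integral_ge0.
by rewrite lte_mul_pinfty// ge0_fin_numE.
Qed.

Lemma integrable_conv_fst (A k : R -> R) :
  mu.-integrable setT (EFin \o A) -> mu.-integrable setT (EFin \o k) ->
  (mu \x mu)%E.-integrable setT (EFin \o (fun z => A z.1 * k (z.1 - z.2))).
Proof.
move=> iA ik.
have mA := (measurable_EFinP _ _).1 (measurable_int mu iA).
have mk := (measurable_EFinP _ _).1 (measurable_int mu ik).
have mE : measurable_fun setT (fun z : R * R => A z.1 * k (z.1 - z.2)).
  apply: measurable_funM; first exact: measurableT_comp.
  by apply: (measurableT_comp mk); exact: measurable_funB.
apply/integrable21ltyP; first exact/measurable_EFinP.
pose Ik := (\int[mu]_y `|k y|%:E)%E; pose IA := (\int[mu]_y `|A y|%:E)%E.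
have Ikf : (Ik < +oo)%E by have /integrableP[] := ik.
have IAf : (IA < +oo)%E by have /integrableP[] := iA.
have mkn : measurable_fun setT (fun y : R => `|k (- y)|).
  by apply: measurableT_comp => //; apply: (measurableT_comp mk); exact: measurable_funN.
have Ikn : (\int[mu]_y `|k (- y)|%:E = Ik)%E.
  have mka : measurable_fun setT (fun y => `|k y|%:E).
    by apply/measurable_EFinP; exact: measurableT_comp.
  exact: (ge0_integral_opp mka (fun=> normr_ge0 _)).
rewrite [ltLHS](_ : _ = IA * Ik)%E; last first.
  have mAa : measurable_fun setT (fun y => `|A y|) by exact: measurableT_comp.
  rewrite -[Ik]Ikn.
  apply: etrans (integral_conv mAa mkn (fun=> normr_ge0 _) (fun=> normr_ge0 _)).
  by apply: eq_integral => x _; apply: eq_integral => y _ /=; rewrite normrM opprB.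
have IA0 : (0 <= IA)%E by exact: integral_ge0.
have Ik0 : (0 <= Ik)%E by exact: integral_ge0.
by rewrite lte_mul_pinfty// ge0_fin_numE.
Qed.

(** [Lfun_mul_le] bounds the integrand by |phi x| |k (x - y)| plus C |H y|^p |k (x - y)|, and each
    of these is a product of integrable functions of two independent variables. *)
Lemma integrable_Lfun_conv (p C : R) (H k phi : R -> R) : 1 <= p -> H \in Lfun mu p%:E ->
  mu.-integrable setT (EFin \o k) -> mu.-integrable setT (EFin \o phi) ->
  (forall x, `|phi x| <= C) ->
  (mu \x mu)%E.-integrable setT (EFin \o (fun z => H z.2 * k (z.1 - z.2) * phi z.1)).
Proof.
move=> p1 LH ik iphi phiC; have mH := measurable_Lfun LH.
have mk := (measurable_EFinP _ _).1 (measurable_int mu ik).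
have mphi := (measurable_EFinP _ _).1 (measurable_int mu iphi).
have iH : mu.-integrable setT (EFin \o (fun x => `|H x| `^ p)) := Lfun_integrable p1 LH.
have ika : mu.-integrable setT (EFin \o (fun x => `|k x|)) := integrable_abse ik.
have iphia : mu.-integrable setT (EFin \o (fun x => `|phi x|)) := integrable_abse iphi.
have i1 := integrable_conv_fst iphia ika.
have i2 := integrableZr measurableT C (integrable_conv iH ika).
apply: le_integrable (integrableD measurableT i1 i2) => //.
  apply/measurable_EFinP; apply: measurable_funM; first exact: measurable_conv_kernel.
  exact: measurableT_comp.
move=> [x y] _ /=; rewrite lee_fin.
rewrite [leRHS]ger0_norm; last first.
  by rewrite addr_ge0 ?mulr_ge0 ?powR_ge0// (le_trans _ (phiC x)).
rewrite mulrAC normrM [leRHS](_ : _ = (`|phi x| + `|H y| `^ p * C) * `|k (x - y)|); last by ring.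
by apply: ler_wpM2r; rewrite ?Lfun_mul_le.
Qed.

Lemma Rintegral_Fubini (F : R * R -> R) :
  (mu \x mu)%E.-integrable setT (EFin \o F) ->
  (forall x, mu.-integrable setT (EFin \o (fun y => F (x, y)))) ->
  (forall y, mu.-integrable setT (EFin \o (fun x => F (x, y)))) ->
  \int[mu]_x (\int[mu]_y F (x, y)) = \int[mu]_y (\int[mu]_x F (x, y)).
Proof.
move=> iF iy ix; rewrite /Rintegral; congr fine.
rewrite [LHS](_ : _ = \int[mu]_x \int[mu]_y (F (x, y))%:E)%E; last first.
  by apply: eq_integral => x _; apply: fineK; exact: (integrable_fin_num measurableT (iy x)).
rewrite [RHS](_ : _ = \int[mu]_y \int[mu]_x (F (x, y))%:E)%E; last first.
  by apply: eq_integral => y _; apply: fineK; exact: (integrable_fin_num measurableT (ix y)).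
exact: (Fubini iF).
Qed.

Lemma integrable_reflect (k : R -> R) x : mu.-integrable setT (EFin \o k) ->
  mu.-integrable setT (EFin \o (fun y => k (x - y))).
Proof.
move=> ik; have mk := (measurable_EFinP _ _).1 (measurable_int mu ik).
apply/integrableP; split.
  by apply/measurable_EFinP; apply: (measurableT_comp mk); exact: measurable_funB.
have /integrableP[_] := ik.
have mka : measurable_fun setT (fun y : R => `|k y|) by exact: measurableT_comp.
by have -> := ge0_integral_reflect x mka (fun=> normr_ge0 _).
Qed.

Lemma integrable_translate (k : R -> R) x : mu.-integrable setT (EFin \o k) ->
  mu.-integrable setT (EFin \o (fun y => k (y - x))).
Proof.
move=> /(integrable_reflect 0)/(integrable_reflect x).
by rewrite (_ : _ \o _ = EFin \o (fun y => k (y - x)))//; apply/funext => y /=; rewrite sub0r opprB.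
Qed.

Lemma integrable_bounded_mul (C : R) (f k : R -> R) : mu.-integrable setT (EFin \o f) ->
  measurable_fun setT k -> (forall x, `|k x| <= C) ->
  mu.-integrable setT (EFin \o (f \* k)).
Proof.
move=> iff mk kC; have mf := (measurable_EFinP _ _).1 (measurable_int mu iff).
apply: le_integrable (integrableZr measurableT C iff) => //.
  by apply/measurable_EFinP; exact: measurable_funM.
move=> x _ /=; rewrite lee_fin !normrM; apply: ler_wpM2l => //.
exact: le_trans (kC x) (ler_norm _).
Qed.

(** The means of moving a convolution onto the test function when [H] is only in L^p: both [k] and
    [phi] are integrable and bounded. *)
Lemma Lfun_conv_Fubini (p C C' : R) (H k phi : R -> R) : 1 <= p -> H \in Lfun mu p%:E ->
  mu.-integrable setT (EFin \o k) -> mu.-integrable setT (EFin \o phi) ->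
  (forall x, `|phi x| <= C) -> (forall x, `|k x| <= C') ->
  \int[mu]_x ((\int[mu]_y (H y * k (x - y))) * phi x) =
  \int[mu]_y (H y * \int[mu]_x (k (x - y) * phi x)).
Proof.
move=> p1 LH ik iphi phiC kC.
have mphi := (measurable_EFinP _ _).1 (measurable_int mu iphi).
have iHk x : mu.-integrable setT (EFin \o (fun y => H y * k (x - y))).
  by apply: (integrable_Lfun_mul p1 LH (integrable_reflect x ik)) => y; exact: kC.
have ikphi y : mu.-integrable setT (EFin \o (fun x => k (x - y) * phi x)).
  exact: (integrable_bounded_mul (integrable_translate y ik) mphi phiC).
have i1 x : mu.-integrable setT (EFin \o (fun y => H y * k (x - y) * phi x)).
  exact: (integrableZr measurableT (phi x) (iHk x)).
have i2 y : mu.-integrable setT (EFin \o (fun x => H y * k (x - y) * phi x)).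
  apply: eq_integrable (integrableZl measurableT (H y) (ikphi y)) => //.
  by move=> x _; congr EFin; exact: mulrA.
have := Rintegral_Fubini (integrable_Lfun_conv p1 LH ik iphi phiC) i1 i2.
move=> /= E.
transitivity (\int[mu]_x \int[mu]_y (H y * k (x - y) * phi x)).
  by apply: eq_Rintegral => x _; rewrite (RintegralZr (phi x) measurableT (iHk x)).
rewrite E; apply: eq_Rintegral => y _.
rewrite -(RintegralZl (H y) measurableT (ikphi y)).
by apply: eq_Rintegral => x _; rewrite mulrA.
Qed.

End convolution_integrability.

(** * Integrals of derivatives *)

Section derivative_integral.
Context {R : realType}.
Local Notation mu := (@lebesgue_measure R).

Lemma Rintegral_is_derive (f f' : R -> R) a b : a <= b ->
  (forall x, is_derive x (1 : R) f (f' x)) -> continuous f' ->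
  \int[mu]_(x in `[a, b]) f' x = f b - f a.
Proof.
rewrite le_eqVlt => /predU1P[->|ab] df cf.
  by rewrite subrr set_itv1 Rintegral_set1.
have cf0 : continuous f.
  by move=> x; apply: differentiable_continuous; apply/derivable1_diffP; case: (df x).
rewrite /Rintegral (@continuous_FTC2 _ f' f)//.
- by apply: continuous_in_subspaceT => x _; exact: cf.
- split=> [x _||].
  + by case: (df x).
  + by apply: cvg_at_right_filter; exact: cf0.
  + by apply: cvg_at_left_filter; exact: cf0.
- by move=> x _; rewrite derive1E; exact: derive_val.
Qed.

Lemma near_in_itvNn (x : R) : \forall n \near \oo, x \in `[- n%:R, n%:R]%R.
Proof.
exists (Num.trunc `|x|).+1 => // n /= hn.
rewrite in_itv/= -ler_norml (@le_trans _ _ (Num.trunc `|x|).+1%:R)//.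
  by rewrite ltW// truncnS_gt.
by rewrite ler_nat.
Qed.

(** On [-n, n] the integral is f n - f (-n), which the decay of [f] sends to 0; dominated
    convergence extends this to the line. *)
Lemma Rintegral_derive_eq0 (f f' : R -> R) (C : R) :
  (forall x, is_derive x (1 : R) f (f' x)) -> continuous f' ->
  mu.-integrable setT (EFin \o f') -> (forall x, `|f x| <= C / oneDsqr x) ->
  \int[mu]_x f' x = 0.
Proof.
move=> df cf if' fC.
pose D (n : nat) : set R := [set` `[- n%:R, n%:R]%R].
have mD n : measurable (D n) by exact: measurable_itv.
have mf' : measurable_fun setT f' by exact: continuous_measurable_fun.
pose g n := (EFin \o f') \_ (D n).
have mg n : measurable_fun setT (g n).
  by apply/(measurable_restrictT _ (mD n)); apply/measurable_EFinP; exact: measurable_funTS.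
have gf (x : R) : setT x -> g ^~ x @ \oo --> (EFin \o f') x.
  move=> _; apply: cvg_near_cst; have := near_in_itvNn x; apply: filterS => n xn.
  by rewrite /g patchE mem_set.
have fin (x : R) : setT x -> (abse \o (EFin \o f')) x \is a fin_num by [].
have gle n (x : R) : setT x -> (`|g n x| <= (abse \o (EFin \o f')) x)%E.
  by move=> _; rewrite /g patchE; case: ifP => _ //=; rewrite ?normr0 ?abse0 ?lee_fin.
have := @dominated_cvg _ _ _ mu setT measurableT g (EFin \o f') _ mg gf fin (integrable_abse if') gle.
have -> : (fun n => \int[mu]_x (g n) x)%E = (fun n : nat => (f n%:R - f (- n%:R))%:E).
  apply/funext => n; rewrite -integral_mkcond.
  have nn : - n%:R <= n%:R :> R by rewrite -subr_ge0 opprK addr_ge0.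
  rewrite -(Rintegral_is_derive nn df cf) /Rintegral fineK//.
  by apply: integrable_fin_num => //; exact: integrableS if'.
move=> c1.
have c2 : (f n%:R - f (- n%:R))%:E @[n --> \oo] --> 0%E.
  apply: cvg_EFin; first exact: nearW.
  apply/cvgr0Pnorm_le => e e0; near=> n.
  have h (z : R) : z ^+ 2 = n%:R ^+ 2 -> `|f z| <= e / 2.
    move=> z2; apply: (le_trans (fC z)).
    have o0 : 0 < oneDsqr z by rewrite (lt_le_trans ltr01)// oneDsqr_ge1.
    rewrite ler_pdivrMr// mulrC -ler_pdivrMr ?divr_gt0// /oneDsqr z2.
    have nC : C / (e / 2) <= n%:R by near: n; exact: nbhs_infty_ger.
    by rewrite (le_trans nC)//; have := sqr_ge0 (n%:R - 1 : R); nra.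
  rewrite (le_trans (ler_normB _ _))// [leRHS](splitr e); apply: lerD; apply: h => //.
  by rewrite sqrrN.
have := cvg_unique (@ereal_hausdorff R) c1 c2; rewrite /Rintegral => E.
by rewrite [X in fine X]E.
Unshelve. all: by end_near. Qed.

End derivative_integral.

(** * Decay and integrability of Schwartz functions *)

Section schwartz_functions.
Context {R : realType}.
Local Notation mu := (@lebesgue_measure R).
Implicit Types phi : schwartz R.

Lemma schwartz_is_derive phi x : is_derive x (1 : R) phi (schwartz_deriv phi x).
Proof.
have := schwartzP phi; rewrite inE => -[s _].
by rewrite /= derive1E; apply: derivableP; exact: (s 0%N).
Qed.

Lemma schwartz_continuous phi : continuous phi.
Proof.
move=> x; apply: differentiable_continuous; apply/derivable1_diffP.
by case: (schwartz_is_derive phi x).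
Qed.

Lemma schwartz_decay phi : exists2 C, 0 <= C & forall x, `|phi x| <= C / oneDsqr x.
Proof.
have := schwartzP phi; rewrite inE => -[_ d].
have [M0 h0] := d 0%N 0%N; have [M2 h2] := d 2%N 0%N.
have M00 : 0 <= M0 by exact: le_trans (h0 0).
have M20 : 0 <= M2 by exact: le_trans (h2 0).
exists (M0 + M2) => [|x]; first exact: addr_ge0.
have o0 : 0 < oneDsqr x by rewrite (lt_le_trans ltr01)// oneDsqr_ge1.
rewrite ler_pdivlMr// mulrC mulrDl mul1r; apply: lerD.
  by have := h0 x; rewrite expr0 mul1r.
by have := h2 x; rewrite normrM ger0_norm ?sqr_ge0.
Qed.

Lemma schwartz_bounded phi : exists C, forall x, `|phi x| <= C.
Proof.
have [C C0 h] := schwartz_decay phi; exists C => x; apply: (le_trans (h x)).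
by rewrite ler_piMr// invf_le1 ?oneDsqr_ge1// (lt_le_trans ltr01)// oneDsqr_ge1.
Qed.

Lemma le_integrable_cst (C : R) (f g : R -> R) : continuous f ->
  mu.-integrable setT (EFin \o g) -> (forall x, `|f x| <= C * g x) ->
  mu.-integrable setT (EFin \o f).
Proof.
move=> cf ig fg; apply: le_integrable (integrableZl measurableT C ig) => //.
  by apply/measurable_EFinP; exact: continuous_measurable_fun.
by move=> x _ /=; rewrite lee_fin; exact: le_trans (fg x) (ler_norm _).
Qed.

Lemma schwartz_integrable phi : mu.-integrable setT (EFin \o phi).
Proof.
have [C C0 h] := schwartz_decay phi.
exact: le_integrable_cst (schwartz_continuous (phi := phi)) integrable_oneDsqrV h.
Qed.

End schwartz_functions.

(** * Derivative of the heat kernel *)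

Section heat_kernel_derivative.
Context {R : realType}.
Local Notation mu := (@lebesgue_measure R).
Variables (t : R) (t0 : 0 < t).

Lemma is_derive_heat_kernel (x : R) :
  is_derive x (1 : R) (heat_kernel t) (- (x / (2 * t)) * heat_kernel t x).
Proof.
have d1 := is_derive_poly ((- (4 * t)^-1)%:P * 'X^2) x.
have d2 := @is_derive1_comp _ expR _ x _ _ (is_derive_expR _) d1.
have d3 := is_deriveZ (2 * Num.sqrt (pi * t))^-1 d2.
have hE (z : R) : ((- (4 * t)^-1)%:P * 'X^2).[z] = - (z ^+ 2 / (4 * t)).
  by rewrite hornerM hornerC hornerXn mulNr mulrC.
have -> : heat_kernel t =
    (2 * Num.sqrt (pi * t))^-1 \*: (expR \o horner ((- (4 * t)^-1)%:P * 'X^2)).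
  by apply/funext => z /=; rewrite hE.
apply: is_derive_eq; rewrite derivM derivC derivXn mul0r add0r /= hE.
rewrite hornerM hornerC hornerMn hornerXn /GRing.scale/=.
have -> : (2 * t)^-1 = 2 * (4 * t)^-1 by field; exact: lt0r_neq0.
by rewrite expr1; ring.
Qed.

Lemma derive1_heat_kernel (x : R) :
  derive1 (heat_kernel t) x = - (x / (2 * t)) * heat_kernel t x.
Proof. by rewrite derive1E; have := is_derive_heat_kernel x => h; exact: derive_val. Qed.

Lemma continuous_heat_kernel : continuous (heat_kernel t).
Proof.
move=> x; apply: differentiable_continuous; apply/derivable1_diffP.
by case: (is_derive_heat_kernel x).
Qed.

Lemma continuous_derive1_heat_kernel : continuous (derive1 (heat_kernel t)).
Proof.
rewrite (_ : derive1 _ = fun x => - (x / (2 * t)) * heat_kernel t x); last first.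
  by apply/funext => x; exact: derive1_heat_kernel.
move=> x; apply: cvgM; last exact: continuous_heat_kernel.
by apply: cvgN; apply: cvgM; [exact: cvg_id|exact: cvg_cst].
Qed.

Lemma integrable_heat_kernel : mu.-integrable setT (EFin \o heat_kernel t).
Proof.
apply/integrableP; split; first by apply/measurable_EFinP; exact: measurable_heat_kernel.
under eq_integral do rewrite /= ger0_norm ?heat_kernel_ge0//.
by rewrite integral_heat_kernel// ltry.
Qed.

End heat_kernel_derivative.

Section heat_kernel_bounds.
Context {R : realType}.
Local Notation mu := (@lebesgue_measure R).

(** The Gaussian factor splits into two equal halves: one absorbs the factor |x|, the other is that
    of the kernel at time 2 t, and sqrt 2 compares the normalizations. *)
Lemma heat_kernel_derive_le (t x : R) : 0 < t ->
  `|derive1 (heat_kernel t) x| <=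
    ((1 + 8 * t) / (2 * t) * Num.sqrt 2) * heat_kernel (2 * t) x.
Proof.
move=> t0; rewrite (derive1_heat_kernel t0) normrM normrN (ger0_norm (heat_kernel_ge0 _ _)).
have t80 : 0 < 8 * t by rewrite mulr_gt0.
have -> : heat_kernel t x = Num.sqrt 2 * heat_kernel (2 * t) x * expR (- (x ^+ 2 / (8 * t))).
  have hs : Num.sqrt (pi * (2 * t)) = Num.sqrt 2 * Num.sqrt (pi * t).
    by rewrite mulrCA sqrtrM.
  have hE : expR (- (x ^+ 2 / (4 * t))) =
      expR (- (x ^+ 2 / (4 * (2 * t)))) * expR (- (x ^+ 2 / (8 * t))).
    by rewrite -expRD; congr expR; field; exact: lt0r_neq0.
  rewrite /heat_kernel hs hE.
  have s20 : Num.sqrt 2 != 0 :> R by rewrite gt_eqF// sqrtr_gt0.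
  have st0 : Num.sqrt (pi * t) != 0 :> R by rewrite gt_eqF// sqrtr_gt0 mulr_gt0// pi_gt0.
  by field; rewrite s20 st0.
have -> : `|x / (2 * t)| = `|x| / (2 * t).
  by rewrite normrM (ger0_norm (x := (2 * t)^-1))// invr_ge0 mulr_ge0// ltW.
suff h : `|x| * expR (- (x ^+ 2 / (8 * t))) <= 1 + 8 * t.
  rewrite [leLHS](_ : _ = (`|x| * expR (- (x ^+ 2 / (8 * t)))) *
      ((2 * t)^-1 * (Num.sqrt 2 * heat_kernel (2 * t) x))); last by ring.
  rewrite [leRHS](_ : _ = (1 + 8 * t) *
      ((2 * t)^-1 * (Num.sqrt 2 * heat_kernel (2 * t) x))); last by ring.
  apply: ler_wpM2r => //; apply: mulr_ge0; first by rewrite invr_ge0 mulr_ge0// ltW.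
  by rewrite mulr_ge0 ?sqrtr_ge0 ?heat_kernel_ge0.
rewrite expRN ler_pdivrMr ?expR_gt0//.
apply: (@le_trans _ _ ((1 + 8 * t) * (1 + x ^+ 2 / (8 * t)))); last first.
  by apply: ler_wpM2l; [rewrite addr_ge0// ltW|exact: expR_ge1Dx].
have -> : (1 + 8 * t) * (1 + x ^+ 2 / (8 * t)) = 1 + x ^+ 2 + (8 * t + x ^+ 2 / (8 * t)).
  by field; exact: lt0r_neq0.
rewrite -[leLHS]addr0; apply: lerD.
  by rewrite -real_normK ?num_real//; have := sqr_ge0 (`|x| - 1); have := normr_ge0 x; nra.
by rewrite addr_ge0 ?(ltW t80)// divr_ge0 ?sqr_ge0// ltW.
Qed.

Lemma integrable_derive1_heat_kernel (t : R) : 0 < t ->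
  mu.-integrable setT (EFin \o derive1 (heat_kernel t)).
Proof.
move=> t0; have t20 : 0 < 2 * t by rewrite mulr_gt0.
apply: le_integrable_cst (continuous_derive1_heat_kernel t0) (integrable_heat_kernel t20) _.
by move=> x; exact: heat_kernel_derive_le.
Qed.

Lemma derive1_heat_kernel_bounded (t : R) : 0 < t ->
  exists C, forall x, `|derive1 (heat_kernel t) x| <= C.
Proof.
move=> t0; have t20 : 0 < 2 * t by rewrite mulr_gt0.
eexists => x; apply: (le_trans (heat_kernel_derive_le x t0)).
apply: ler_wpM2l (heat_kernel_le_sup x t20).
rewrite mulr_ge0 ?sqrtr_ge0// divr_ge0 ?mulr_ge0 ?(ltW t0)//.
by rewrite addr_ge0// mulr_ge0// ltW.
Qed.

(** The product of the translated kernel and [phi] has a derivative of integral 0; its decay comes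
    from [phi], the kernel being bounded. *)
Lemma heat_kernel_by_parts (t y : R) (phi : schwartz R) : 0 < t ->
  \int[mu]_x (derive1 (heat_kernel t) (x - y) * phi x) =
  - \int[mu]_x (heat_kernel t (x - y) * schwartz_deriv phi x).
Proof.
move=> t0; have [C C0 hC] := schwartz_decay phi.
have [B hB] := schwartz_bounded phi; have [B' hB'] := schwartz_bounded (schwartz_deriv phi).
have cphi := schwartz_continuous (phi := phi).
have cphi' := schwartz_continuous (phi := schwartz_deriv phi).
have mphi : measurable_fun setT phi by exact: continuous_measurable_fun.
have mphi' : measurable_fun setT (schwartz_deriv phi) by exact: continuous_measurable_fun.
have i1 := integrable_bounded_mul
  (integrable_translate y (integrable_derive1_heat_kernel t0)) mphi hB.
have i2 := integrable_bounded_mul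
  (integrable_translate y (integrable_heat_kernel t0)) mphi' hB'.
apply/eqP; rewrite -addr_eq0; apply/eqP; rewrite -(RintegralD measurableT i1 i2).
pose f' x := derive1 (heat_kernel t) (x - y) * phi x +
  heat_kernel t (x - y) * schwartz_deriv phi x.
have dT (z : R) : is_derive z (1 : R) (fun x : R => x - y) 1.
  by apply: is_derive_eq; rewrite subr0.
have df x : is_derive x (1 : R) (fun x => heat_kernel t (x - y) * phi x) (f' x).
  have dk : is_derive (x - y) (1 : R) (heat_kernel t) (derive1 (heat_kernel t) (x - y)).
    by apply: DeriveDef; [case: (is_derive_heat_kernel t0 (x - y))|rewrite derive1E].
  have d1 := @is_derive1_comp _ (heat_kernel t) (fun x : R => x - y) x _ _ dk (dT x).
  have d2 := is_deriveM d1 (schwartz_is_derive phi x).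
  apply: (is_derive_eq d2); rewrite /f' /GRing.scale/=; ring.
have cT : continuous (fun x : R => x - y).
  by move=> z; apply: cvgB; [exact: cvg_id|exact: cvg_cst].
have cf' : continuous f'.
  move=> x; apply: cvgD; apply: cvgM.
  - exact: continuous_comp (cT x) (@continuous_derive1_heat_kernel _ t t0 _).
  - exact: cphi.
  - exact: continuous_comp (cT x) (@continuous_heat_kernel _ t t0 _).
  - exact: cphi'.
have if' : mu.-integrable setT (EFin \o f') := integrableD measurableT i1 i2.
apply: (Rintegral_derive_eq0 (C := kernel_norm +oo%E t * C) df cf' if') => x.
rewrite normrM -mulrA; apply: ler_pM => //.
by rewrite (ger0_norm (heat_kernel_ge0 _ _)) heat_kernel_le_sup.
Qed.

End heat_kernel_bounds.

(** * Bounded functions as tempered distributions *)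

Section tempered_bounded.
Context {R : realType}.
Local Notation mu := (@lebesgue_measure R).
Implicit Types phi psi : schwartz R.

(** Continuity of one coordinate of [schwartz_jet]: this extracts a seminorm from the initial
    topology. *)
Lemma near_schwartz_jet (k m : nat) phi e : 0 < e ->
  \forall psi \near phi, forall x,
    `|x ^+ k * derive1n m phi x - x ^+ k * derive1n m (psi : schwartz R) x| < e.
Proof.
move=> e0.
pose pr (h : prod_topology (fun _ : nat * nat => {uniform R -> R})) := h (k, m).
have c : {for phi, continuous (fun psi : schwartz R => pr (schwartz_jet psi))}.
  apply: (@continuous_comp _ _ _ (@schwartz_jet R) pr).
    exact: (@initial_continuous (schwartz R) _ (@schwartz_jet R) phi).
  exact: proj_continuous.
pose A : set {uniform R -> R} := [set h | forall x, `|pr (schwartz_jet phi) x - h x| < e].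
have nA : nbhs (pr (schwartz_jet phi)) A.
  apply/uniform_nbhs; exists [set xy | `|xy.1 - xy.2| < e]; split.
    by exists e.
  by move=> h /= hh x; exact: hh.
by have := c _ nA.
Qed.

Lemma regular_dist_bounded_integrable (u : R -> R) (B : R) phi : measurable_fun setT u ->
  (forall x, `|u x| <= B) -> mu.-integrable setT (EFin \o (u \* phi)).
Proof.
move=> mu_ uB; have := integrable_bounded_mul (schwartz_integrable phi) mu_ uB.
by apply: eq_integrable => // x _ /=; rewrite mulrC.
Qed.

(** The seminorms with k = 0 and k = 2 together bound (1 + x^2) |phi x - psi x|, and 1 / (1 + x^2)
    is integrable. *)
Lemma tempered_bounded (u : R -> R) (B : R) : measurable_fun setT u ->
  (forall x, `|u x| <= B) -> tempered (regular_dist u).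
Proof.
move=> mu_ uB; have B0 : 0 <= B by exact: le_trans (uB 0).
have iu phi := regular_dist_bounded_integrable phi mu_ uB.
split.
  move=> a phi psi; rewrite /regular_dist.
  transitivity (\int[mu]_x (a * (u x * phi x) + u x * psi x)).
    by apply: eq_Rintegral => x _ /=; rewrite mulrDr mulrCA.
  have i1 : mu.-integrable setT (EFin \o (fun x => a * (u x * phi x))).
    exact: (integrableZl measurableT a (iu phi)).
  by rewrite (RintegralD measurableT i1 (iu psi)) (RintegralZl a measurableT (iu phi)).
move=> phi; apply/(@cvgrPdist_le _ _ _ (nbhs phi) (nbhs_filter phi)) => e e0.
pose J := \int[mu]_x (oneDsqr x)^-1.
have J0 : 0 <= J by apply: Rintegral_ge0 => x _; rewrite invr_ge0 addr_ge0 ?sqr_ge0.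
have BJ0 : 0 < B * J + 1 by rewrite ltr_wpDl// mulr_ge0.
(* Halved because two seminorms are added; the 1 keeps the denominator positive when B J = 0. *)
pose d := e / (B * J + 1) / 2.
have d0 : 0 < d by rewrite !divr_gt0.
have n0 := near_schwartz_jet 0 0 phi d0.
have n2 := near_schwartz_jet 2 0 phi d0.
near=> psi.
have h0 : forall x, `|x ^+ 0 * derive1n 0 phi x - x ^+ 0 * derive1n 0 psi x| < d.
  by near: psi.
have h2 : forall x, `|x ^+ 2 * derive1n 0 phi x - x ^+ 2 * derive1n 0 psi x| < d.
  by near: psi.
rewrite /regular_dist -(RintegralB measurableT (iu phi) (iu psi)).
have il : mu.-integrable setT (EFin \o (fun x => u x * phi x - u x * psi x)).
  exact: integrableB (iu phi) (iu psi).
apply: (le_trans (le_normr_Rintegral measurableT il)).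
have ir := integrableZl measurableT (B * (2 * d)) (@integrable_oneDsqrV R).
apply: (@le_trans _ _ (\int[mu]_x (B * (2 * d) * (oneDsqr x)^-1))).
  apply: le_Rintegral => //; first exact: integrable_abse il.
  move=> x _; rewrite -mulrBr normrM -mulrA; apply: ler_pM => //.
  have o0 : 0 < oneDsqr x by rewrite (lt_le_trans ltr01)// oneDsqr_ge1.
  rewrite ler_pdivlMr// /oneDsqr mulrDr mulr1 mulrDl mul1r; apply: lerD.
    by have := h0 x; rewrite /= !expr0 !mul1r => /ltW.
  have := h2 x; rewrite /= -mulrBr normrM ger0_norm ?sqr_ge0// mulrC => /ltW.
  by [].
rewrite RintegralZl//; last exact: integrable_oneDsqrV.
have -> : B * (2 * d) * J = e * (B * J / (B * J + 1)).
  by rewrite /d; field; exact: lt0r_neq0.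
by apply: ler_piMr; rewrite ?(ltW e0)// ler_pdivrMr// mul1r lerDl.
Unshelve. all: by end_near. Qed.

Lemma locally_integrable_bounded (u : R -> R) (B : R) : measurable_fun setT u ->
  (forall x, `|u x| <= B) -> locally_integrable setT u.
Proof.
move=> mu_ uB; split => //; first exact: openT.
move=> K _ cK; have mK : measurable K by exact: compact_measurable.
apply: (@le_lt_trans _ _ (\int[mu]_(x in K) (cst B%:E) x)%E).
  apply: ge0_le_integral => //.
  - by apply/measurable_EFinP; apply: measurableT_comp => //; exact: measurable_funTS.
  - by move=> x _; rewrite lee_fin.
rewrite integral_cst//.
have B0 : 0 <= B by exact: le_trans (uB 0).
by rewrite lte_mul_pinfty ?lee_fin//; exact: compact_finite_measure.
Qed.

End tempered_bounded.

(** * The heat convolution and its distributional derivative *)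

Section heat_distribution.
Context {R : realType}.
Local Notation mu := (@lebesgue_measure R).
Variables (p : R) (p1 : 1 <= p).

Lemma Lfun_conv_integrable (C : R) (H k : R -> R) x : H \in Lfun mu p%:E ->
  mu.-integrable setT (EFin \o k) -> (forall y, `|k y| <= C) ->
  mu.-integrable setT (EFin \o (fun y => H y * k (x - y))).
Proof.
move=> LH ik kC.
exact: (integrable_Lfun_mul p1 LH (integrable_reflect x ik) (fun y => kC (x - y))).
Qed.

Lemma Lfun_conv_bounded (C : R) (H k : R -> R) : H \in Lfun mu p%:E ->
  mu.-integrable setT (EFin \o k) -> (forall y, `|k y| <= C) ->
  exists B, forall x, `|\int[mu]_y (H y * k (x - y))| <= B.
Proof.
move=> LH ik kC.
have iH : mu.-integrable setT (EFin \o (fun x => `|H x| `^ p)) := Lfun_integrable p1 LH.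
have ika : mu.-integrable setT (EFin \o (fun x => `|k x|)) := integrable_abse ik.
have mka := (measurable_EFinP _ _).1 (measurable_int mu ika).
exists (\int[mu]_y `|k y| + \int[mu]_y (`|H y| `^ p * C)) => x.
have iHk := Lfun_conv_integrable x LH ik kC.
have ikx := integrable_reflect x ika.
have iHC : mu.-integrable setT (EFin \o (fun y => `|H y| `^ p * C)).
  exact: (integrableZr measurableT C iH).
apply: (le_trans (le_normr_Rintegral measurableT iHk)).
have -> : \int[mu]_y `|k y| = \int[mu]_y `|k (x - y)|.
  by rewrite /Rintegral; congr fine; apply/esym/(ge0_integral_reflect x mka).
rewrite -(RintegralD measurableT ikx iHC); apply: le_Rintegral => //.
- exact: (integrable_abse iHk).
- exact: (integrableD measurableT ikx iHC).
- by move=> y _; exact: Lfun_mul_le.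
Qed.

Variables (H : R -> R) (LH : H \in Lfun mu p%:E) (t : R) (t0 : 0 < t).

Let D x := \int[mu]_y (H y * derive1 (heat_kernel t) (x - y)).

Lemma heat_conv_deriv_bounded : measurable_fun setT D /\ exists B, forall x, `|D x| <= B.
Proof.
have [C hC] := derive1_heat_kernel_bounded t0.
have ik := integrable_derive1_heat_kernel t0.
split; last exact: Lfun_conv_bounded LH ik hC.
apply: measurable_Rintegral_conv; first exact: measurable_Lfun LH.
exact: ((measurable_EFinP _ _).1 (measurable_int mu ik)).
Qed.

Lemma distribution_of_heat_conv_deriv : distribution_of D (regular_dist D).
Proof.
have [mD [B DB]] := heat_conv_deriv_bounded; split => //.
- exact: locally_integrable_bounded mD DB.
- exact: tempered_bounded mD DB.
Qed.

(** Fubini moves the convolution onto [phi], integration by parts shifts the derivative from the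
    kernel to [phi], and Fubini moves the convolution back. *)
Lemma regular_dist_heat_conv :
  regular_dist D = dist_deriv (regular_dist (heat_conv_fun H t)).
Proof.
apply/funext => phi; rewrite /dist_deriv /regular_dist /D /heat_conv_fun.
have [C hC] := derive1_heat_kernel_bounded t0.
have ik' := integrable_derive1_heat_kernel t0.
have ik := integrable_heat_kernel t0.
have kC x : `|heat_kernel t x| <= kernel_norm +oo%E t.
  by rewrite (ger0_norm (heat_kernel_ge0 _ _)) heat_kernel_le_sup.
have [B hB] := schwartz_bounded phi; have [B' hB'] := schwartz_bounded (schwartz_deriv phi).
have iphi := schwartz_integrable phi; have iphi' := schwartz_integrable (schwartz_deriv phi).
rewrite (Lfun_conv_Fubini p1 LH ik' iphi hB hC).
have iNphi' : mu.-integrable setT (EFin \o (fun x => - schwartz_deriv phi x)).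
  exact: (integrableN iphi').
have hB'N x : `|- schwartz_deriv phi x| <= B' by rewrite normrN.
have mphi' := (measurable_EFinP _ _).1 (measurable_int mu iphi').
have := Lfun_conv_Fubini p1 LH ik iNphi' hB'N kC => E.
have NE (f : R -> R) : mu.-integrable setT (EFin \o f) ->
    \int[mu]_x - f x = - \int[mu]_x f x.
  move=> i; rewrite -mulN1r -(RintegralZl (-1) measurableT i).
  by apply: eq_Rintegral => x _; rewrite mulN1r.
have [BU hBU] := Lfun_conv_bounded LH ik kC.
have mU := measurable_Rintegral_conv (measurable_Lfun LH) (measurable_heat_kernel t).
have iU : mu.-integrable setT (EFin \o (fun x =>
    (\int[mu]_y (H y * heat_kernel t (x - y))) * schwartz_deriv phi x)).
  exact: regular_dist_bounded_integrable mU hBU.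
rewrite -(NE _ iU).
transitivity (\int[mu]_y (H y * \int[mu]_x (heat_kernel t (x - y) * - schwartz_deriv phi x))).
  apply: eq_Rintegral => y _; congr (_ * _); rewrite heat_kernel_by_parts// -NE.
    by apply: eq_Rintegral => x _; rewrite mulrN.
  exact: (integrable_bounded_mul (integrable_translate y ik) mphi' hB').
by rewrite -E; apply: eq_Rintegral => x _; rewrite mulrN.
Qed.

End heat_distribution.

(** * Schwartz functions approaching indicators of intervals *)

Section bump.
Context {R : realType}.
Local Notation mu := (@lebesgue_measure R).

(** For fixed Q this class is stable under differentiation in P, so all derivatives of a bump are
    described at once. *)
Let poly_expR (P Q : {poly R}) (x : R) : R := P.[x] * expR (- Q.[x]).

Let is_derive_poly_expR (P Q : {poly R}) (x : R) :
  is_derive x (1 : R) (poly_expR P Q) (poly_expR (P^`() - P * Q^`()) Q x).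
Proof.
have dP := is_derive_poly P x.
have dQ : is_derive x (1 : R) (horner (- Q)) ((- Q)^`()).[x] := is_derive_poly (- Q) x.
have d1 := @is_derive1_comp _ expR (horner (- Q)) x _ _ (is_derive_expR _) dQ.
have d2 := is_deriveM dP d1.
rewrite (_ : poly_expR P Q = horner P * (expR \o horner (- Q))); last first.
  by apply/funext => z; rewrite /poly_expR -hornerN.
apply: (is_derive_eq d2); rewrite /GRing.scale/= /poly_expR.
rewrite derivN !hornerN hornerD hornerN hornerM; ring.
Qed.

Let derive1n_poly_expR (P Q : {poly R}) m : derive1n m (poly_expR P Q) =
  poly_expR (iter m (fun S => S^`() - S * Q^`()) P) Q.
Proof.
elim: m => // m IH; rewrite derive1nS IH/=; apply/funext => x.
by rewrite derive1E; have := is_derive_poly_expR (iter m (fun S => S^`() - S * Q^`()) P) Q x =>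
  h; exact: derive_val.
Qed.

(** The comparison y <= 1 + y^(n + 1) is uniform in n: it gives the decay of each bump and a common
    majorant of all of them. *)
Lemma expRN_even_le n (u : R) : expR (- u ^+ (2 * n.+1)) <= expR 1 * expR (- u ^+ 2).
Proof.
rewrite -expRD ler_expR exprM; set y := u ^+ 2.
have y0 : 0 <= y by exact: sqr_ge0.
suff : y <= 1 + y ^+ n.+1 by lra.
have [y1|y1] := leP y 1; first by rewrite (le_trans y1)// lerDl exprn_ge0.
rewrite (@le_trans _ _ (y ^+ n.+1))//; last by rewrite lerDr.
by rewrite ler_eXnr// ltW.
Qed.

Let poly_expR_bounded n (S : {poly R}) :
  exists M, forall u, `|S.[u] * expR (- u ^+ (2 * n.+1))| <= M.
Proof.
have mono i : exists M, forall u : R, `|u| ^+ i * expR (- u ^+ 2) <= M.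
  have [->|i0] := posnP i.
    by exists 1 => u; rewrite expr0 mul1r -expR0 ler_expR oppr_le0 sqr_ge0.
  have i0' : 0 < i%:R :> R by rewrite ltr0n.
  (* The 1 covers |u| <= 1; otherwise |u|^i <= u^(2 i) = i^i (u^2 / i)^i <= i^i exp(u^2). *)
  exists (1 + i%:R ^+ i) => u.
  have E0 : 0 < expR (u ^+ 2) by exact: expR_gt0.
  rewrite expRN ler_pdivrMr// mulrDl mul1r.
  have [u1|u1] := leP `|u| 1.
    rewrite (@le_trans _ _ 1)//; first by rewrite exprn_ile1.
    rewrite (@le_trans _ _ (expR (u ^+ 2)))//; first by rewrite -expR0 ler_expR sqr_ge0.
    by rewrite lerDl mulr_ge0 ?exprn_ge0// ltW.
  have h : (u ^+ 2 / i%:R) ^+ i <= expR (u ^+ 2).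
    have -> : expR (u ^+ 2) = expR (u ^+ 2 / i%:R) ^+ i.
      by rewrite -expRM_natl mulrC divfK// gt_eqF.
    have q0 : 0 <= u ^+ 2 / i%:R by rewrite divr_ge0 ?sqr_ge0// ltW.
    apply: lerXn2r; rewrite ?nnegrE ?expR_ge0//.
    by rewrite (le_trans _ (expR_ge1Dx _))// lerDr.
  rewrite (@le_trans _ _ (i%:R ^+ i * expR (u ^+ 2)))//; last by rewrite lerDr ltW.
  have ii0 : 0 <= i%:R ^+ i :> R by rewrite exprn_ge0.
  apply: le_trans (ler_wpM2l ii0 h).
  rewrite -exprMn mulrC divfK ?gt_eqF//.
  apply: lerXn2r; rewrite ?nnegrE ?sqr_ge0//.
  by rewrite -[u ^+ 2]real_normK ?num_real// expr2 ler_peMl// ltW.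
have [M hM] := choice mono.
exists (\sum_(i < size S) `|S`_i| * (expR 1 * M i)) => u.
rewrite horner_coef mulr_suml (le_trans (ler_norm_sum _ _ _))//.
apply: ler_sum => i _; rewrite -mulrA normrM; apply: ler_wpM2l => //.
rewrite normrM normrX (ger0_norm (expR_ge0 _)).
apply: (@le_trans _ _ (`|u| ^+ i * (expR 1 * expR (- u ^+ 2)))).
  by apply: ler_wpM2l; [exact: exprn_ge0|exact: expRN_even_le].
by rewrite mulrCA; apply: ler_wpM2l; [exact: expR_ge0|exact: hM].
Qed.

Let bump_fun n (c d : R) (x : R) : R := expR (- (d * (x - c)) ^+ (2 * n.+1)).

Let bump_subproof n (c d : R) : d != 0 -> bump_fun n c d \in schwartz_pred.
Proof.
move=> d0; pose Q := (d%:P * ('X - c%:P)) ^+ (2 * n.+1) : {poly R}.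
have QE x : Q.[x] = (d * (x - c)) ^+ (2 * n.+1).
  by rewrite horner_exp hornerM hornerC hornerXsubC.
have -> : bump_fun n c d = poly_expR 1 Q.
  by apply/funext => x; rewrite /poly_expR QE hornerC mul1r.
rewrite inE; split=> [m x|k m].
  rewrite derive1n_poly_expR.
  by case: (is_derive_poly_expR (iter m (fun S => S^`() - S * Q^`()) 1) Q x).
rewrite derive1n_poly_expR; set S := iter _ _ _.
(* The substitution x = u / d + c reduces a general center and width to the standard ones. *)
have [M hM] := poly_expR_bounded n (('X^k * S) \Po (d^-1 *: 'X + c%:P)).
exists M => x; have := hM (d * (x - c)).
rewrite horner_comp hornerD hornerZ hornerX hornerC mulKf// subrK.
by rewrite hornerM hornerXn /poly_expR QE mulrA.
Qed.

(* As n grows, this approaches the indicator of the interval of center c and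
   radius 1 / d. *)
Definition bump n (c d : R) (d0 : d != 0) : schwartz R :=
  Schwartz (bump_subproof n c d0).

Lemma bumpE n c d (d0 : d != 0) x :
  bump n c d0 x = expR (- (d * (x - c)) ^+ (2 * n.+1)).
Proof. by []. Qed.

End bump.

(** * Functions in L^p with zero distributional derivative *)

Section uniqueness.
Context {R : realType}.
Local Notation mu := (@lebesgue_measure R).
Variables (p : R) (p1 : 1 <= p) (H : R -> R) (LH : H \in Lfun mu p%:E).

Let conv (k : R -> R) (x : R) : R := \int[mu]_y (H y * k (x - y)).

(** The convolution is not differentiated: pairing the vanishing [conv (schwartz_deriv psi)] with
    the indicator of [a, b] and applying Fubini gives conv psi b - conv psi a. *)
Lemma conv_eq_cst (psi : schwartz R) :
  (forall x, conv (schwartz_deriv psi) x = 0) -> forall a b, conv psi a = conv psi b.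
Proof.
move=> h; suff main a b : a <= b -> conv psi a = conv psi b.
  by move=> a b; case: (leP a b) => [/main//|/ltW/main/esym].
move=> ab.
have [C hC] := schwartz_bounded psi; have [C' hC'] := schwartz_bounded (schwartz_deriv psi).
have ipsi := schwartz_integrable psi; have ipsi' := schwartz_integrable (schwartz_deriv psi).
have cpsi' := schwartz_continuous (phi := schwartz_deriv psi).
pose J : set R := [set` `[a, b]%R].
have iind : mu.-integrable setT (EFin \o (\1_J : R -> R)) by exact: integrable_indic_itv.
have ind1 x : `|(\1_J : R -> R) x| <= 1.
  by rewrite indicE; case: (_ \in _); rewrite ?normr0 ?normr1.
have := Lfun_conv_Fubini p1 LH ipsi' iind ind1 hC'.
have -> : \int[mu]_x ((\int[mu]_y (H y * schwartz_deriv psi (x - y))) * (\1_J : R -> R) x) = 0.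
  transitivity (\int[mu]_(x in setT) (0 : R)).
    by apply: eq_Rintegral => x _; have := h x; rewrite /conv => ->; rewrite mul0r.
  by rewrite Rintegral_cst ?mul0r.
have E y : \int[mu]_x (schwartz_deriv psi (x - y) * (\1_J : R -> R) x) = psi (b - y) - psi (a - y).
  have dT (z : R) : is_derive z (1 : R) (fun x : R => x - y) 1.
    by apply: is_derive_eq; rewrite subr0.
  have df (x : R) : is_derive x (1 : R) (fun x => psi (x - y)) (schwartz_deriv psi (x - y)).
    have d := @is_derive1_comp _ psi (fun x : R => x - y) x _ _
      (schwartz_is_derive psi (x - y)) (dT x).
    by apply: (is_derive_eq d); rewrite mulr1.
  have cf : continuous (fun x : R => schwartz_deriv psi (x - y)).
    move=> x; apply: (continuous_comp (f := fun x : R => x - y)); last exact: cpsi'.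
    by apply: cvgB; [exact: cvg_id|exact: cvg_cst].
  by rewrite -(Rintegral_is_derive ab df cf) [RHS]Rintegral_mkcond patch_indic.
have -> : \int[mu]_y (H y * \int[mu]_x (schwartz_deriv psi (x - y) * (\1_J : R -> R) x)) =
    \int[mu]_y (H y * psi (b - y) - H y * psi (a - y)).
  by apply: eq_Rintegral => y _; rewrite E mulrBr.
have iH x : mu.-integrable setT (EFin \o (fun y => H y * psi (x - y))).
  exact: (Lfun_conv_integrable p1 x LH ipsi hC).
rewrite (RintegralB measurableT (iH b) (iH a)) => /esym/eqP.
by rewrite subr_eq0 => /eqP.
Qed.

(** [young_L1] bounds the integral of the p-th power of this constant over a line of infinite
    measure. *)
Lemma conv_cst_eq0 (psi : schwartz R) : (forall x, 0 <= psi x) ->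
  (forall a b, conv psi a = conv psi b) -> forall a, conv psi a = 0.
Proof.
move=> psi0 cst_ a; have p0 : 0 < p by exact: lt_le_trans p1.
have ipsi := schwartz_integrable psi.
have mpsi := (measurable_EFinP _ _).1 (measurable_int mu ipsi).
have mH := measurable_Lfun LH.
have [al al0 alE] := Lnorm_fin_integral p0 (Lnorm_Lfun LH).
have [be beE] : exists be : R, (\int[mu]_y (psi y)%:E = be%:E)%E.
  by eexists; apply/esym/fineK; exact: (integrable_fin_num measurableT ipsi).
have := young_L1 p1 mH mpsi psi0; rewrite alE beE poweR_EFin -!EFinM.
have -> : (\int[mu]_x (`|\int[mu]_y (H y * psi (x - y))| `^ p)%:E =
    \int[mu]_(x in setT) (cst (`|conv psi a| `^ p)%:E) x)%E.
  by apply: eq_integral => x _ /=; rewrite -(cst_ x a).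
rewrite integral_cst//.
set m := (X in (_ * X <= _)%E -> _); have -> : m = +oo%E.
  have := @lebesgue_measure_itv R `]-oo, +oo[%R; rewrite set_itvE /= => e; exact: e.
have [->//|c0] := eqVneq (conv psi a) 0.
rewrite gt0_muley ?lte_fin ?powR_gt0 ?normr_gt0//.
Qed.

Lemma bump_reflect n d (d0 : d != 0) (c y : R) : bump n c d0 y = bump n 0 d0 (c - y).
Proof.
have E : (d * (y - c)) ^+ 2 = (d * (c - y)) ^+ 2 by ring.
by rewrite !bumpE subr0 !exprM E.
Qed.

Lemma schwartz_deriv_bump n d (d0 : d != 0) (c y : R) :
  schwartz_deriv (bump n c d0) y = - schwartz_deriv (bump n 0 d0) (c - y).
Proof.
have dT : is_derive y (1 : R) (fun y : R => c - y) (-1).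
  by apply: is_derive_eq; rewrite add0r mul1r.
have d1 := @is_derive1_comp _ (schwartz_fun (bump n 0 d0)) (fun y : R => c - y) y _ _
  (schwartz_is_derive (bump n 0 d0) (c - y)) dT.
have E : (bump n c d0 : R -> R) = bump n 0 d0 \o (fun y => c - y).
  by apply/funext => z /=; exact: bump_reflect.
transitivity (derive1 (bump n c d0 : R -> R) y); first by [].
by rewrite E derive1E (@derive_val _ _ _ _ _ _ _ d1) mulrN1.
Qed.

Lemma conv_bump_eq0 n d (d0 : d != 0) (c : R) :
  (forall phi : schwartz R, \int[mu]_x (H x * schwartz_deriv phi x) = 0) ->
  conv (bump n 0 d0) c = 0.
Proof.
move=> h; apply: conv_cst_eq0; first by move=> x; exact: expR_ge0.
apply: conv_eq_cst => x; have := h (bump n x d0).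
have [C hC] := schwartz_bounded (schwartz_deriv (bump n 0 d0)).
have i := Lfun_conv_integrable p1 x LH (schwartz_integrable _) hC.
have -> : \int[mu]_y (H y * schwartz_deriv (bump n x d0) y) =
    \int[mu]_y (-1 * (H y * schwartz_deriv (bump n 0 d0) (x - y))).
  by apply: eq_Rintegral => y _; rewrite schwartz_deriv_bump mulN1r mulrN.
by rewrite (RintegralZl (-1) measurableT i) mulN1r => /eqP; rewrite oppr_eq0 => /eqP.
Qed.

(** The bumps of center c and radius r integrate to 0 against H and converge almost everywhere to
    the indicator of the ball, under a multiple of the first bump. *)
Lemma ball_integral_eq0 (c r : R) : 0 < r ->
  (forall phi : schwartz R, \int[mu]_x (H x * schwartz_deriv phi x) = 0) ->
  \int[mu]_(x in ball c r) H x = 0.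
Proof.
move=> r0 h; have d0 : r^-1 != 0 by rewrite invr_neq0// gt_eqF.
have mH := measurable_Lfun LH.
pose b n (y : R) := bump n 0 d0 (c - y).
have bE n y : b n y = expR (- (r^-1 * (c - y)) ^+ (2 * n.+1)) by rewrite /b bumpE subr0.
have mb n : measurable_fun setT (b n).
  have := integrable_reflect c (schwartz_integrable (bump n 0 d0)).
  by move=> /measurable_int /measurable_EFinP.
pose g n (y : R) := (H y * b n y)%:E.
pose B : set R := ball c r.
have mB : measurable B by exact: measurable_ball.
have mg n : measurable_fun setT (g n).
  by apply/measurable_EFinP; exact: measurable_funM.
have [C hC] := schwartz_bounded (bump 0 0 d0).
have iHb := integrable_abse (Lfun_conv_integrable p1 c LH (schwartz_integrable _) hC).
have ib0 : mu.-integrable setT (EFin \o (fun y => expR 1 * `|H y * b 0%N y|)).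
  exact: (integrableZl measurableT (expR 1) iHb).
pose f (y : R) : \bar R := (H y * (\1_B : R -> R) y)%:E.
have mf : measurable_fun setT f.
  by apply/measurable_EFinP; apply: measurable_funM => //; exact: measurable_indic.
(* The two end points are excluded: there every bump equals exp(-1). *)
have gf : \forall y \ae mu, setT y -> g ^~ y @ \oo --> f y.
  exists [set c - r; c + r]; split.
  - by apply: measurableU; exact: measurable_set1.
  - by apply: countable_lebesgue_measure0; exact: finite_set_countable.
  - move=> y /=; apply: contra_notP => /not_orP[yl yr] _.
    have yr0 : `|c - y| != r.
      apply/eqP => e; have /eqP := e; rewrite eqr_norml => /andP[/orP[|] /eqP e' _].
        by apply: yl; rewrite -e'; ring.
      by apply: yr; rewrite -[r]opprK -e'; ring.
    pose z := (r^-1 * (c - y)) ^+ 2.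
    have zE : z = (`|c - y| / r) ^+ 2.
      by rewrite /z exprMn [RHS]exprMn real_normK ?num_real// mulrC.
    have z0 : 0 <= z by exact: sqr_ge0.
    have q0 : 0 <= `|c - y| / r by rewrite divr_ge0// ltW.
    apply: cvg_EFin; first exact: nearW.
    apply: cvgM; first exact: cvg_cst.
    have -> : b ^~ y = fun n => expR (- z ^+ n.+1).
      by apply/funext => n; rewrite bE exprM.
    have shift (w : R) : 0 <= w -> w < 1 -> w ^+ n.+1 @[n --> \oo] --> 0.
      by move=> w0 w1; rewrite (cvg_shiftS (fun n => w ^+ n)); apply: cvg_expr; rewrite ger0_norm.
    rewrite indicE; have [yB|yB] := ltP `|c - y| r.
      rewrite mem_set//=.
      have z1 : z < 1.
        by rewrite zE exprn_ilt1// ltr_pdivrMr ?mul1r.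
      have c1 : (fun n => - z ^+ n.+1) @ \oo --> (- 0 : R) by apply: cvgN; exact: shift.
      by have := cvg_comp _ _ c1 (@continuous_expR R _); rewrite oppr0 expR0.
    rewrite memNset/=; last by apply/negP; rewrite -leNgt.
    have z1 : 1 < z.
      by rewrite zE exprn_egt1// ltr_pdivlMr ?mul1r// lt_neqAle eq_sym yr0.
    apply: (@squeeze_cvgr _ _ _ _ (cst 0) (fun n => z^-1 ^+ n.+1)).
    - apply: nearW => n; rewrite expR_ge0/= expRN exprVn lef_pV2 ?posrE ?expR_gt0//.
        by rewrite (le_trans _ (expR_ge1Dx _))// lerDr.
      by rewrite exprn_gt0// (lt_trans _ z1).
    - exact: cvg_cst.
    - by apply: shift; [rewrite invr_ge0|rewrite invf_lt1// (lt_trans _ z1)].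
have gle : \forall y \ae mu, forall n, setT y ->
    (`|g n y| <= (EFin \o (fun y => expR 1 * `|H y * b 0%N y|)%R) y)%E.
  apply: nearW => y n _; rewrite /g /= lee_fin !normrM [leRHS]mulrCA.
  apply: ler_wpM2l => //; rewrite !bE !(ger0_norm (expR_ge0 _)).
  exact: expRN_even_le.
have [_ _] := @dominated_convergence _ _ _ mu setT measurableT g f _ mg mf gf ib0 gle.
have -> : (fun n => \int[mu]_x g n x)%E = cst 0%E.
  apply/funext => n; have i := Lfun_conv_integrable p1 c LH (schwartz_integrable _)
    (proj2_sig (cid (schwartz_bounded (bump n 0 d0)))).
  rewrite -[LHS]fineK; last exact: (integrable_fin_num measurableT i).
  by congr EFin; exact: (conv_bump_eq0 n d0 c h).
move=> c0; have e0 : (\int[mu]_x f x = 0)%E.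
  exact: (cvg_unique (@ereal_hausdorff R) c0 (cvg_cst _)).
rewrite Rintegral_mkcond patch_indic /Rintegral.
by rewrite [X in fine X]e0.
Qed.

End uniqueness.

(** * Uniqueness of primitives and the norm *)

Section primitives.
Context {R : realType}.
Local Notation mu := (@lebesgue_measure R).
Variables (p : R) (p1 : 1 <= p).

Lemma integrable_cst_finite (c : R) (A : set R) : measurable A -> (mu A < +oo)%E ->
  mu.-integrable A (EFin \o (cst c : R -> R)).
Proof.
move=> mA Afin; apply/integrableP; split; first exact/measurable_EFinP.
rewrite (_ : (fun x => _) = cst (`|c|%:E)) ?integral_cst//.
by rewrite lte_mul_pinfty ?lee_fin.
Qed.

Lemma Lfun_integrable_finite (H : R -> R) (A : set R) : H \in Lfun mu p%:E ->
  measurable A -> (mu A < +oo)%E -> mu.-integrable A (EFin \o H).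
Proof.
move=> LH mA Afin; have mH := measurable_Lfun LH.
have iHT : mu.-integrable setT (EFin \o (fun x => `|H x| `^ p)) := Lfun_integrable p1 LH.
have iH : mu.-integrable A (EFin \o (fun x => `|H x| `^ p)).
  exact: (@integrableS _ _ _ mu setT A _ measurableT mA (@subsetT _ A) iHT).
have i1 := integrable_cst_finite 1 mA Afin.
have i2 := @integrableD _ _ _ mu A mA _ _ i1 iH.
apply: le_integrable i2 => //.
  by apply/measurable_EFinP; exact: measurable_funTS.
move=> x _ /=; by rewrite lee_fin [leRHS]ger0_norm ?norm_le_powR// addr_ge0 ?powR_ge0.
Qed.

Lemma locally_integrable_Lfun (H : R -> R) : H \in Lfun mu p%:E -> locally_integrable setT H.
Proof.
move=> LH; split; [exact: measurable_Lfun LH|exact: openT|move=> K _ cK].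
have := Lfun_integrable_finite LH (compact_measurable cK) (compact_finite_measure cK).
by move=> /integrableP[].
Qed.

(** If H has mean 0 over the ball, then H x is the mean of H x - H, hence is bounded by the mean
    oscillation [davg]. *)
Lemma le_davg (H : R -> R) (x r : R) : 0 < r -> H \in Lfun mu p%:E ->
  \int[mu]_(y in ball x r) H y = 0 -> (`|H x|%:E <= davg H x r)%E.
Proof.
move=> r0 LH H0.
have mB : measurable (ball x r : set R) by exact: measurable_ball.
have muB : mu (ball x r) = (r *+ 2)%:E by exact: lebesgue_measure_ball (ltW r0).
have Bfin : (mu (ball x r) < +oo)%E by rewrite muB ltry.
have iH := Lfun_integrable_finite LH mB Bfin.
have ic := integrable_cst_finite (H x) mB Bfin.
have iB : mu.-integrable (ball x r) (EFin \o (fun y => H y - H x)).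
  exact: (@integrableB _ _ _ mu _ mB _ _ iH ic).
have := @le_normr_Rintegral _ _ _ mu _ _ mB iB.
rewrite (@RintegralB _ _ _ mu _ _ _ mB iH ic) H0 sub0r normrN.
rewrite Rintegral_cst// normrM => h.
rewrite /davg /iavg.
have -> : (\int[mu]_(y in ball x r) `|((shift (- H x) \o H) y)%:E| =
    (\int[mu]_(y in ball x r) `|H y - H x|)%:E)%E.
  rewrite /Rintegral fineK//.
  exact: (@integrable_fin_num _ _ _ mu _ mB _ (integrable_abse iB)).
have r20 : 0 < r *+ 2 by rewrite mulrn_wgt0.
have fE : `|fine (mu (ball x r))| = r *+ 2 by rewrite muB /= (ger0_norm (ltW r20)).
rewrite muB; move: h; rewrite [X in _ * X <= _](_ : _ = r *+ 2) => [h|]; last exact: fE.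
by rewrite inver gt_eqF// -EFinM lee_fin mulrC ler_pdivlMr.
Qed.

(** Almost every x is a Lebesgue point, where [davg] tends to 0 with the radius while staying above
    |H x|. *)
Lemma Lfun_eq0_ae (H : R -> R) : H \in Lfun mu p%:E ->
  (forall phi : schwartz R, \int[mu]_x (H x * schwartz_deriv phi x) = 0) ->
  \forall x \ae mu, H x = 0.
Proof.
move=> LH h; have [N [mN N0 sub]] := lebesgue_differentiation (locally_integrable_Lfun LH).
exists N; split => // x /=; apply: contra_notP => xN.
have {sub xN} : lebesgue_pt H x by apply: contrapT => /sub.
rewrite /lebesgue_pt => c.
have : (`|H x|%:E <= 0)%E.
  apply: cvge_ge c; near=> r; have r0 : 0 < r by [].
  exact: le_davg r0 LH (ball_integral_eq0 p1 LH x r0 h).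
by rewrite lee_fin normr_le0 => /eqP.
Unshelve. all: by end_near. Qed.

Lemma ae_eq_Lnorm (F G : R -> R) : measurable_fun setT F -> measurable_fun setT G ->
  (\forall x \ae mu, F x = G x) ->
  'N[mu]_p%:E[EFin \o F]%E = 'N[mu]_p%:E[EFin \o G]%E.
Proof.
move=> mF mG [N [mN N0 sub]]; rewrite (Lnorm_EFin p F) (Lnorm_EFin p G).
have m (K : R -> R) : measurable_fun setT K -> measurable_fun setT (fun x => (`|K x| `^ p)%:E).
  move=> mK; apply/measurable_EFinP; apply: (measurableT_comp (measurable_powR p)).
  exact: measurableT_comp.
suff -> : (\int[mu]_x (`|F x| `^ p)%:E = \int[mu]_x (`|G x| `^ p)%:E)%E by [].
apply: ae_eq_integral; [exact: measurableT|exact: m|exact: m|].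
by exists N; split => // x /= h; apply: sub => /= e; apply: h => _; rewrite e.
Qed.

Lemma Lfun_sub (F G : R -> R) : F \in Lfun mu p%:E -> G \in Lfun mu p%:E ->
  F \- G \in Lfun mu p%:E.
Proof.
move=> LF LG; have p1' : (1 <= p%:E)%E by rewrite lee_fin.
have [_ +] := Lfun_addr_closed mu p1'; apply => //.
exact: Lfun_oppr_closed.
Qed.

Lemma Lfun_schwartz_integrable (F : R -> R) (phi : schwartz R) : F \in Lfun mu p%:E ->
  mu.-integrable setT (EFin \o (F \* phi)).
Proof.
move=> LF; have [C hC] := schwartz_bounded phi.
exact: integrable_Lfun_mul p1 LF (schwartz_integrable phi) hC.
Qed.

Lemma is_primitiveB (f g : schwartz R -> R) (F G : R -> R) :
  is_primitive p f F -> is_primitive p g G -> is_primitive p (f \- g) (F \- G).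
Proof.
move=> [LF ->] [LG ->]; split; first exact: Lfun_sub.
apply/funext => phi; rewrite /dist_deriv /regular_dist /=.
have iF := Lfun_schwartz_integrable (schwartz_deriv phi) LF.
have iG := Lfun_schwartz_integrable (schwartz_deriv phi) LG.
rewrite -opprB opprK addrC -(RintegralB measurableT iF iG); congr (- _).
by apply: eq_Rintegral => x _ /=; rewrite mulrBl.
Qed.

Lemma is_primitive_Lnorm (f : schwartz R -> R) (F G : R -> R) :
  is_primitive p f F -> is_primitive p f G ->
  'N[mu]_p%:E[EFin \o F]%E = 'N[mu]_p%:E[EFin \o G]%E.
Proof.
move=> fF fG; have [LF _] := fF; have [LG _] := fG.
have [LB eB] := is_primitiveB fF fG.
apply: ae_eq_Lnorm; [exact: measurable_Lfun LF|exact: measurable_Lfun LG|].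
have h (phi : schwartz R) : \int[mu]_x ((F \- G) x * schwartz_deriv phi x) = 0.
  have := congr1 (fun T => T phi) eB; rewrite /dist_deriv /regular_dist /= subrr.
  by move=> /esym/eqP; rewrite oppr_eq0 => /eqP.
have [N [mN N0 sub]] := Lfun_eq0_ae LB h.
exists N; split => // x /= FGx; apply: sub => /= /eqP.
by rewrite subr_eq0 => /eqP.
Qed.

Lemma Lprime_is_primitive (f : schwartz R -> R) : Lprime p f ->
  is_primitive p f (primitive p f).
Proof. by move=> [_ [F fF]]; exact: (xgetPex (cst 0) (ex_intro _ F fF)). Qed.

(** The representative picked by [primitive] may differ from [F] on a null set, which the norm does
    not see. *)
Lemma Lprime_normE (f : schwartz R -> R) (F : R -> R) : is_primitive p f F ->
  Lprime_norm p f = 'N[mu]_p%:E[EFin \o F]%E.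
Proof.
move=> fF; apply: (is_primitive_Lnorm (f := f) _ fF).
exact: (xgetPex (cst 0) (ex_intro (is_primitive p f) F fF)).
Qed.

Lemma Lprime_normB (f g : schwartz R -> R) : Lprime p f -> Lprime p g ->
  Lprime_norm p (f \- g) = 'N[mu]_p%:E[EFin \o (primitive p f \- primitive p g)%R]%E.
Proof.
by move=> /Lprime_is_primitive fF /Lprime_is_primitive gG; exact: Lprime_normE (is_primitiveB fF gG).
Qed.

Lemma Lprime_normBC (f g : schwartz R -> R) : Lprime p f -> Lprime p g ->
  Lprime_norm p (f \- g) = Lprime_norm p (g \- f).
Proof.
move=> fL gL; rewrite !Lprime_normB// -oppe_Lnorm; apply: eq_Lnorm => x /=.
by rewrite opprB.
Qed.

Lemma Lprime_norm_triangle (f g h : schwartz R -> R) :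
  Lprime p f -> Lprime p g -> Lprime p h ->
  (Lprime_norm p (f \- h)%R <= Lprime_norm p (f \- g)%R + Lprime_norm p (g \- h)%R)%E.
Proof.
move=> fL gL hL; rewrite !Lprime_normB//.
have [LF _] := Lprime_is_primitive fL; have [LG _] := Lprime_is_primitive gL.
have [LK _] := Lprime_is_primitive hL.
set F := primitive p f; set G := primitive p g; set K := primitive p h.
rewrite (_ : F \- K = (F \- G) \+ (G \- K)); last first.
  by apply/funext => x /=; rewrite addrA subrK.
apply: minkowski_EFin => //; apply: measurable_funB;
  by [exact: measurable_Lfun LF|exact: measurable_Lfun LG|exact: measurable_Lfun LK].
Qed.

End primitives.

(** * Differences of heat convolutions *)

Section heat_difference.
Context {R : realType}.
Local Notation mu := (@lebesgue_measure R).
Variables (p : R) (p1 : 1 <= p) (f g : schwartz R -> R).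
Hypotheses (fL : Lprime p f) (gL : Lprime p g).
Variables (t : R) (t0 : 0 < t).

Let H : R -> R := primitive p f \- primitive p g.

Let LH : H \in Lfun mu p%:E.
Proof.
have [LF _] := Lprime_is_primitive fL; have [LG _] := Lprime_is_primitive gL.
exact: Lfun_sub.
Qed.

(** The difference may be taken under the integral because the derivative of the kernel is bounded
    and integrable, so both integrals converge. *)
Lemma heat_diffE :
  heat_diff p f g t = fun x => \int[mu]_y (H y * derive1 (heat_kernel t) (x - y)).
Proof.
have [LF _] := Lprime_is_primitive fL; have [LG _] := Lprime_is_primitive gL.
have ik := integrable_derive1_heat_kernel t0.
have [C hC] := derive1_heat_kernel_bounded t0.
apply/funext => x; rewrite /heat_diff /heat_conv /=.
have iF := Lfun_conv_integrable p1 x LF ik hC.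
have iG := Lfun_conv_integrable p1 x LG ik hC.
rewrite -(RintegralB measurableT iF iG).
by apply: eq_Rintegral => y _; rewrite /H /= mulrBl.
Qed.

Lemma is_primitive_heat_diff (r : R) (q : \bar R) : 1 <= r -> (1 <= q)%E ->
  ((p%:E)^-1 + q^-1 = 1 + (r%:E)^-1)%E ->
  is_primitive r (regular_dist (heat_diff p f g t)) (heat_conv_fun H t).
Proof.
move=> r1 q1 pqr; split; last by rewrite heat_diffE; exact: (regular_dist_heat_conv p1 LH t0).
by apply: (Lfun_heat_conv p1 q1 _ pqr t0 LH); rewrite lee_fin.
Qed.

Lemma distribution_of_heat_diff :
  distribution_of (heat_diff p f g t) (regular_dist (heat_diff p f g t)).
Proof. by rewrite heat_diffE; exact: (distribution_of_heat_conv_deriv p1 LH t0). Qed.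

Lemma Lprime_heat_diff (r : R) (q : \bar R) : 1 <= r -> (1 <= q)%E ->
  ((p%:E)^-1 + q^-1 = 1 + (r%:E)^-1)%E ->
  Lprime r (regular_dist (heat_diff p f g t)).
Proof.
move=> r1 q1 pqr; have [_ tD _] := distribution_of_heat_diff; split; first exact: tD.
by exists (heat_conv_fun H t); exact: is_primitive_heat_diff pqr.
Qed.

Lemma heat_diff_norm_le (q r : \bar R) : (1 <= q)%E -> (1 <= r)%E ->
  ((p%:E)^-1 + q^-1 = 1 + r^-1)%E ->
  (heat_diff_norm p f g t r <= (young_K p%:E q r)%:E * Lprime_norm p (f \- g)%R *
    (t `^ (- ((1 - fine (q^-1)%E) / 2)))%:E)%E.
Proof.
move=> q1 r1 pqr; rewrite (Lprime_normB p1 fL gL) -/H.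
have := young_heat p1 q1 r1 pqr t0 (measurable_Lfun LH) (Lnorm_Lfun LH).
(* For r = +oo [heat_diff_norm] is already the norm bounded by [young_heat]; a finite r requires the
   primitive to be identified first. *)
case: r r1 pqr => [r r1 pqr|//|//]; rewrite /heat_diff_norm.
by rewrite (Lprime_normE _ (is_primitive_heat_diff _ q1 pqr)).
Qed.

End heat_difference.

Theorem proposition2p4 (R : realType) (p : R) (f g : schwartz R -> R) :
  1 <= p -> Lprime p f -> Lprime p g ->
  (* (a) *)
  (forall q r : \bar R, (1 <= q)%E -> (1 <= r)%E ->
     ((p%:E)^-1 + q^-1 = 1 + r^-1)%E ->
     forall t : R, 0 < t ->
       (forall r' : R, r = r'%:E ->
          distribution_of (heat_diff p f g t)
            (regular_dist (heat_diff p f g t)) /\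
          Lprime r' (regular_dist (heat_diff p f g t))) /\
       (heat_diff_norm p f g t r <=
          (young_K p%:E q r)%:E * Lprime_norm p (f \- g)%R *
          (t `^ (- ((1 - fine (q^-1)%E) / 2)))%:E)%E) /\
  (* (a) with r = p and q = 1 *)
  (forall t : R, 0 < t ->
     (Lprime_norm p (regular_dist (heat_diff p f g t)) <=
        Lprime_norm p (f \- g)%R)%E) /\
  (* (b) *)
  (forall (v w : R -> R -> R) (V W : R -> schwartz R -> R) (eps : R),
     (forall t, 0 < t ->
        distribution_of (fun x => v x t) (V t) /\ Lprime p (V t)) ->
     (forall t, 0 < t ->
        distribution_of (fun x => w x t) (W t) /\ Lprime p (W t)) ->
     0 < eps ->
     Lprime_norm p (V t \- f) @[t --> 0^'+] --> 0%E ->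
     Lprime_norm p (W t \- g) @[t --> 0^'+] --> 0%E ->
     (Lprime_norm p (f \- g)%R < eps%:E)%E ->
     \forall t \near 0^'+,
       (Lprime_norm p (V t \- W t)%R < (2 * eps)%:E)%E).
Proof.
move=> p1 fL gL; split; last split.
- move=> q r q1 r1 pqr t t0; split; last exact: heat_diff_norm_le.
  move=> r' rE; rewrite rE in r1 pqr; rewrite lee_fin in r1.
  split; first exact: distribution_of_heat_diff.
  exact: (Lprime_heat_diff p1 fL gL t0 r1 q1 pqr).
- move=> t t0.
  have p1e : (1 <= p%:E)%E by rewrite lee_fin.
  have pq : ((p%:E)^-1 + 1^-1 = 1 + (p%:E)^-1 :> \bar R)%E by rewrite inve1 addeC.
  have := heat_diff_norm_le p1 fL gL t0 (lexx (1 : \bar R)%E) p1e pq.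
  by rewrite young_K_diag// inve1 /= subrr mul0r oppr0 powRr0 mule1 mul1e.
- move=> v w V W eps hV hW eps0 cV cW fg.
  (* The budget is eps / 2 for [V t] against [f], eps for [f] against [g], and eps / 2 for [W t]
     against [g]. *)
  have e2 : (0 < (eps / 2)%:E)%E by rewrite lte_fin divr_gt0.
  have nV : \forall t \near 0^'+, (Lprime_norm p (V t \- f)%R < (eps / 2)%:E)%E.
    exact: (cV _ (open_ereal_lt' e2)).
  have nW : \forall t \near 0^'+, (Lprime_norm p (W t \- g)%R < (eps / 2)%:E)%E.
    exact: (cW _ (open_ereal_lt' e2)).
  near=> t; have t0 : 0 < t by [].
  have [_ VL] := hV t t0; have [_ WL] := hW t t0.
  apply: (le_lt_trans (Lprime_norm_triangle p1 VL fL WL)).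
  have ht : (Lprime_norm p (f \- W t)%R < eps%:E + (eps / 2)%:E)%E.
    apply: (le_lt_trans (Lprime_norm_triangle p1 fL gL WL)).
    rewrite lteD//; rewrite Lprime_normBC//.
    by near: t.
  have -> : (2 * eps)%:E = ((eps / 2)%:E + (eps%:E + (eps / 2)%:E))%E.
    by rewrite -!EFinD; congr EFin; field.
  by rewrite lteD//; near: t.
Unshelve. all: by end_near. Qed.
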